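(* Let $r\ge 2$ be an integer, fix $p\in\mathbb{Z}$, let $\boldsymbol\alpha=(\alpha_1,\dots,\alpha_r)\in\mathbb{C}^r$, $\boldsymbol\beta=(\beta_1,\dots,\beta_r)\in\mathbb{C}^r$, $\mathbf n=(n_1,\dots,n_r)\in\mathbb{Z}^r$, $\mathbf m=(m_1,\dots,m_r)\in\mathbb{Z}^r$. Assume that $\alpha_2=\alpha_1+p$ and that $\alpha_i-\alpha_j\notin\mathbb{Z}$ for every pair $\{i,j\}\neq\{1,2\}$. Put $\mathcal A=1-\boldsymbol\alpha_{[1,2]}+\alpha_1+p$ (a vector of dimension $r-2$) and $\mathcal B=1-\boldsymbol\beta+\alpha_1+p$ (a vector of dimension $r$), and suppose that these two vectors contain no integer components. Then for $0<|z|<1$ $$ \begin{aligned} &\phi\!\left(\begin{matrix}\mathcal B+\mathbf m-n_2\\ 1+p+n_1-n_2,\ \mathcal A+\mathbf n_{[1,2]}-n_2\end{matrix}\middle| z\right)\sum_{k=0}^\infty\big[\Psi_1(k)z^p+\Psi_2(k)\big]z^{k-n_2}\\ &\quad+\phi\!\left(\begin{matrix}1-\mathcal B+p\\ 1+p,\ 2-\mathcal A+p\end{matrix}\middle| z\right)\sum_{k=0}^\infty\big[\Psi_3(k)z^{p+n_1-n_2}-\Psi_4(k)\big]z^{k-n_1}\\ &=(-1)^{r+p}\pi^2\,\frac{\sin(\pi\mathcal A)}{\sin(\pi\mathcal B)}\bigg(\frac{1}{(1-z)^{e+1}}\sum_{j=-n_{\max}}^{e-m_{\min}}\Delta_j z^j-V_3(z)\bigg)\\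 &\quad+\pi z^{p-n_2}\bigg[\sum_{\eta\in\mathcal A}\cot\pi\eta-\sum_{\delta\in\mathcal B}\cot\pi\delta\bigg]\phi\!\left(\begin{matrix}1-\mathcal B+p\\ 1+p,\ 2-\mathcal A+p\end{matrix}\middle| z\right)\phi\!\left(\begin{matrix}\mathcal B+\mathbf m-n_2\\ 1+p+n_1-n_2,\ \mathcal A+\mathbf n_{[1,2]}-n_2\end{matrix}\middle| z\right), \end{aligned} $$ where $$ \Psi_1(k)=\frac{\psi(1+p+k)\,\Gamma(1-\mathcal B+p+k)}{\Gamma(1+p+k)\,\Gamma(2-\mathcal A+p+k)\,k!}, $$ $$ \Psi_2(k)=\frac{\Gamma(1-\mathcal B+k)}{\Gamma(1-p+k)\Gamma(2-\mathcal A+k)\,k!}\Big\{\psi(1-p+k)+\psi(2-\mathcal A+k)-\psi(1-\mathcal B+k)\Big\}, $$ $$ \begin{aligned} \Psi_3(k)={}&\frac{\Gamma(\mathcal B+\mathbf m+k-n_2)}{\Gamma(1+p+k+n_1-n_2)\,\Gamma(\mathcal A+k+\mathbf n_{[1,2]}-n_2)\,k!}\\ &\times\Big\{\psi(\mathcal B+\mathbf m+k-n_2)-\psi(1+p+n_1-n_2+k)-\psi(\mathcal A+\mathbf n_{[1,2]}-n_2+k)\Big\}, \end{aligned} $$ $$ \Psi_4(k)=\frac{\psi(1-p+k+n_2-n_1)\,\Gamma(\mathcal B-p+\mathbf m+k-n_1)}{\Gamma(1-p+k+n_2-n_1)\,\Gamma(\mathcal A-p+k+\mathbf n_{[1,2]}-n_1)\,k!}.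 $$
   Context: **Digamma.** $\psi=\Gamma'/\Gamma$. At poles of $\Gamma$: for $n\in\{0,1,2,\dots\}$, $1/\Gamma(-n)=0$ and $\psi(-n)/\Gamma(-n)$ is read as its continuous value $(-1)^{n+1}n!$. **Vectors.** Sums of a vector and a scalar, and sums of vectors, are componentwise. For a vector $\mathbf x=(x_1,\dots,x_d)$: $\Gamma(\mathbf x)=\prod_i\Gamma(x_i)$, $\sin(\mathbf x)=\prod_i\sin x_i$, $\psi(\mathbf x)=\sum_i\psi(x_i)$. Empty sums are $0$, empty products are $1$. $\mathbf x_{[i]}$ and $\mathbf x_{[1,2]}$ denote $\mathbf x$ with component $i$, respectively components $1$ and $2$, removed. For an integer $n$, $(x)_n=\Gamma(x+n)/\Gamma(x)$; for a vector $\mathbf x$ and an integer vector $\mathbf k$ of the same length, $(\mathbf x)_{\mathbf k}=\prod_i(x_i)_{k_i}$; for an integer $k$, $(\mathbf x)_k=\prod_i(x_i)_k$. **Integers.** $M=m_1+\dots+m_r$, $N=n_1+\dots+n_r$, $e=\max\{-1,M-N-r+1\}$, $m_{\min}=\min_i m_i$, $n_{\max}=\max_i n_i$. **Hypergeometric functions.** $F\!\left(\begin{smallmatrix}\mathbf x\\ \mathbf y\end{smallmatrix}\middle|z\right)=\sum_{k\ge0}\frac{(\mathbf x)_k}{(\mathbf y)_k}\frac{z^k}{k!}$ is the generalized hypergeometric series; if $z$ is omitted then $z=1$. The regularized version is $\phi\!\left(\begin{smallmatrix}\mathbf x\\ \mathbf y\end{smallmatrix}\middle|z\right)=\sum_{k\ge0}\frac{\Gamma(\mathbf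 x+k)}{\Gamma(\mathbf y+k)}\frac{z^k}{k!}$ (well defined also if components of $\mathbf y$ are non-positive integers). **$V_3$.** $$V_3(z)=\sum_{i=3}^r\frac{(1-\boldsymbol\beta+\alpha_i)_{\mathbf m-n_i}\,z^{-n_i}}{(\alpha_i-\boldsymbol\alpha_{[i]})_{\mathbf n_{[i]}-n_i+1}}F\!\left(\begin{matrix}\boldsymbol\beta-\alpha_i\\1+\boldsymbol\alpha_{[i]}-\alpha_i\end{matrix}\middle|z\right)F\!\left(\begin{matrix}1-\boldsymbol\beta+\alpha_i+\mathbf m-n_i\\1-\boldsymbol\alpha_{[i]}+\alpha_i+\mathbf n_{[i]}-n_i\end{matrix}\middle|z\right)$$ (zero if $r=2$). The identity is read for parameters at which the Pochhammer symbols appearing in $V_3$ are finite. **$\Delta_j$.** For $\boldsymbol\alpha$ with components distinct modulo integers, $$\Delta_j=\sum_{\ell=\max(-n_{\max},\,j-e-1)}^{j}\binom{e+1}{j-\ell}(-1)^{j-\ell}\sum_{i=1}^r\frac{(1-\boldsymbol\beta+\alpha_i)_{\mathbf m+\ell}}{(\alpha_i-\boldsymbol\alpha_{[i]})_{\mathbf n_{[i]}+\ell+1}\,(\ell+n_i)!}\,{}_{2r}F_{2r-1}\!\left(\begin{matrix}-\ell-n_i,\ \boldsymbol\beta-\alpha_i,\ \boldsymbol\alpha_{[i]}-\alpha_i-\mathbf n_{[i]}-\ell\\ \boldsymbol\beta-\alpha_i-\mathbf m-\ell,\ 1+\boldsymbol\alpha_{[i]}-\alpha_i\end{matrix}\right),$$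 where terms with $\ell+n_i<0$ are zero. In the claim, where $\alpha_2=\alpha_1+p$, $\Delta_j$ denotes the continuous limit of this expression as $\alpha_2\to\alpha_1+p$ (all other parameters fixed). The sum over $j$ is zero if $e-m_{\min}<-n_{\max}$. *)

(* Defs.v *)
From HB Require Import structures.
From mathcomp Require Import all_boot all_order all_algebra.
From mathcomp Require Import all_classical all_reals all_analysis.
From mathcomp Require Import complex.

Set Implicit Arguments.
Unset Strict Implicit.
Unset Printing Implicit Defensive.

Import Order.TTheory GRing.Theory Num.Theory.
Import numFieldNormedType.Exports.

Local Open Scope classical_set_scope.
Local Open Scope complex_scope.
Local Open Scope ring_scope.

(* [R[i]] packed as a [numClosedFieldType]: in this form it inherits the
   topology and the normed-space structure that MathComp-Analysis puts on every
   [numFieldType], so [lim] and [derive1] are the complex limit and the complex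
   derivative. *)
Definition CC (R : realType) : numClosedFieldType := R[i].

Definition Cpi (R : realType) : CC R := (pi : R)%:C.

Definition Cexp (R : realType) (x : CC R) : CC R :=
  (expR (complex.Re x))%:C * (cos (complex.Im x) +i* sin (complex.Im x)).

Definition Ci (R : realType) : CC R := 0 +i* 1.

Definition Csin (R : realType) (x : CC R) : CC R :=
  (Cexp (Ci R * x) - Cexp (- (Ci R * x))) / (2 * Ci R).

Definition Ccos (R : realType) (x : CC R) : CC R :=
  (Cexp (Ci R * x) + Cexp (- (Ci R * x))) / 2.

Definition Ccot (R : realType) (x : CC R) : CC R := Ccos x / Csin x.

Definition is_integer (R : realType) (x : CC R) : Prop :=
  exists k : int, x = k%:~R.

Definition is_nonpos_integer (R : realType) (x : CC R) : Prop :=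
  exists k : nat, x = - k%:R.

(* Gauss' product: Gamma x = lim_k k! k^x / (x (x + 1) ... (x + k)).
   At a pole the sequence is eventually 0, because 0^-1 = 0 in MathComp; hence
   [Gamma x = 0] and [(Gamma x)^-1 = 0] there, so that [(Gamma x)^-1] is the
   entire function 1/Gamma.  [Gamma] itself is only meaningful off the poles. *)
Definition Gamma (R : realType) (x : CC R) : CC R :=
  limn (fun k : nat => k`!%:R * Cexp (x * (ln (k%:R : R))%:C)
                         / \prod_(i < k.+1) (x + i%:R) : CC R).

Definition psi (R : realType) (x : CC R) : CC R :=
  derive1 (@Gamma R) x / Gamma x.

(* psi/Gamma, with its continuous value at the poles of Gamma. *)
Definition psi_div_Gamma (R : realType) (x : CC R) : CC R :=
  match pselect (is_nonpos_integer x) with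
  | left h => let k := sval (cid h) in (-1) ^+ k.+1 * k`!%:R
  | right _ => psi x / Gamma x
  end.

(* (x)_k = Gamma (x + k) / Gamma x; where Gamma has a pole at x, the quotient
   is read as its continuous value.  The symbol is infinite exactly when
   Gamma (x + k) is a pole and Gamma x is not. *)
Definition poch (R : realType) (x : CC R) (k : int) : CC R :=
  if pselect (is_nonpos_integer x)
  then lim (Gamma (y + k%:~R) / Gamma y @[y --> x^'])
  else Gamma (x + k%:~R) / Gamma x.

Definition poch_finite (R : realType) (x : CC R) (k : int) : Prop :=
  is_nonpos_integer (x + k%:~R) -> is_nonpos_integer x.

(* Vectors are sequences, whose components are numbered from 0. *)
Definition rem_at (T : Type) (i : nat) (s : seq T) : seq T :=
  take i s ++ drop i.+1 s.

Definition addzv (R : realType) (x : seq (CC R)) (k : seq int) : seq (CC R) :=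
  [seq xk.1 + xk.2%:~R | xk <- zip x k].

Definition shiftv (R : realType) (x : seq (CC R)) (c : CC R) : seq (CC R) :=
  [seq a + c | a <- x].

Definition Gammav (R : realType) (x : seq (CC R)) : CC R :=
  \prod_(a <- x) Gamma a.

Definition psiv (R : realType) (x : seq (CC R)) : CC R := \sum_(a <- x) psi a.

Definition sinv (R : realType) (x : seq (CC R)) : CC R :=
  \prod_(a <- x) Csin a.

Definition pochv (R : realType) (x : seq (CC R)) (k : seq int) : CC R :=
  \prod_(xk <- zip x k) poch xk.1 xk.2.

Definition rsubv (R : realType) (c : CC R) (x : seq (CC R)) : seq (CC R) :=
  [seq c - a | a <- x].

Definition hyperF (R : realType) (x y : seq (CC R)) (z : CC R) : CC R :=
  limn (series (fun k : nat =>
    (\prod_(a <- x) poch a k%:Z) / (\prod_(b <- y) poch b k%:Z)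
      * z ^+ k / k`!%:R : CC R)).

Definition phi (R : realType) (x y : seq (CC R)) (z : CC R) : CC R :=
  limn (series (fun k : nat =>
    Gammav (shiftv x k%:R) / Gammav (shiftv y k%:R) * z ^+ k / k`!%:R : CC R)).

(* Both ends included. *)
Definition zrange (a b : int) : seq int :=
  if a <= b then [seq a + k%:Z | k <- iota 0 (absz (b - a)).+1] else [::].

Definition vmax (s : seq int) : int := \big[Num.max/head 0 s]_(a <- s) a.
Definition vmin (s : seq int) : int := \big[Num.min/head 0 s]_(a <- s) a.

Definition e_of (n m : seq int) : int :=
  Num.max (-1)
    ((\sum_(a <- m) a) - (\sum_(a <- n) a) - (size n)%:Z + 1).

Definition V3 (R : realType) (alpha beta : seq (CC R)) (n m : seq int)
    (z : CC R) : CC R :=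
  \sum_(2 <= i < size alpha)
    let ai := alpha`_i in
    let ni := n`_i in
    let alpha' := rem_at i alpha in
    let n' := rem_at i n in
    pochv (rsubv (1 + ai) beta) [seq mj - ni | mj <- m] * z ^ (- ni)
      / pochv (rsubv ai alpha') [seq nj - ni + 1 | nj <- n']
    * hyperF (shiftv beta (- ai)) (shiftv alpha' (1 - ai)) z
    * hyperF (addzv (rsubv (1 + ai) beta) [seq mj - ni | mj <- m])
             (addzv (rsubv (1 + ai) alpha') [seq nj - ni | nj <- n']) z.

(* Finiteness of the Pochhammer symbols in the numerators of [V3].  The other
   ones are always finite when the components of alpha with index at least 2
   differ from all the other components by non-integers. *)
Definition V3_finite (R : realType) (alpha beta : seq (CC R)) (n m : seq int)
    : Prop :=
  forall i j : nat, (2 <= i < size alpha)%N -> (j < size beta)%N ->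
    poch_finite (1 - beta`_j + alpha`_i) (m`_j - n`_i).

(* The series terminates, so it is evaluated at 1 without convergence issues. *)
Definition Delta_raw (R : realType) (alpha beta : seq (CC R)) (n m : seq int)
    (j : int) : CC R :=
  let e := e_of n m in
  \sum_(l <- zrange (Num.max (- vmax n) (j - e - 1)) j)
    'C(absz (e + 1), absz (j - l))%:R * (-1) ^+ absz (j - l) *
    \sum_(0 <= i < size alpha | 0 <= l + n`_i)
      let ai := alpha`_i in
      let ni := n`_i in
      let alpha' := rem_at i alpha in
      let n' := rem_at i n in
      pochv (rsubv (1 + ai) beta) [seq mj + l | mj <- m]
        / (pochv (rsubv ai alpha') [seq nj + l + 1 | nj <- n']
             * (absz (l + ni))`!%:R)
      * hyperF
          ((- (l + ni))%:~R :: shiftv beta (- ai)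
             ++ addzv (shiftv alpha' (- ai)) [seq - nj - l | nj <- n'])
          (addzv (shiftv beta (- ai)) [seq - mj - l | mj <- m]
             ++ shiftv alpha' (1 - ai))
          1.

(* If beta_j - alpha_i is an integer, the lower parameters
   beta - alpha_i - m - l of the terminating series may be non-positive
   integers, whose vanishing Pochhammer symbols cancel against zeros of
   (1 - beta + alpha_i)_(m+l).  The expression is then read as its continuous
   value in beta; if no beta_j - alpha_i is an integer this is [Delta_raw]. *)
Definition Delta_generic (R : realType) (alpha beta : seq (CC R))
    (n m : seq int) (j : int) : CC R :=
  lim (Delta_raw alpha (shiftv beta s) n m j @[s --> (0 : CC R)^']).

(* alpha_2 is component 1: the limit is taken as alpha_2 -> alpha_1 + p. *)
Definition Delta (R : realType) (p : int) (alpha beta : seq (CC R))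
    (n m : seq int) (j : int) : CC R :=
  lim (Delta_generic (set_nth 0 alpha 1 y) beta n m j
         @[y --> ((alpha`_0 + p%:~R) : CC R)^']).

(* In Psi1, ..., Psi4, A and B are the vectors of dimension r - 2 and r.  The digamma values
   at integer arguments are grouped with the Gamma in the denominator that has
   the same argument, to be read through [psi_div_Gamma]. *)

Definition Psi1 (R : realType) (p : int) (A B : seq (CC R)) (k : nat) : CC R :=
  psi_div_Gamma (1 + p%:~R + k%:R) * Gammav (rsubv (1 + p%:~R + k%:R) B)
    / (Gammav (rsubv (2 + p%:~R + k%:R) A) * k`!%:R).

Definition Psi2 (R : realType) (p : int) (A B : seq (CC R)) (k : nat) : CC R :=
  let c : CC R := 1 - p%:~R + k%:R in
  let X := rsubv (1 + k%:R) B in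
  let Y := rsubv (2 + k%:R) A in
  Gammav X / (Gammav Y * k`!%:R)
    * (psi_div_Gamma c + (psiv Y - psiv X) / Gamma c).

Definition Psi3 (R : realType) (p : int) (A B : seq (CC R)) (n m : seq int)
    (k : nat) : CC R :=
  let c : CC R := (1 + p + n`_0 - n`_1)%:~R + k%:R in
  let X := shiftv (addzv B m) (k%:R - (n`_1)%:~R) in
  let Y := shiftv (addzv A (drop 2 n)) (k%:R - (n`_1)%:~R) in
  Gammav X / (Gammav Y * k`!%:R)
    * ((psiv X - psiv Y) / Gamma c - psi_div_Gamma c).

Definition Psi4 (R : realType) (p : int) (A B : seq (CC R)) (n m : seq int)
    (k : nat) : CC R :=
  let c : CC R := (1 - p + n`_1 - n`_0)%:~R + k%:R in
  let X := shiftv (addzv B m) (k%:R - (p + n`_0)%:~R) in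
  let Y := shiftv (addzv A (drop 2 n)) (k%:R - (p + n`_0)%:~R) in
  psi_div_Gamma c * Gammav X / (Gammav Y * k`!%:R).

(* Main.v *)
Require Import Defs.
From HB Require Import structures.
From mathcomp Require Import all_boot all_order all_algebra.
From mathcomp Require Import all_classical all_reals all_analysis.
From mathcomp Require Import complex.
From mathcomp Require Import zify ring lra.

Set Implicit Arguments.
Unset Strict Implicit.
Unset Printing Implicit Defensive.

Import Order.TTheory GRing.Theory Num.Theory.
Import numFieldNormedType.Exports.

Local Open Scope classical_set_scope.
Local Open Scope complex_scope.
Local Open Scope ring_scope.

(** Write alpha_2 = alpha_1 + p + delta. For generic parameters the terminating
    series in Delta_j are residue sums: the l-th inner sum is the coefficient of
    z^l in the sum over i of products C_i F_i(z) G_i(z) z^(-n_i) of two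
    hypergeometric series, of which the part i >= 3 is V_3. Lagrange
    interpolation at the points alpha_i + c shows that multiplying by
    (1-z)^(e+1) annihilates all coefficients beyond e - m_min, so that
    (1-z)^(-e-1) sum_j Delta_j z^j is that whole sum. As delta -> 0 the terms
    i = 1, 2 have simple poles which cancel; by the reflection formula their sum
    tends to the derivative of a product of reciprocal Gamma functions, that is,
    to a Wronskian-like combination X Y' - X' Y of two Frobenius solutions X
    (= z^p phi_1B), Y (= phi_B) and their formal parameter derivatives X', Y',
    which are the Psi series. The cotangent terms come from the reflection
    formula for psi. *)

(** * Complex norm and limits *)

(** The obstacle is the confluence: at alpha_2 = alpha_1 + p the terms i = 1, 2 acquire poles, and
    the signs of p and of p + n_1 - n_2 are arbitrary, so the exceptional exponents differ from case
    to case. Writing every singular Gamma factor through the entire function 1/Gamma removes the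
    case distinction: its zeros switch off the missing terms by themselves. Limits are taken
    coefficient by coefficient, in finite sums; infinite series enter only after the limit, so no
    limit is ever exchanged with an infinite sum. Two limits are nested. Shifting beta by s makes
    every beta_j - alpha_i a non-integer, as the interpolation argument requires; only after s -> 0
    does alpha_2 move to its confluent value. The limit in s is taken in the product form C_i F_i
    G_i, whose Pochhammer symbols are continuous where they are finite; this is where the finiteness
    assumption on V_3 enters. Since Gamma is given by Gauss' product, its reflection formula is
    derived from Euler's sine product, and the latter from the factorization of (1 + w)^n - (1 -
    w)^n. *)

Section ComplexNorm.
Variable R : realType.
Local Notation C := (CC R).
Implicit Types x y z : C.

(** The norm of [CC R] has values in [CC R], whose order is partial. Its real part allows estimates
    in the ordered field [R], within reach of [lra]. *)
Definition nrm (x : C) : R := complex.Re `|x|.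

Lemma nrmE x : `|x| = ((nrm x)%:C : C).
Proof. by case: x => a b; rewrite /nrm; simpc. Qed.

Lemma nrm_ge0 x : 0 <= nrm x.
Proof. by have := normr_ge0 x; rewrite nrmE lecR. Qed.

Lemma nrmM x y : nrm (x * y) = nrm x * nrm y.
Proof. by apply: complexI; rewrite rmorphM/= -!nrmE normrM. Qed.

Lemma nrmD x y : nrm (x + y) <= nrm x + nrm y.
Proof. by rewrite -lecR rmorphD/= -!nrmE; exact: ler_normD. Qed.

Lemma nrmN x : nrm (- x) = nrm x.
Proof. by rewrite /nrm normrN. Qed.

Lemma nrmBC x y : nrm (x - y) = nrm (y - x).
Proof. by rewrite -nrmN opprB. Qed.

Lemma nrmB x y : nrm (x - y) <= nrm x + nrm y.
Proof. by rewrite -(nrmN y); exact: nrmD. Qed.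

Lemma nrm_tri x y z : nrm (x - z) <= nrm (x - y) + nrm (y - z).
Proof. by have := nrmD (x - y) (y - z); rewrite addrA subrK. Qed.

Lemma nrm0 : nrm 0 = 0.
Proof. by rewrite /nrm normr0. Qed.

Lemma nrm1 : nrm 1 = 1.
Proof. by rewrite /nrm normr1. Qed.

Lemma nrm_eq0 x : (nrm x == 0) = (x == 0).
Proof.
apply/eqP/eqP => [x0|->]; last exact: nrm0.
by apply/eqP; rewrite -normr_eq0 nrmE x0.
Qed.

Lemma nrm_gt0 x : (0 < nrm x) = (x != 0).
Proof. by rewrite lt_def nrm_eq0 nrm_ge0 andbT. Qed.

Lemma nrmV x : nrm x^-1 = (nrm x)^-1.
Proof.
have [->|x0] := eqVneq x 0; first by rewrite invr0 nrm0 invr0.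
by apply: (mulfI (x := nrm x)); rewrite ?nrm_eq0// -nrmM !divff ?nrm1 ?nrm_eq0.
Qed.

Lemma nrmX x n : nrm (x ^+ n) = nrm x ^+ n.
Proof. by elim: n => [|n IH]; rewrite ?nrm1// !exprS nrmM IH. Qed.

Lemma nrmR (a : R) : nrm (a%:C) = `|a|.
Proof. by rewrite /nrm; simpc; rewrite /= expr0n/= addr0 sqrtr_sqr. Qed.

Lemma nrm_nat n : nrm n%:R = n%:R.
Proof. by rewrite -(rmorph_nat (real_complex R)) nrmR normr_nat. Qed.

Lemma nrm_sum (I : Type) (s : seq I) (P : pred I) (F : I -> C) :
  nrm (\sum_(i <- s | P i) F i) <= \sum_(i <- s | P i) nrm (F i).
Proof.
elim/big_rec2: _ => [|i y1 y2 _ le12]; first by rewrite nrm0.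
by apply: (le_trans (nrmD _ _)); rewrite lerD2l.
Qed.

Lemma nrm_prod (I : Type) (s : seq I) (P : pred I) (F : I -> C) :
  nrm (\prod_(i <- s | P i) F i) = \prod_(i <- s | P i) nrm (F i).
Proof. by elim/big_rec2: _ => [|i y1 y2 _ <-]; rewrite ?nrm1// nrmM. Qed.

Lemma Re_nrm x : `|complex.Re x| <= nrm x.
Proof.
case: x => a b; rewrite /nrm; simpc; rewrite /= -sqrtr_sqr ler_wsqrtr//.
by rewrite lerDl sqr_ge0.
Qed.

Lemma Im_nrm x : `|complex.Im x| <= nrm x.
Proof.
case: x => a b; rewrite /nrm; simpc; rewrite /= -sqrtr_sqr ler_wsqrtr//.
by rewrite lerDr sqr_ge0.
Qed.

Lemma Ci2 : Ci R ^+ 2 = -1.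
Proof. by rewrite expr2 /Ci; simpc. Qed.

Lemma nrm_Ci : nrm (Ci R) = 1.
Proof.
by apply/eqP; rewrite -[_ == _](eqrXn2 (n := 2)) ?nrm_ge0// -nrmX Ci2 nrmN nrm1 expr1n.
Qed.

Lemma nrm_ReIm x : nrm x <= `|complex.Re x| + `|complex.Im x|.
Proof.
have -> : x = (complex.Re x)%:C + Ci R * (complex.Im x)%:C :> C.
  by rewrite {1}[x]complexE.
apply: (le_trans (nrmD _ _)); rewrite nrmM nrm_Ci mul1r !nrmR.
by case: x => a b; simpc => /=.
Qed.

Lemma nrm_ge_sub x y : nrm x - nrm y <= nrm (x - y).
Proof. by have := nrmD (x - y) y; rewrite subrK lerBlDr. Qed.

Lemma nrm_prod_le (n : nat) (F : nat -> C) (G : nat -> R) :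
  (forall i, (i < n)%N -> nrm (F i) <= G i) ->
  nrm (\prod_(i < n) F i) <= \prod_(i < n) G i.
Proof.
by move=> FG; rewrite nrm_prod; apply: ler_prod => i _; rewrite nrm_ge0 FG.
Qed.

(** In the partial order of the complex numbers a positive element is real, so every epsilon can be
    drawn from [R]. *)
Lemma gt0_CC (e : C) : 0 < e -> exists2 d : R, 0 < d & e = d%:C.
Proof.
case: e => a b; rewrite ltcE/= => /andP[/eqP -> a0]; by exists a.
Qed.

Lemma cvgC_nearP (T : Type) (F : set_system T) {FF : Filter F} (f : T -> C) (l : C) :
  f x @[x --> F] --> l <-> (forall e : R, 0 < e -> \forall t \near F, nrm (f t - l) < e).
Proof.
split=> [/cvgrPdist_lt fl e e0|fl].
  have /fl : 0 < (e%:C : C) by rewrite ltcR.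
  by apply: filterS => t; rewrite nrmE ltcR nrmBC.
apply/cvgrPdist_lt => _/gt0_CC[e e0 ->].
by apply: filterS (fl e e0) => t; rewrite nrmBC nrmE ltcR.
Qed.

Lemma cvgC_nrmP (T : Type) (F : set_system T) {FF : Filter F} (f : T -> C) (l : C) :
  f x @[x --> F] --> l <-> nrm (f t - l) @[t --> F] --> (0 : R).
Proof.
rewrite cvgC_nearP; split=> [fl|/cvgrPdist_lt fl e e0].
  apply/cvgrPdist_lt => e e0; apply: filterS (fl e e0) => t.
  by rewrite sub0r normrN ger0_norm ?nrm_ge0.
by apply: filterS (fl e e0) => t; rewrite sub0r normrN ger0_norm ?nrm_ge0.
Qed.

Lemma cvgC_squeeze (T : Type) (F : set_system T) {FF : Filter F}
    (f : T -> C) (l : C) (g : T -> R) :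
  (\forall t \near F, nrm (f t - l) <= g t) -> g t @[t --> F] --> (0 : R) ->
  f x @[x --> F] --> l.
Proof.
move=> fg g0; apply/cvgC_nrmP; apply: (squeeze_cvgr (f := fun=> 0) (h := g)) => //.
  by apply: filterS fg => t ->; rewrite nrm_ge0.
exact: cvg_cst.
Qed.

Lemma cvgC_real (T : Type) (F : set_system T) {FF : Filter F} (f : T -> R) (l : R) :
  f x @[x --> F] --> l -> ((f x)%:C : C) @[x --> F] --> (l%:C : C).
Proof.
move=> fl; apply/cvgC_nrmP.
have -> : (fun t => nrm ((f t)%:C - l%:C : C)) = fun t => `|f t - l|.
  by apply/funext => t; rewrite -rmorphB/= nrmR.
rewrite -(normr0 (R : numDomainType)); apply: cvg_norm.
by rewrite -(subrr l); apply: cvgB => //; exact: cvg_cst.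
Qed.

Lemma cvgC_ReIm (T : Type) (F : set_system T) {FF : Filter F} (f : T -> C) (a b : R) :
  complex.Re (f x) @[x --> F] --> a -> complex.Im (f x) @[x --> F] --> b ->
  f x @[x --> F] --> (a +i* b : C).
Proof.
move=> fa fb; have -> : a +i* b = (a%:C : C) + Ci R * (b%:C : C).
  by rewrite /Ci; simpc.
have -> : f = fun t => ((complex.Re (f t))%:C : C) + Ci R * ((complex.Im (f t))%:C : C).
  by apply/funext => t; rewrite {1}[f t]complexE.
apply: (@cvgD _ C); first exact: cvgC_real.
by apply: (@cvgM C); [exact: cvg_cst | exact: cvgC_real].
Qed.

Lemma nbhsC_dP (a : C) (P : C -> Prop) :
  (\forall y \near a^', P y) <->
  (exists2 d : R, 0 < d & forall y, y != a -> nrm (y - a) < d -> P y).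
Proof.
split=> [|[d d0 dP]].
  rewrite /dnbhs /within/= => /nbhs_ballP[e /= e0 eP].
  have [d d0 ed] := gt0_CC e0.
  exists d => // y ya yd; apply: eP => //=.
  by rewrite /ball/= ed nrmE ltcR nrmBC.
apply/nbhs_ballP; exists (d%:C : C) => /=; first by rewrite ltcR.
move=> y; rewrite /ball/= nrmE ltcR nrmBC => yd ya; exact: dP.
Qed.

Global Instance dnbhsC_proper (a : C) : ProperFilter (a^').
Proof.
apply: Build_ProperFilter_ex => P /nbhsC_dP[d d0 dP].
have h : nrm ((d / 2)%:C) = d / 2 by rewrite nrmR ger0_norm// divr_ge0// ltW.
exists (a + (d / 2)%:C); apply: dP; last first.
  by rewrite addrAC subrr add0r h ltr_pdivrMr// ltr_pMr// ltr1n.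
by rewrite -subr_eq0 addrAC subrr add0r -nrm_eq0 h mulf_neq0// ?gt_eqF// invr_gt0.
Qed.

Lemma limC (T : Type) (F : set_system T) {FF : ProperFilter F} (f : T -> C) (l : C) :
  f x @[x --> F] --> l -> lim (f x @[x --> F]) = l.
Proof. exact/cvg_lim/norm_hausdorff. Qed.

Lemma cvgC_unique (T : Type) (F : set_system T) {FF : ProperFilter F} (f : T -> C) (l l' : C) :
  f x @[x --> F] --> l -> f x @[x --> F] --> l' -> l = l'.
Proof. by move=> /limC {1}<- /limC. Qed.

Lemma cvgCM (T : Type) (F : set_system T) {FF : Filter F} (f g : T -> C) (a b : C) :
  f x @[x --> F] --> a -> g x @[x --> F] --> b -> (f x * g x) @[x --> F] --> a * b.
Proof. exact: (@cvgM C T F FF f g a b). Qed.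

Lemma cvgCD (T : Type) (F : set_system T) {FF : Filter F} (f g : T -> C) (a b : C) :
  f x @[x --> F] --> a -> g x @[x --> F] --> b -> (f x + g x) @[x --> F] --> a + b.
Proof. exact: (@cvgD C C T F FF f g a b). Qed.

Lemma cvgCN (T : Type) (F : set_system T) {FF : Filter F} (f : T -> C) (a : C) :
  f x @[x --> F] --> a -> (- f x) @[x --> F] --> - a.
Proof. exact: (@cvgN C C T F FF f a). Qed.

Lemma cvgCB (T : Type) (F : set_system T) {FF : Filter F} (f g : T -> C) (a b : C) :
  f x @[x --> F] --> a -> g x @[x --> F] --> b -> (f x - g x) @[x --> F] --> a - b.
Proof. by move=> fa gb; apply: cvgCD; [exact: fa|exact: cvgCN gb]. Qed.

Lemma cvgCV (T : Type) (F : set_system T) {FF : Filter F} (f : T -> C) (a : C) :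
  a != 0 -> f x @[x --> F] --> a -> (f x)^-1 @[x --> F] --> a^-1.
Proof. exact: (@cvgV C T F FF f a). Qed.

Lemma cvgC_cst (T : Type) (F : set_system T) {FF : Filter F} (a : C) :
  (fun=> a) x @[x --> F] --> a.
Proof. exact: cvg_cst. Qed.

Lemma cvg_prodC (T I : Type) (F : set_system T) {FF : Filter F} (s : seq I) (P : pred I)
    (f : I -> T -> C) (l : I -> C) :
  (forall i, P i -> f i x @[x --> F] --> l i) ->
  (\prod_(i <- s | P i) f i x) @[x --> F] --> \prod_(i <- s | P i) l i.
Proof.
move=> fl; elim: s => [|i s IH].
  by under eq_fun do rewrite big_nil; rewrite big_nil; exact: cvg_cst.
under eq_fun do rewrite big_cons; rewrite big_cons.
case: ifP => [Pi|_]; last exact: IH.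
by apply: (@cvgM C); [exact: fl|exact: IH].
Qed.

Lemma cvg_sumC (T I : Type) (F : set_system T) {FF : Filter F} (s : seq I) (P : pred I)
    (f : I -> T -> C) (l : I -> C) :
  (forall i, P i -> f i x @[x --> F] --> l i) ->
  (\sum_(i <- s | P i) f i x) @[x --> F] --> \sum_(i <- s | P i) l i.
Proof.
move=> fl; elim: s => [|i s IH].
  by under eq_fun do rewrite big_nil; rewrite big_nil; exact: cvg_cst.
under eq_fun do rewrite big_cons; rewrite big_cons.
case: ifP => [Pi|_]; last exact: IH.
by apply: (@cvgD _ C); [exact: fl|exact: IH].
Qed.

Lemma cvgC_divf (T : Type) (F : set_system T) {FF : Filter F} (f g : T -> C) (a b : C) :
  b != 0 -> f x @[x --> F] --> a -> g x @[x --> F] --> b ->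
  f x / g x @[x --> F] --> a / b.
Proof.
by move=> b0 fa gb; apply: (@cvgM C); [exact: fa|exact: (@cvgV C _ _ _ _ _ b0 gb)].
Qed.

Lemma cvgC_eq (T : Type) (F : set_system T) {FF : Filter F} (f g : T -> C) (l : C) :
  (\forall x \near F, f x = g x) -> f x @[x --> F] --> l -> g x @[x --> F] --> l.
Proof.
by move=> fg /cvgC_nearP fl; apply/cvgC_nearP => e /fl; apply: filterS2 fg => x ->.
Qed.

(** Real and imaginary parts are both dominated by [v], so the real comparison test applies to
    each. *)
Lemma cvg_seriesC (u : nat -> C) (v : nat -> R) :
  (forall n, nrm (u n) <= v n) -> cvgn (series v) -> exists l : C, series u n @[n --> \oo] --> l.
Proof.
move=> uv cv.
have cc (g : C -> R) : (forall x, `|g x| <= nrm x) -> cvgn (series (g \o u)).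
  move=> gle; apply: normed_cvg; apply: series_le_cvg cv => n //=; last exact: (le_trans (gle _)).
  exact: (le_trans (nrm_ge0 _) (uv n)).
have mS (g : C -> R) : {morph g : x y / x + y} -> g 0 = 0 ->
    (fun n => g (series u n)) = series (g \o u).
  move=> gD g0; apply/funext => n; rewrite /series/=.
  by elim/big_rec2: _ => [|i y1 y2 _ <-]; rewrite ?gD.
exists (limn (series (@complex.Re R \o u)) +i* limn (series (@complex.Im R \o u))).
apply: cvgC_ReIm.
  rewrite (mS (@complex.Re R)); [exact: (cc _ Re_nrm)| |by []].
  by move=> [a b] [c d].
rewrite (mS (@complex.Im R)); [exact: (cc _ Im_nrm)| |by []].
by move=> [a b] [c d].
Qed.

End ComplexNorm.

(** * Real bounds for sine, cosine and exponential *)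

Section RealTrig.
Variable R : realType.
Implicit Types a b t : R.

Lemma sin_le_id t : 0 <= t -> sin t <= t.
Proof.
rewrite le_eqVlt => /orP[/eqP <-|t0]; first by rewrite sin0.
have [c _] := @MVT R sin cos 0 t t0 (fun x _ => is_derive_sin x)
   (continuous_subspaceT (@continuous_sin R)).
by rewrite sin0 !subr0 => ->; rewrite ger_pMl// cos_le1.
Qed.

Lemma norm_sin_le t : `|sin t| <= `|t|.
Proof.
wlog t0 : t / 0 <= t => [wl|].
  have [/wl//|/ltW] := leP 0 t.
  by rewrite -oppr_ge0 => /wl; rewrite sinN !normrN.
rewrite [leRHS]ger0_norm// ler_norml sin_le_id// andbT.
have [t1|t1] := leP t pi.
  by rewrite (@le_trans _ _ 0) ?oppr_le0// sin_ge0_pi// t0.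
have := sin_geN1 t; apply: le_trans; rewrite lerN2; apply: ltW.
by apply: lt_trans t1; apply: (lt_le_trans _ (pi_ge2 R)); rewrite ltr1n.
Qed.

Lemma cos_sub1_le t : `|cos t - 1| <= t ^+ 2.
Proof.
have -> : cos t - 1 = - (2 * sin (t / 2) ^+ 2).
  have -> : cos t = cos ((t / 2) *+ 2) by congr cos; rewrite -mulr_natr divfK ?pnatr_eq0.
  by rewrite cos_mulr2n cos2sin2; ring.
rewrite normrN ger0_norm; last by apply: mulr_ge0; rewrite ?sqr_ge0.
have : sin (t / 2) ^+ 2 <= (t / 2) ^+ 2.
  rewrite -(real_normK (num_real (sin (t / 2)))) -(real_normK (num_real (t / 2))).
  by rewrite ler_pXn2r ?nnegrE ?normr_ge0 ?norm_sin_le.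
have -> : t ^+ 2 = 4 * (t / 2) ^+ 2 by field.
have := sqr_ge0 (t / 2); lra.
Qed.

Lemma sin_sub_id_le t : `|t| <= 1 -> `|sin t - t| <= t ^+ 2.
Proof.
wlog t0 : t / 0 <= t => [wl|].
  have [/wl//|/ltW] := leP 0 t.
  by rewrite -oppr_ge0 => /wl; rewrite sinN sqrrN -opprD !normrN.
move: t0; rewrite le_eqVlt => /orP[/eqP <-|t0]; first by rewrite sin0 subrr normr0 expr0n.
have [c] := @MVT R sin cos 0 t t0 (fun x _ => is_derive_sin x)
   (continuous_subspaceT (@continuous_sin R)).
rewrite sin0 !subr0 in_itv/= => /andP[c0 ct] ->.
rewrite (gtr0_norm t0) => t1; rewrite -[X in _ - X]mul1r -mulrBl normrM (gtr0_norm t0).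
apply: (@le_trans _ _ (t ^+ 2 * t)).
  rewrite ler_pM2r//; apply: (le_trans (cos_sub1_le c)).
  by rewrite ler_pXn2r// ?nnegrE// ltW.
by rewrite ler_piMr ?sqr_ge0.
Qed.

(** Both bounds come from [1 + x <= expR x]: at [t] it bounds from below, at [- t] it gives
    [expR t <= 1 / (1 - t)]. *)
Lemma expR_sub_le t : `|t| <= 2^-1 -> `|expR t - 1 - t| <= 2 * t ^+ 2.
Proof.
move=> t1; have := expR_ge1Dx t; have := expR_ge1Dx (- t).
rewrite expRN => h1 h2; have e0 := expR_gt0 t.
move: t1; rewrite ler_norml => /andP[t1 t2].
have h3 : (1 - t) * expR t <= 1 by rewrite -ler_pdivlMr// mul1r.
rewrite ger0_norm; [|lra].
have : expR t <= 1 + t + 2 * t ^+ 2; last lra.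
have p0 : 0 < 1 - t by lra.
rewrite -(ler_pM2l p0); apply: (le_trans h3).
have : 0 <= t ^+ 2 * (1 - 2 * t) by apply: mulr_ge0; [exact: sqr_ge0|lra].
by rewrite expr2; lra.
Qed.

(** This is [t <= tan t] with the cosine cleared; the difference of the two sides has derivative
    [x * sin x], nonnegative on the interval. *)
Lemma tan_ge_id t : 0 < t -> t < pi / 2 -> t * cos t <= sin t.
Proof.
move=> t0 tp.
have h (x : R) : is_derive x (1 : R) (fun u : R => sin u - u * cos u : R) (x * sin x).
  apply: is_derive_eq.
  by rewrite /GRing.scale/=; ring.
have cf : {within `[0, t], continuous (fun u : R => sin u - u * cos u)}.
  apply: continuous_subspaceT => x.
  by apply: differentiable_continuous; apply/derivable1_diffP; case: (h x).
have [c] := MVT t0 (fun x _ => h x) cf.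
rewrite in_itv/= => /andP[c0 ct]; rewrite sin0 mul0r !subr0 => e.
rewrite -subr_ge0 e; apply: mulr_ge0; last exact: ltW.
apply: mulr_ge0; first exact: ltW.
by apply/ltW/sin_gt0_pihalf; rewrite c0 (lt_trans ct).
Qed.

End RealTrig.

(** * The complex exponential *)

Section Cexp.
Variable R : realType.
Local Notation C := (CC R).
Implicit Types x y z v : C.

Lemma nrm_sqr x : nrm x ^+ 2 = complex.Re x ^+ 2 + complex.Im x ^+ 2.
Proof.
case: x => a b; rewrite /nrm; simpc; rewrite /= sqr_sqrtr//.
by rewrite addr_ge0 ?sqr_ge0.
Qed.

Lemma CexpD x y : Cexp (x + y) = Cexp x * Cexp y.
Proof.
case: x => a b; case: y => c d; rewrite /Cexp/= expRD cosD sinD.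
by simpc; congr (_ +i* _); ring.
Qed.

Lemma Cexp0 : Cexp (0 : C) = 1.
Proof. by rewrite /Cexp/= expR0 cos0 sin0 mul1r. Qed.

Lemma nrm_Cexp x : nrm (Cexp x) = expR (complex.Re x).
Proof.
rewrite /Cexp nrmM nrmR ger0_norm ?expR_ge0//.
rewrite -[RHS]mulr1; congr (_ * _); apply/eqP.
by rewrite -[_ == _](eqrXn2 (n := 2)) ?nrm_ge0// nrm_sqr/= cos2Dsin2 expr1n.
Qed.

Lemma nrm_Cexp_le x : nrm (Cexp x) <= expR (nrm x).
Proof. by rewrite nrm_Cexp ler_expR (le_trans (ler_norm _))// Re_nrm. Qed.

Lemma Cexp_real (a : R) : Cexp (a%:C : C) = (expR a)%:C.
Proof. by rewrite /Cexp/= cos0 sin0 mulr1. Qed.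

Lemma Cexp_sum (I : Type) (s : seq I) (F : I -> C) :
  Cexp (\sum_(i <- s) F i) = \prod_(i <- s) Cexp (F i).
Proof. by elim/big_rec2: _ => [|i y1 y2 _ <-]; rewrite ?Cexp0// CexpD. Qed.

Lemma Cexp_natl (n : nat) x : Cexp (n%:R * x) = Cexp x ^+ n.
Proof.
elim: n => [|n IH]; first by rewrite mul0r Cexp0.
by rewrite -natr1 mulrDl mul1r CexpD IH exprSr.
Qed.

(** The second-order remainder of the exponential, on which all later product and derivative
    estimates rest. Real and imaginary part are estimated separately. *)
Lemma Cexp_sub_le v : nrm v <= 2^-1 -> nrm (Cexp v - 1 - v) <= 4 * nrm v ^+ 2.
Proof.
move=> v1; apply: (le_trans (nrm_ReIm _)); rewrite nrm_sqr.
have := le_trans (Re_nrm v) v1; have := le_trans (Im_nrm v) v1.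
case: v {v1} => a b /= b1 a1.
have h1 := expR_sub_le a1.
have h2 := cos_sub1_le b.
have h3 : `|sin b - b| <= b ^+ 2 by apply: sin_sub_id_le; apply: (le_trans b1); lra.
have h4 := norm_sin_le b.
rewrite /Cexp/=; simpc => /=.
have -> : expR a * cos b - 1 - a = (expR a - 1 - a) * cos b + (1 + a) * (cos b - 1) by ring.
have -> : expR a * sin b - b = (expR a - 1) * sin b + (sin b - b) by ring.
have e1 : `|expR a - 1| <= 2 * `|a|.
  have -> : expR a - 1 = (expR a - 1 - a) + a by ring.
  apply: (le_trans (ler_normD _ _)).
  have : a ^+ 2 <= `|a| / 2 by rewrite -real_normK ?num_real// expr2 ler_wpM2l.
  lra.
have A : `|(expR a - 1 - a) * cos b + (1 + a) * (cos b - 1)| <= 2 * a ^+ 2 + 2 * b ^+ 2.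
  apply: (le_trans (ler_normD _ _)); rewrite !normrM; apply: lerD.
    by rewrite -[leRHS]mulr1; apply: ler_pM => //; exact: cos_max.
  apply: ler_pM => //; apply: (le_trans (ler_normD _ _)); rewrite normr1; lra.
have B : `|(expR a - 1) * sin b + (sin b - b)| <= 2 * `|a| * `|b| + b ^+ 2.
  apply: (le_trans (ler_normD _ _)); rewrite !normrM; apply: lerD => //.
  by apply: ler_pM.
apply: (le_trans (lerD A B)).
have : 2 * `|a| * `|b| <= a ^+ 2 + b ^+ 2.
  rewrite -(real_normK (num_real a)) -(real_normK (num_real b)).
  by have := sqr_ge0 (`|a| - `|b|); rewrite sqrrB -mulr_natl; lra.
have := sqr_ge0 a; lra.
Qed.

Lemma cvg_Cexp (T : Type) (F : set_system T) {FF : Filter F} (f : T -> C) (l : C) :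
  f x @[x --> F] --> l -> Cexp (f x) @[x --> F] --> Cexp l.
Proof.
move=> fl.
have -> : (fun t => Cexp (f t)) = fun t => Cexp l * Cexp (f t - l).
  by apply/funext => t; rewrite -CexpD addrC subrK.
suff h : Cexp (f t - l) @[t --> F] --> (1 : C).
  rewrite -{2}[Cexp l]mulr1.
  apply: cvgCM; [exact: cvgC_cst|exact: h].
apply: (@cvgC_squeeze _ _ _ _ _ _ (fun t => 3 * nrm (f t - l))).
  have /cvgC_nearP/(_ 2^-1) := fl.
  rewrite invr_gt0 ltr0n => /(_ isT); apply: filterS => t /ltW ft.
  have := Cexp_sub_le ft; set v := f t - l in ft * => h.
  have -> : Cexp v - 1 = (Cexp v - 1 - v) + v by ring.
  apply: (le_trans (nrmD _ _)).
  have : nrm v ^+ 2 <= nrm v / 2 by rewrite expr2 ler_wpM2l// nrm_ge0.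
  lra.
rewrite -(mulr0 3); apply: cvgM; first exact: cvg_cst.
by move/cvgC_nrmP: fl.
Qed.

End Cexp.

(** * Infinite products *)

Section Products.
Variable R : realType.
Local Notation C := (CC R).

Lemma prod_sub1_le (n : nat) (a : nat -> C) (b : nat -> R) :
  (forall i, nrm (a i) <= b i) ->
  nrm (\prod_(i < n) (1 + a i) - 1) <= expR (\sum_(i < n) b i) - 1.
Proof.
move=> ab; elim: n => [|n IH]; first by rewrite !big_ord0 subrr nrm0 expR0 subrr.
rewrite !big_ord_recr/= expRD.
have -> : \prod_(i < n) (1 + a i) * (1 + a n) - 1 =
   (\prod_(i < n) (1 + a i) - 1) * (1 + a n) + a n by ring.
apply: (le_trans (nrmD _ _)); rewrite nrmM.
have h1 : nrm (1 + a n) <= expR (b n).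
  apply: (le_trans (nrmD _ _)); rewrite nrm1.
  by apply: le_trans (expR_ge1Dx _); rewrite lerD2l.
have h2 : nrm (a n) <= expR (b n) - 1.
  by apply: (le_trans (ab n)); rewrite lerBrDl; exact: expR_ge1Dx.
have := ler_pM (nrm_ge0 _) (nrm_ge0 _) IH h1; lra.
Qed.

(** Factors are exchanged one at a time. As every [M i] is at least 1, the one majorant missing from
    each exchange can be added for free. *)
Lemma prod_sub_le (n : nat) (a b : nat -> C) (M : nat -> R) :
  (forall i, 1 <= M i) -> (forall i, (i < n)%N -> nrm (a i) <= M i) ->
  (forall i, (i < n)%N -> nrm (b i) <= M i) ->
  nrm (\prod_(i < n) a i - \prod_(i < n) b i) <=
    \prod_(i < n) M i * \sum_(i < n) nrm (a i - b i).
Proof.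
move=> M1; elim: n => [|n IH] aM bM.
  by rewrite !big_ord0 subrr nrm0 mulr0.
rewrite !big_ord_recr/=.
set p := \prod_(i < n) a i; set q := \prod_(i < n) b i.
set P := \prod_(i < n) M i; set S := \sum_(i < n) _.
have -> : p * a n - q * b n = (p - q) * a n + q * (a n - b n) by ring.
apply: (le_trans (nrmD _ _)); rewrite !nrmM.
have qP : nrm q <= P by apply: nrm_prod_le => i ni; apply: bM; exact: ltnW.
have P0 : 0 <= P by apply: prodr_ge0 => i _; apply: le_trans (M1 i).
have pq : nrm (p - q) <= P * S by apply: IH => i ni; [apply: aM|apply: bM]; exact: ltnW.
have h1 : nrm (p - q) * nrm (a n) <= P * S * M n.
  by apply: ler_pM; rewrite ?nrm_ge0 ?aM.
have h2 : nrm q * nrm (a n - b n) <= P * M n * nrm (a n - b n).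
  rewrite ler_wpM2r ?nrm_ge0//; apply: (le_trans qP).
  by rewrite ler_peMr.
lra.
Qed.

(* A telescoping majorant of 1/(i+1)^2. *)
Definition wgt (i : nat) : R := (i.+1%:R * i.+2%:R)^-1.

Lemma wgt_ge0 i : 0 <= wgt i.
Proof. by rewrite invr_ge0 mulr_ge0. Qed.

Lemma sum_wgt n : \sum_(i < n) wgt i = 1 - n.+1%:R^-1.
Proof.
elim: n => [|n IH]; first by rewrite big_ord0 invr1 subrr.
rewrite big_ord_recr/= IH /wgt.
have h1 : (n.+1%:R : R) != 0 by rewrite pnatr_eq0.
have h2 : (n.+2%:R : R) != 0 by rewrite pnatr_eq0.
have e : (n.+2%:R : R) = n.+1%:R + 1 by rewrite natr1.
move: h1 h2; rewrite e; move: (n.+1%:R) => x h1 h2.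
by field; rewrite h1 h2.
Qed.

Lemma sum_wgt_le n : \sum_(i < n) wgt i <= 1.
Proof. by rewrite sum_wgt gerDl oppr_le0. Qed.

Lemma cvg_series_wgt (c : R) : cvgn (series (fun n => c * wgt n)).
Proof.
have -> : series (fun n => c * wgt n) = (fun n => c * (1 - n.+1%:R^-1)).
  by apply/funext => n; rewrite /series/= -big_distrr/= big_mkord sum_wgt.
apply: is_cvgM; first exact: is_cvg_cst.
apply: is_cvgB; first exact: is_cvg_cst.
by apply/cvg_ex; exists 0; exact: cvg_harmonic.
Qed.

Lemma inv_sqr_wgt i : (i.+1%:R : R) ^- 2 <= 2 * wgt i.
Proof.
rewrite /wgt; have h0 : (0 : R) < i.+1%:R by rewrite ltr0n.
have h : (i.+2%:R : R) = i.+1%:R + 1 by rewrite natr1.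
have h1 : (1 : R) <= i.+1%:R by rewrite ler1n.
rewrite h; move: h0 h1; set x := i.+1%:R => h0 h1.
have x1 : 0 < x + 1 by lra.
rewrite -[X in X * _]invrK -invfM lef_pV2 ?posrE ?exprn_gt0 ?mulr_gt0 ?invr_gt0 ?ltr0n//.
by rewrite expr2; nra.
Qed.

(** The partial products [p n] telescope: [p n.+1 - p n = p n * a n]. They are bounded by [expR c],
    so the series of differences converges absolutely. *)
Lemma cvg_prod_wgt (a : nat -> C) (c : R) :
  (forall i, nrm (a i) <= c * wgt i) ->
  exists l : C, \prod_(i < n) (1 + a i) @[n --> \oo] --> l.
Proof.
move=> ac.
have c0 : 0 <= c.
  have := le_trans (nrm_ge0 _) (ac 0%N); rewrite pmulr_lge0//.
  by rewrite invr_gt0 mulr_gt0.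
pose p n := \prod_(i < n) (1 + a i).
have pb n : nrm (p n) <= expR c.
  have : nrm (p n - 1) <= expR (\sum_(i < n) c * wgt i) - 1 by exact: (@prod_sub1_le n a (fun i => c * wgt i)).
  have : expR (\sum_(i < n) c * wgt i) <= expR c.
    by rewrite ler_expR -big_distrr/= ler_piMr// sum_wgt_le.
  have := nrmD (p n - 1) 1; rewrite subrK nrm1; lra.
have [l hl] : exists l : C, series (fun n => p n * a n) n @[n --> \oo] --> l.
  apply: (@cvg_seriesC _ _ (fun n => (expR c * c) * wgt n)); last exact: cvg_series_wgt.
  by move=> n; rewrite nrmM -mulrA; apply: ler_pM; rewrite ?nrm_ge0.
exists (1 + l).
have -> : (fun n => \prod_(i < n) (1 + a i)) = fun n => 1 + series (fun n => p n * a n) n.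
  apply/funext; elim=> [|n IH]; first by rewrite big_ord0 /series/= big_geq// addr0.
  by rewrite big_ord_recr/= IH seriesSr /p IH; ring.
apply: cvgCD; [exact: cvgC_cst|exact: hl].
Qed.

Lemma eventually_wgt (a : nat -> C) (c : R) (N : nat) :
  (forall i, (N <= i)%N -> nrm (a i) <= c * wgt i) ->
  exists c', forall i, nrm (a i) <= c' * wgt i.
Proof.
elim: N c => [c h|N IH c h]; first by exists c => i; exact: h.
apply: (IH (Num.max c (nrm (a N) / wgt N))) => i.
have w0 j : 0 < wgt j by rewrite invr_gt0 mulr_gt0.
rewrite leq_eqVlt => /orP[/eqP <-|/h hi].
  by rewrite -ler_pdivrMr// le_max lexx orbT.
by apply: (le_trans hi); rewrite ler_pM2r// le_max lexx.
Qed.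

Lemma eventually_prod_wgt (a : nat -> C) (c : R) (N : nat) :
  (forall i, (N <= i)%N -> nrm (a i - 1) <= c * wgt i) ->
  exists l : C, \prod_(i < n) a i @[n --> \oo] --> l.
Proof.
move=> h; have [c' h'] := @eventually_wgt (fun i => a i - 1) c N h.
have [l hl] := cvg_prod_wgt h'; exists l.
suff -> : (fun n => \prod_(i < n) a i) = fun n => \prod_(i < n) (1 + (a i - 1)) by [].
by apply/funext => n; apply: eq_bigr => i _; rewrite addrC subrK.
Qed.

End Products.

(** * Complex derivatives *)

Section Deriv.
Variable R : realType.
Local Notation C := (CC R).

(** The quotient is spelled as in [derive1], so that [limC] alone passes from one to the other. *)
Definition has_deriv (f : C -> C) (x d : C) :=
  h^-1 * (f (h + x) - f x) @[h --> 0^'] --> d.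

Lemma has_deriv_derive1 f x d : has_deriv f x d -> derive1 f x = d.
Proof. exact: limC. Qed.

(** A quadratic remainder is what the product estimates deliver; the derivatives of Gamma and of the
    exponential are obtained through it. *)
Lemma has_deriv_sq f x d (B e : R) : 0 < e ->
  (forall h, nrm h < e -> nrm (f (h + x) - f x - h * d) <= B * nrm h ^+ 2) ->
  has_deriv f x d.
Proof.
move=> e0 fB; apply/cvgC_nearP => q q0; apply/nbhsC_dP.
have B1 : 0 < `|B| + 1 by apply: ltr_wpDl.
exists (Num.min e (q / (`|B| + 1))) => [|h h0]; first by rewrite lt_min e0 divr_gt0.
rewrite subr0 lt_min => /andP[he hq].
have n0 : 0 < nrm h by rewrite nrm_gt0.
have -> : h^-1 * (f (h + x) - f x) - d = h^-1 * (f (h + x) - f x - h * d).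
  by rewrite [RHS]mulrBr mulKf.
rewrite nrmM nrmV ltr_pdivrMl//; apply: (le_lt_trans (fB h he)).
rewrite expr2 mulrA mulrC ltr_pM2l//; move: hq; rewrite ltr_pdivlMr//.
apply: le_lt_trans; rewrite mulrC ler_wpM2l ?nrm_ge0//.
by apply: (le_trans (ler_norm B)); rewrite lerDl.
Qed.

Lemma has_deriv_cvg f x d : has_deriv f x d -> f (h + x) @[h --> 0^'] --> f x.
Proof.
move=> fd; rewrite -[X in _ --> X]addr0.
have idc : id h @[h --> (0 : C)^'] --> (0 : C).
  by apply/cvgC_nearP => e e0; apply/nbhsC_dP; exists e.
have : f x + h * (h^-1 * (f (h + x) - f x)) @[h --> 0^'] --> f x + 0 * d.
  by apply: cvgCD; [exact: cvgC_cst|apply: cvgCM; [exact: idc|exact: fd]].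
rewrite mul0r; apply: cvgC_eq; apply/nbhsC_dP; exists 1 => // h h0 _.
by rewrite mulVKf// addrC subrK.
Qed.

Lemma has_derivM f g x d d' : has_deriv f x d -> has_deriv g x d' ->
  has_deriv (fun t => f t * g t) x (d * g x + f x * d').
Proof.
move=> fd gd; rewrite /has_deriv.
have : (h^-1 * (f (h + x) - f x)) * g x + f (h + x) * (h^-1 * (g (h + x) - g x)) @[h --> 0^']
    --> d * g x + f x * d'.
  apply: cvgCD; first by apply: cvgCM; [exact: fd|exact: cvgC_cst].
  by apply: cvgCM; [exact: has_deriv_cvg fd|exact: gd].
apply: cvgC_eq; apply/nbhsC_dP; exists 1 => // h h0 _; ring.
Qed.

Lemma has_derivD f g x d d' : has_deriv f x d -> has_deriv g x d' ->
  has_deriv (fun t => f t + g t) x (d + d').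
Proof.
move=> fd gd; rewrite /has_deriv.
have : h^-1 * (f (h + x) - f x) + h^-1 * (g (h + x) - g x) @[h --> 0^'] --> d + d'.
  by apply: cvgCD; [exact: fd|exact: gd].
by apply: cvgC_eq; apply/nbhsC_dP; exists 1 => // h h0 _; ring.
Qed.

Lemma has_deriv_cst c x : has_deriv (fun=> c) x 0.
Proof.
rewrite /has_deriv; under eq_fun do rewrite subrr mulr0; exact: cvgC_cst.
Qed.

Lemma has_derivV f x d : f x != 0 -> has_deriv f x d ->
  has_deriv (fun t => (f t)^-1) x (- d / f x ^+ 2).
Proof.
move=> fx0 fd; rewrite /has_deriv.
have fc := has_deriv_cvg fd.
have : - (h^-1 * (f (h + x) - f x)) / (f (h + x) * f x) @[h --> 0^'] --> - d / (f x * f x).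
  apply: cvgC_divf; first by rewrite mulf_neq0.
    exact: cvgCN fd.
  by apply: cvgCM; [exact: fc|exact: cvgC_cst].
apply: cvgC_eq.
have /cvgC_nearP/(_ (nrm (f x))) := fc; rewrite nrm_gt0 => /(_ fx0)/nbhsC_dP[e e0 fe].
apply/nbhsC_dP; exists e => // h h0 /(fe h h0) fh.
have fh0 : f (h + x) != 0.
  by apply/negP => /eqP f0; move: fh; rewrite f0 sub0r nrmN ltxx.
by field; rewrite fh0 fx0 h0.
Qed.

Lemma has_deriv_eq f g x d (e : R) : 0 < e ->
  (forall h, nrm h < e -> f (h + x) = g (h + x)) -> has_deriv f x d -> has_deriv g x d.
Proof.
move=> e0 fg; rewrite /has_deriv; apply: cvgC_eq; apply/nbhsC_dP; exists e => // h h0.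
by rewrite subr0 => he; rewrite (fg h he) -[x]add0r fg ?nrm0// add0r.
Qed.

Lemma has_deriv_shift f x c d : has_deriv f (x + c) d -> has_deriv (fun t => f (t + c)) x d.
Proof. by rewrite /has_deriv; under eq_fun do rewrite addrA. Qed.

Lemma cvg_oppC0 (P : C -> C) (l : C) :
  P h @[h --> (0 : C)^'] --> l -> P (- h) @[h --> (0 : C)^'] --> l.
Proof.
move=> /cvgC_nearP Pl; apply/cvgC_nearP => e /Pl/nbhsC_dP[d d0 Pd].
apply/nbhsC_dP; exists d => // h h0; rewrite subr0 => hd.
by apply: Pd; rewrite ?oppr_eq0// subr0 nrmN.
Qed.

Lemma has_deriv_refl f x c d : has_deriv f (c - x) d -> has_deriv (fun t => f (c - t)) x (- d).
Proof.
move=> fd.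
have : - ((- h)^-1 * (f (- h + (c - x)) - f (c - x))) @[h --> (0 : C)^'] --> - d.
  by apply: cvgCN; exact: (@cvg_oppC0 (fun h => h^-1 * (f (h + (c - x)) - f (c - x)))).
apply: cvgC_eq.
apply/nbhsC_dP; exists 1 => // h h0 _.
by rewrite invrN mulNr opprK opprD addrCA.
Qed.

Lemma has_deriv_unique f x d d' : has_deriv f x d -> has_deriv f x d' -> d = d'.
Proof. exact: cvgC_unique. Qed.

End Deriv.

(** * The Gamma and digamma functions *)

Section Gauss.
Variable R : realType.
Local Notation C := (CC R).
Implicit Types x h v : C.

Lemma nonpoleP x : ~ is_nonpos_integer x <-> forall i : nat, x + i%:R != 0.
Proof.
split=> [xp i|xi [k xk]]; last by have := xi k; rewrite xk addNr eqxx.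
by apply/negP; rewrite addr_eq0 => /eqP xi; apply: xp; exists i.
Qed.

(** For large [i] the summand [i] dominates [x] and the constant 1/4 works; for the finitely many
    other indices it is enough that [x + i] is nonzero. *)
Lemma add_nat_lower x : (forall i : nat, x + i%:R != 0) ->
  exists2 c : R, 0 < c & forall i : nat, c * i.+1%:R <= nrm (x + i%:R).
Proof.
move=> xi.
have fin N : exists2 c : R, 0 < c & forall i, (i < N)%N -> c * i.+1%:R <= nrm (x + i%:R).
  elim: N => [|N [c c0 IH]]; first by exists 1.
  have n0 : 0 < nrm (x + N%:R) by rewrite nrm_gt0.
  exists (Num.min c (nrm (x + N%:R) / N.+1%:R)) => [|i].
    by rewrite lt_min c0 divr_gt0.
  rewrite ltnS leq_eqVlt => /orP[/eqP ->|/IH]; last first.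
    by apply: le_trans; rewrite ler_pM2r// ge_min lexx.
  by rewrite -ler_pdivlMr// ge_min lexx orbT.
have [N hN] : exists N : nat, 2 * nrm x + 1 <= N%:R.
  exists (Num.bound (2 * nrm x + 1)); apply/ltW/archi_boundP.
  by rewrite addr_ge0// mulr_ge0// nrm_ge0.
have [c c0 hc] := fin N; exists (Num.min c 4^-1) => [|i]; first by rewrite lt_min c0 invr_gt0 ltr0n.
have [iN|Ni] := ltnP i N.
  by apply: le_trans (hc i iN); rewrite ler_pM2r// ge_min lexx.
apply: (@le_trans _ _ (4^-1 * i.+1%:R)).
  by rewrite ler_pM2r// ge_min lexx orbT.
have : (N%:R : R) <= i%:R by rewrite ler_nat.
have := nrm_ge_sub (i%:R : C) (- x); rewrite opprK nrmN nrm_nat addrC.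
have e : (i.+1%:R : R) = i%:R + 1 by rewrite natr1.
rewrite e [_ + x]addrC; have := nrm_ge0 x; lra.
Qed.

(* Gauss' product factors as
   gk (h + x) k = gk x k * exp (h * ck x k) * prod_(i <= k) wf x h i, with
   wf = 1 + O(h^2 / i^2): this gives both convergence and the derivative. *)
Definition gk x (k : nat) : C :=
  k`!%:R * Cexp (x * (ln (k%:R : R))%:C) / \prod_(i < k.+1) (x + i%:R).

(** The logarithmic derivative of [gk] at [x]; its limit [cl] turns out to be [psi]. *)
Definition ck x (k : nat) : C := (ln (k%:R : R))%:C - \sum_(i < k.+1) (x + i%:R)^-1.

Definition wf x h (i : nat) : C := Cexp (h / (x + i%:R)) / (1 + h / (x + i%:R)).

Lemma gk_split x h k : (forall i : nat, x + i%:R != 0) ->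
  gk (h + x) k = gk x k * (Cexp (h * ck x k) * \prod_(i < k.+1) wf x h i).
Proof.
move=> xi; rewrite /wf big_split/= -Cexp_sum prodfV [Cexp (h * ck x k) * _]mulrA -CexpD.
have -> : h * ck x k + \sum_(i < k.+1) h / (x + i%:R) = h * (ln (k%:R : R))%:C.
  by rewrite /ck mulrBr -big_distrr/= subrK.
rewrite /gk mulrDl CexpD.
have -> : \prod_(i < k.+1) (h + x + i%:R) =
   \prod_(i < k.+1) (x + i%:R) * \prod_(i < k.+1) (1 + h / (x + i%:R)).
  by rewrite -big_split; apply: eq_bigr => i _ /=; field; exact: xi.
by rewrite invfM; ring.
Qed.

(** The increments are O(1/j^2): [ln (j + 1) - ln j] lies between 1/(j + 1) and 1/j, and replacing
    1/(j + 1) by 1/(x + j + 1) costs x/((j + 1)(x + j + 1)). *)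
Lemma ck_cvg x : (forall i : nat, x + i%:R != 0) -> exists l : C, ck x k @[k --> \oo] --> l.
Proof.
move=> xi; have [c c0 hc] := add_nat_lower xi.
pose d j : C := (ln (j.+1%:R : R) - ln (j%:R : R))%:C - (x + j.+1%:R)^-1.
have ckE k : ck x k = ck x 0 + series d k.
  elim: k => [|k IH]; first by rewrite /series/= big_geq// addr0.
  rewrite seriesSr addrA -IH /ck [in LHS]big_ord_recr/= /d rmorphB/=; ring.
have dle j : (1 <= j)%N -> nrm (d j) <= (3 + nrm x / c) * wgt R j.
  move=> j1; have jp : (0 : R) < j%:R by rewrite ltr0n.
  have j1p : (0 : R) < j.+1%:R by rewrite ltr0n.
  have -> : d j = (ln (j.+1%:R : R) - ln (j%:R : R) - j.+1%:R^-1)%:C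
      + x / (j.+1%:R * (x + j.+1%:R)).
    rewrite /d [in RHS]rmorphB/= fmorphV/= rmorph_nat.
    have := xi j.+1; have : (j.+1%:R : C) != 0 by rewrite pnatr_eq0.
    by move: (j.+1%:R : C) => t t0 t1; field; rewrite t0 t1.
  apply: (le_trans (nrmD _ _)); rewrite mulrDl; apply: lerD.
    rewrite nrmR -ln_div ?posrE//.
    have jj : (j.+1%:R : R) = j%:R + 1 by rewrite natr1.
    have up : ln (j.+1%:R / j%:R : R) <= j%:R^-1.
      have -> : j.+1%:R / j%:R = 1 + j%:R^-1 :> R by rewrite jj; field; rewrite gt_eqF.
      by apply: le_ln1Dx; apply: lt_trans (ltrN10 _) _; rewrite invr_gt0.
    have lo : j.+1%:R^-1 <= ln (j.+1%:R / j%:R : R).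
      rewrite -lerN2 -lnV ?posrE ?divr_gt0// invf_div.
      have -> : j%:R / j.+1%:R = 1 + - j.+1%:R^-1 :> R.
        by rewrite jj; rewrite jj in j1p; move: j1p; move: (j%:R : R) => t t0; field; rewrite gt_eqF.
      apply: le_ln1Dx; rewrite ltrN2 invf_lt1//.
      by rewrite ltr1n ltnS.
    rewrite ger0_norm ?subr_ge0//.
    apply: (@le_trans _ _ (j%:R^-1 - j.+1%:R^-1)); first by rewrite lerB.
    have t1 : (1 : R) <= j%:R by rewrite ler1n.
    have jjj : (j.+2%:R : R) = j%:R + 2 by rewrite -[in RHS]natr1 -(natrD _ j 2) addn2.
    rewrite /wgt jj jjj; move: (j%:R : R) jp t1 => t tp t1.
    have -> : t^-1 - (t + 1)^-1 = (t * (t + 1))^-1.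
      by field; rewrite !gt_eqF//; lra.
    rewrite -[3]invrK -invfM lef_pV2 ?posrE.
    - have : 0 <= (t + 1) * (t - 1) by apply: mulr_ge0; lra.
      by lra.
    - by rewrite !mulr_gt0 ?invr_gt0//; lra.
    - by rewrite !mulr_gt0 ?invr_gt0//; lra.
  rewrite nrmM nrmV nrmM nrm_nat /wgt -mulrA ler_wpM2l ?nrm_ge0//.
  rewrite -invfM lef_pV2 ?posrE ?mulr_gt0 ?nrm_gt0//.
  by have := hc j.+1; rewrite -(ler_pM2l j1p); lra.
have [c' hc'] := eventually_wgt dle.
have [l hl] : exists l : C, series d n @[n --> \oo] --> l.
  by apply: (cvg_seriesC hc'); exact: cvg_series_wgt.
exists (ck x 0 + l); under eq_fun do rewrite ckE.
by apply: cvgCD; [exact: cvgC_cst|exact: hl].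
Qed.

Lemma wf_sub1 (v : C) (c : R) : 0 < c -> nrm v <= 2^-1 -> c <= nrm (1 + v) ->
  nrm (Cexp v / (1 + v) - 1) <= 4 / c * nrm v ^+ 2.
Proof.
move=> c0 v1 cv; have v0 : 1 + v != 0 by rewrite -nrm_gt0 (lt_le_trans c0).
have -> : Cexp v / (1 + v) - 1 = (Cexp v - 1 - v) / (1 + v) by field.
rewrite nrmM nrmV ler_pdivrMr ?nrm_gt0//.
apply: (le_trans (Cexp_sub_le v1)).
have : 0 <= 4 * nrm v ^+ 2 * c^-1 by rewrite !mulr_ge0 ?invr_ge0 ?nrm_ge0// ltW.
move/(ler_wpM2l) => /(_ _ _ cv).
have -> : 4 * nrm v ^+ 2 / c * c = 4 * nrm v ^+ 2 by rewrite divfK// gt_eqF.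
by move/le_trans; apply; rewrite le_eqVlt; apply/orP; left; apply/eqP; ring.
Qed.

(** The bound [q] on the denominator is a hypothesis of its own because it has two sources: a large
    [h] with non-pole [h + x] in [gk_cvg_ex], and a small [h] in [Gamma_deriv_cl]. *)
Lemma wf_bound x h (c q : R) (i : nat) : 0 < c -> 0 < q ->
  c * i.+1%:R <= nrm (x + i%:R) -> nrm h <= c / 2 * i.+1%:R ->
  q <= nrm (1 + h / (x + i%:R)) ->
  nrm (wf x h i - 1) <= (8 / q) * (nrm h / c) ^+ 2 * wgt R i.
Proof.
move=> c0 q0 hc hh hq.
have i0 : (0 : R) < i.+1%:R by rewrite ltr0n.
have n0 : 0 < nrm (x + i%:R) by apply: lt_le_trans hc; rewrite mulr_gt0.
have vle : nrm (h / (x + i%:R)) <= nrm h / c / i.+1%:R.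
  rewrite nrmM nrmV -mulrA ler_wpM2l ?nrm_ge0//.
  by rewrite -invfM lef_pV2 ?posrE// mulr_gt0.
apply: (le_trans (wf_sub1 q0 _ hq)).
  by apply: (le_trans vle); rewrite ler_pdivrMr// ler_pdivrMr//; lra.
have v2 : nrm (h / (x + i%:R)) ^+ 2 <= (nrm h / c) ^+ 2 * (2 * wgt R i).
  apply: (@le_trans _ _ ((nrm h / c) ^+ 2 * i.+1%:R ^- 2)).
    rewrite -expr_div_n ler_pXn2r// nnegrE ?nrm_ge0//.
    by rewrite !divr_ge0 ?nrm_ge0// ltW.
  by rewrite ler_wpM2l ?sqr_ge0// inv_sqr_wgt.
have q4 : 0 <= 4 / q by rewrite divr_ge0// ltW.
apply: (le_trans (ler_wpM2l q4 v2)); rewrite le_eqVlt; apply/orP; left; apply/eqP.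
by field; rewrite !gt_eqF.
Qed.

Lemma prod_nat_fact k : \prod_(i < k) (1 + i%:R) = k`!%:R :> C.
Proof.
elim: k => [|k IH]; first by rewrite big_ord0.
by rewrite big_ord_recr/= IH factS natrM mulrC nat1r.
Qed.

(** At 1 Gauss' product collapses to k/(k + 1). *)
Lemma gk1_cvg : gk 1 k @[k --> \oo] --> (1 : C).
Proof.
have h0 : (k.+1%:R^-1 : C) @[k --> \oo] --> (0 : C).
  have : ((@harmonic R k)%:C : C) @[k --> \oo] --> (0%:C : C) by apply: cvgC_real; exact: cvg_harmonic.
  apply: cvgC_eq; near=> k.
  by rewrite /harmonic/= fmorphV/= rmorph_nat.
have : (1 - k.+1%:R^-1 : C) @[k --> \oo] --> (1 - 0 : C).
  by apply: cvgCB; [exact: cvgC_cst|exact: h0].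
rewrite subr0; apply: cvgC_eq; near=> k.
have k0 : (0 < k)%N by near: k; exists 1%N.
rewrite /gk mul1r Cexp_real lnK ?posrE ?ltr0n// rmorph_nat prod_nat_fact factS natrM.
have f0 : (k`!%:R : C) != 0 by rewrite pnatr_eq0 -lt0n fact_gt0.
have k1 : (k.+1%:R : C) != 0 by rewrite pnatr_eq0.
move: k1; rewrite -natr1; move: (k%:R : C) (k`!%:R : C) f0 => t f f0 t0.
by field; rewrite f0 t0.
Unshelve. all: by end_near.
Qed.

(** [gk_split] with base point 1 and [h = x - 1] reduces everything to [gk1_cvg], [ck_cvg] and a
    product whose factors are 1 + O(1/i^2) from some index on. *)
Lemma gk_cvg_ex x : (forall i : nat, x + i%:R != 0) -> exists l : C, gk x k @[k --> \oo] --> l.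
Proof.
move=> xi; have [q q0 hq] := add_nat_lower xi.
have oi (i : nat) : (1 : C) + i%:R != 0 by rewrite nat1r pnatr_eq0.
pose h := x - 1; have xh : x = h + 1 by rewrite subrK.
have [c cc] := ck_cvg oi.
have [N hN] : exists N : nat, 2 * nrm h <= N%:R.
  by exists (Num.bound (2 * nrm h)); apply/ltW/archi_boundP; rewrite mulr_ge0// nrm_ge0.
have wb i : (N <= i)%N -> nrm (wf 1 h i - 1) <= 8 / q * (nrm h / 1) ^+ 2 * wgt R i.
  move=> Ni; apply: wf_bound => //; rewrite ?nat1r ?nrm_nat ?mul1r//.
    have : (N%:R : R) <= i.+1%:R by rewrite ler_nat leqW.
    lra.
  have e : 1 + h / i.+1%:R = (x + i%:R) / i.+1%:R.
    have := oi i; rewrite nat1r => i0; rewrite /h -natr1 in i0 *.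
    by move: (i%:R : C) i0 => t t0; field.
  by rewrite e nrmM nrmV nrm_nat ler_pdivlMr// hq.
have [w hw] := eventually_prod_wgt wb.
exists (1 * (Cexp (h * c) * w)); rewrite xh.
under eq_fun do rewrite gk_split//.
apply: cvgCM; first exact: gk1_cvg.
apply: cvgCM; first by apply: cvg_Cexp; apply: cvgCM; [exact: cvgC_cst|exact: cc].
by apply: (cvg_comp (fun k => k.+1) (fun n => \prod_(i < n) wf 1 h i)); [exact: cvg_addnl 1%N|exact: hw].
Qed.

Lemma Gamma_cvg x : (forall i : nat, x + i%:R != 0) -> gk x k @[k --> \oo] --> Gamma x.
Proof. by move=> /gk_cvg_ex[l hl]; rewrite /Gamma (limC hl). Qed.

End Gauss.

(** * The factorization behind Euler's product for the sine *)

Section SineProduct.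
Variable R : realType.
Local Notation C := (CC R).
Implicit Types x w z : C.

Lemma Ci_neq0 : Ci R != 0 :> C.
Proof. by rewrite -nrm_eq0 nrm_Ci oner_eq0. Qed.

Lemma Cpi_neq0 : Cpi R != 0 :> C.
Proof. by rewrite -nrm_eq0 nrmR normr_eq0 gt_eqF// pi_gt0. Qed.

Lemma realCN (t : R) : ((- t)%:C : C) = - (t%:C : C).
Proof. exact: rmorphN. Qed.

Lemma Cexp_Ci (t : R) : Cexp (Ci R * t%:C) = cos t +i* sin t.
Proof. by rewrite /Cexp /Ci; simpc; rewrite /= expR0; simpc. Qed.

Lemma Cexp_NCi (t : R) : Cexp (- (Ci R * t%:C)) = cos t -i* sin t.
Proof. by rewrite /Cexp /Ci; simpc; rewrite /= !(oppr0, expR0) cosN sinN; simpc. Qed.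

Lemma Csin_real (t : R) : Csin (t%:C : C) = (sin t)%:C.
Proof.
rewrite /Csin Cexp_Ci Cexp_NCi.
have -> : (cos t +i* sin t) - (cos t -i* sin t) = 2 * Ci R * (sin t)%:C :> C.
  rewrite -[2]/(1 + 1 : C) /Ci; simpc; congr (_ +i* _); rewrite /=; ring.
by rewrite mulrC mulKf// mulf_neq0 ?Ci_neq0// pnatr_eq0.
Qed.

Lemma Ccos_real (t : R) : Ccos (t%:C : C) = (cos t)%:C.
Proof.
rewrite /Ccos Cexp_Ci Cexp_NCi.
have -> : (cos t +i* sin t) + (cos t -i* sin t) = 2 * (cos t)%:C :> C.
  rewrite -[2]/(1 + 1 : C); simpc; congr (_ +i* _); rewrite /=; ring.
by rewrite mulrC mulKf// pnatr_eq0.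
Qed.

Lemma Cexp_CiE z : Cexp (Ci R * z) = Ccos z + Ci R * Csin z.
Proof.
rewrite /Ccos /Csin; have := Ci_neq0; move: (Cexp _) (Cexp _) => a b c0; field.
by rewrite c0.
Qed.

(** Half the argument of the k-th root of unity of order n: with the half angle, (1 + omega)/(1 -
    omega) is i times a cotangent. *)
Definition ang (n k : nat) : R := pi * k%:R / n%:R.

Definition omega (n k : nat) : C := Cexp (2 * Ci R * (ang n k)%:C).

Lemma sin_ang_gt0 n k : (0 < k < n)%N -> 0 < sin (ang n k).
Proof.
move=> /andP[k0 kn]; apply: sin_gt0_pi.
have n0 : (0 : R) < n%:R by rewrite ltr0n; exact: ltn_trans kn.
rewrite /ang divr_gt0 ?mulr_gt0 ?pi_gt0 ?n0 ?ltr0n//=.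
by rewrite ltr_pdivrMr// ltr_pM2l ?pi_gt0// ltr_nat.
Qed.

Lemma omegaE n k : omega n k = omega n 1 ^+ k.
Proof.
rewrite /omega -Cexp_natl; congr Cexp; rewrite /ang !rmorphM/= fmorphV/= !rmorph_nat.
by ring.
Qed.

Lemma omega_sq n k : omega n k = Cexp (Ci R * (ang n k)%:C) ^+ 2.
Proof. by rewrite /omega -Cexp_natl mulrA. Qed.

Lemma omega_prim n : (0 < n)%N -> n.-primitive_root (omega n 1).
Proof.
move=> n0; apply/andP; split=> //; apply/forallP => i.
rewrite unity_rootE -omegaE; apply/eqP.
have [->|ni] := eqVneq i.+1 n.
  apply/eqP; rewrite omega_sq /ang mulfK ?pnatr_eq0 -?lt0n// Cexp_Ci cospi sinpi.
  by rewrite complexr0 rmorphN/= sqrrN expr1n.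
apply/negbTE/negP => /eqP; rewrite omega_sq => o1.
have s0 : 0 < sin (ang n i.+1) by apply: sin_ang_gt0; rewrite /= ltn_neqAle ltn_ord andbT; apply/eqP; apply/eqP.
have := congr1 (@complex.Re R) o1.
rewrite Cexp_Ci expr2; simpc => /=; rewrite -!expr2 cos2sin2 => h.
have : 0 < sin (ang n i.+1) ^+ 2 by rewrite exprn_gt0.
lra.
Qed.

Lemma prod_sub_omega n (X : C) : (0 < n)%N ->
  (X - 1) * \prod_(1 <= k < n) (X - omega n k) = X ^+ n - 1.
Proof.
move=> n0; have := factor_Xn_sub_1 (omega_prim n0).
move=> /(congr1 (fun p : {poly C} => p.[X])).
rewrite hornerD hornerN hornerXn hornerC => <-.
rewrite horner_prod [in RHS]big_ltn// expr0 hornerXsubC; congr (_ * _).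
by apply: eq_bigr => k _; rewrite hornerXsubC -omegaE.
Qed.

(** The quotient (X^n - 1)/(X - 1) = 1 + X + ... + X^(n-1), evaluated at 1. *)
Lemma prod_1_sub_omega n : (0 < n)%N -> \prod_(1 <= k < n) (1 - omega n k) = n%:R.
Proof.
move=> n0; have := factor_Xn_sub_1 (omega_prim n0).
rewrite subrX1 big_ltn// expr0 polyC1 => h0.
have X1 : ('X - 1 : {poly C}) != 0 by rewrite -polyC1 polyXsubC_eq0.
have := mulfI X1 h0 => {h0 X1}.
move=> /(congr1 (fun p : {poly C} => p.[1])).
rewrite horner_prod horner_sum => h.
have -> : (n%:R : C) = \sum_(i < n) ('X^i : {poly C}).[1].
  under eq_bigr do rewrite hornerXn expr1n.
  by rewrite sumr_const card_ord.
rewrite -h; by apply: eq_bigr => k _; rewrite hornerXsubC -omegaE.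
Qed.

Lemma prod_pair (N : nat) (f : nat -> C) :
  \prod_(1 <= k < (N + N).+1) f k = \prod_(i < N) (f i.+1 * f ((N + N).+1 - i.+1)%N).
Proof.
rewrite big_split/= (big_cat_nat (n := N.+1))//=; last by rewrite ltnS leq_addr.
congr (_ * _).
  by rewrite big_add1/= big_mkord.
rewrite -[N.+1]addn1 -[(N + N).+1]addn1 -addnA [(N + 1)%N]addnC addnCA addnA.
rewrite -[X in \prod_(X <= _ < _) _]add0n big_addn.
rewrite (_ : (1 + N + N - (1 + N) = N)%N); last by rewrite addKn.
rewrite big_nat_rev/= add0n big_mkord; apply: eq_bigr => i _; congr f.
by have := ltn_ord i; lia.
Qed.

(* Pairing the n-th roots of unity, n = 2 N + 1. With w = i pi x / n and
   n -> oo this becomes Euler's product for the sine. *)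
Lemma pow_sub_prod (N : nat) (w : C) : nrm w < 1 ->
  (1 + w) ^+ (N + N).+1 - (1 - w) ^+ (N + N).+1 =
  2 * w * (N + N).+1%:R * \prod_(i < N)
     (1 + w ^+ 2 * ((cos (ang (N + N).+1 i.+1) / sin (ang (N + N).+1 i.+1)) ^+ 2)%:C).
Proof.
move=> w1; set n := (N + N).+1.
have w0 : 1 - w != 0.
  by rewrite subr_eq0; apply/eqP => e; move: w1; rewrite -e nrm1 ltxx.
have e1 : (1 + w) ^+ n - (1 - w) ^+ n =
    2 * w * \prod_(1 <= k < n) ((1 + w) - omega n k * (1 - w)).
  have -> : (1 + w) ^+ n - (1 - w) ^+ n = (1 - w) ^+ n * (((1 + w) / (1 - w)) ^+ n - 1).
    by rewrite mulrBr mulr1 expr_div_n mulrCA divff ?mulr1// expf_neq0.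
  rewrite -prod_sub_omega// /n exprS.
  have -> : (1 - w) ^+ (N + N) = \prod_(1 <= k < (N + N).+1) (1 - w).
    by rewrite prodr_const_nat subn1.
  rewrite -/n mulrACA -big_split/=; congr (_ * _); first by field.
  by apply: eq_bigr => k _; field.
rewrite e1 -(@prod_1_sub_omega n)// -[RHS]mulrA; congr (_ * _).
pose t k := cos (ang n k) / sin (ang n k).
(* The left side is (1 - omega) + w (1 + omega), and (1 + omega)/(1 - omega) = i cot ([ang]). *)
have fk k : (0 < k < n)%N ->
    (1 + w) - omega n k * (1 - w) = (1 - omega n k) * (1 + w * (Ci R * (t k)%:C)).
  move=> kn; have s0 := sin_ang_gt0 kn.
  rewrite omega_sq Cexp_CiE Ccos_real Csin_real /t.
  rewrite [(cos _ / sin _)%:C]rmorphM fmorphV/=.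
  have : ((sin (ang n k))%:C : C) != 0 by rewrite -nrm_eq0 nrmR normr_eq0 gt_eqF.
  have : ((cos (ang n k))%:C : C) ^+ 2 = 1 - ((sin (ang n k))%:C : C) ^+ 2.
    by rewrite -!rmorphXn/= cos2sin2 rmorphB/= rmorph1.
  have := Ci2 R; move: ((cos _)%:C : C) ((sin _)%:C : C) (Ci R) => c s i i2 c2 s0'.
  have -> : (c + i * s) ^+ 2 = 1 - 2 * s ^+ 2 + 2 * (i * (s * c)).
    by have := i2; rewrite !expr2 in c2 *; move=> i2'; ring: c2 i2'.
  have q : 1 - (1 - 2 * s ^+ 2 + 2 * (i * (s * c))) = 2 * s * (s - i * c) by ring.
  have q2 : 2 * s * (s - i * c) * (1 + w * (i * (c / s))) =
     2 * s * (s - i * c) + w * (2 * (s - i * c) * (i * c)) by field.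
  rewrite q q2.
  have q3 : 2 * (s - i * c) * (i * c) = 2 * (i * (s * c)) - 2 * i ^+ 2 * c ^+ 2 by ring.
  by rewrite q3 i2 c2; ring.
rewrite [LHS](eq_big_nat _ _ (F2 := fun k => (1 - omega n k) * (1 + w * (Ci R * (t k)%:C)))); last first.
  by move=> k kn; exact: fk.
rewrite big_split/=; congr (_ * _); rewrite prod_pair; apply: eq_bigr => i _.
rewrite -/n /t.
(* The partner index n - k has the opposite cotangent, so a pair of factors gives (1 + i w t)(1 - i
   w t) = 1 + w^2 t^2. *)
have -> : ang n (n - i.+1)%N = pi - ang n i.+1.
  rewrite /ang natrB; last by have := ltn_ord i; rewrite /n; lia.
  by rewrite mulrBr mulrBl mulfK// pnatr_eq0.
have -> : cos (pi - ang n i.+1) = - cos (ang n i.+1).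
  by rewrite addrC cosDpi cosN.
have -> : sin (pi - ang n i.+1) = sin (ang n i.+1).
  by rewrite addrC sinDpi sinN opprK.
rewrite mulNr realCN; move: ((_ / _)) => a.
have -> : ((a ^+ 2)%:C : C) = (a%:C : C) ^+ 2 by rewrite rmorphXn.
have := Ci2 R; move: (a%:C : C) (Ci R) => b i' i2.
have -> : (1 + w * (i' * b)) * (1 + w * (i' * - b)) = 1 - w ^+ 2 * (i' ^+ 2 * b ^+ 2) by ring.
by rewrite i2; ring.
Qed.

(** Both sides are products of n factors, 1 + z/n against exp (z/n), which differ by O(1/n^2) each;
    [prod_sub_le] sums these errors to O(1/n). *)
Lemma exp_approx (z : C) (n : nat) : (0 < n)%N -> nrm z / n%:R <= 2^-1 ->
  nrm ((1 + z / n%:R) ^+ n - Cexp z) <= expR (nrm z) * (4 * nrm z ^+ 2) / n%:R.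
Proof.
move=> n0 zn; have n0' : (0 : R) < n%:R by rewrite ltr0n.
have nn : nrm (z / n%:R) = nrm z / n%:R by rewrite nrmM nrmV nrm_nat.
have -> : Cexp z = \prod_(i < n) Cexp (z / n%:R).
  by rewrite prodr_const card_ord -Cexp_natl mulrC divfK// pnatr_eq0 -lt0n.
have -> : (1 + z / n%:R) ^+ n = \prod_(i < n) (1 + z / n%:R) by rewrite prodr_const card_ord.
apply: (le_trans (@prod_sub_le R n (fun=> 1 + z / n%:R) (fun=> Cexp (z / n%:R))
   (fun=> expR (nrm (z / n%:R))) _ _ _)).
- by move=> _; apply: le_trans (expR_ge1Dx _); rewrite lerDl nrm_ge0.
- move=> _ _; apply: (le_trans (nrmD _ _)); rewrite nrm1; exact: expR_ge1Dx.
- by move=> _ _; exact: nrm_Cexp_le.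
have -> : \prod_(i < n) expR (nrm (z / n%:R)) = expR (nrm z).
  by rewrite prodr_const card_ord -expRM_natl nn mulrC divfK// gt_eqF.
rewrite -[leRHS]mulrA ler_pM2l ?expR_gt0// sumr_const card_ord -[leLHS]mulr_natl.
have := @Cexp_sub_le R (z / n%:R); rewrite nn => /(_ zn) h.
have e : 1 + z / n%:R - Cexp (z / n%:R) = - (Cexp (z / n%:R) - 1 - z / n%:R) by ring.
rewrite e nrmN; rewrite -(ler_pM2l n0') in h.
apply: (le_trans h); rewrite le_eqVlt; apply/orP; left; apply/eqP.
by field; rewrite gt_eqF.
Qed.

Lemma cvg_nat_inv (T : R) : T / (N + N).+1%:R @[N --> \oo] --> (0 : R).
Proof.
have h : `|T| * N.+1%:R^-1 @[N --> \oo] --> (0 : R).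
  rewrite -(mulr0 `|T|); apply: cvgM; first exact: cvg_cst.
  exact: cvg_harmonic.
have h' : - (`|T| * N.+1%:R^-1) @[N --> \oo] --> (0 : R).
  by rewrite -oppr0; apply: cvgN.
apply: (squeeze_cvgr _ h' h); near=> N.
rewrite -ler_norml normrM ler_wpM2l// normfV normr_nat lef_pV2 ?posrE ?ltr0n//.
by rewrite ler_nat ltnS leq_addr.
Unshelve. all: by end_near.
Qed.

Lemma exp_approx_cvg (z : C) :
  (1 + z / (N + N).+1%:R) ^+ (N + N).+1 @[N --> \oo] --> Cexp z.
Proof.
apply: (@cvgC_squeeze _ _ _ _ _ _ (fun N => expR (nrm z) * (4 * nrm z ^+ 2) / (N + N).+1%:R)).
  have /cvgrPdist_lt/(_ 2^-1) := @cvg_nat_inv (nrm z).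
  rewrite invr_gt0 ltr0n => /(_ isT); apply: filterS => N.
  rewrite sub0r normrN => hN; apply: exp_approx => //.
  by apply/ltW; apply: le_lt_trans hN; exact: ler_norm.
exact: cvg_nat_inv.
Qed.

(** From sin t <= t <= tan t follow cot^2 t <= 1/t^2 <= 1/sin^2 t, and the outer terms differ by
    exactly 1. *)
Lemma cot2_bound (t : R) : 0 < t -> t < pi / 2 -> `|(cos t / sin t) ^+ 2 - t ^- 2| <= 1.
Proof.
move=> t0 tp; have s0 : 0 < sin t by apply: sin_gt0_pihalf; rewrite t0.
have c0 : 0 < cos t by apply: cos_gt0_pihalf; rewrite tp andbT (lt_trans _ t0)// oppr_lt0 divr_gt0 ?pi_gt0.
have h1 := sin_le_id (ltW t0); have h2 := tan_ge_id t0 tp.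
have e : (cos t / sin t) ^+ 2 = (sin t) ^- 2 - 1.
  by rewrite expr_div_n cos2sin2; field; rewrite gt_eqF.
have a : t ^- 2 <= sin t ^- 2.
  by rewrite lef_pV2 ?posrE ?exprn_gt0// ler_pXn2r ?nnegrE ?(ltW t0) ?(ltW s0).
have b : (cos t / sin t) ^+ 2 <= t ^- 2.
  rewrite -exprVn ler_pXn2r ?nnegrE ?invr_ge0 ?divr_ge0 ?(ltW t0) ?(ltW s0) ?(ltW c0)//.
  by rewrite ler_pdivrMr// mulrC ler_pdivlMr// mulrC.
rewrite ler_norml; apply/andP; split; first by rewrite e; lra.
by rewrite lerBlDr; apply: (le_trans b); rewrite lerDr.
Qed.

End SineProduct.

(** * Euler's sine product and the reflection formula *)

Section Reflection.
Variable R : realType.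
Local Notation C := (CC R).
Implicit Types x w z : C.

(** [pow_sub_prod] at w = i pi x / n, n = 2 N + 1, has a known limit by [exp_approx_cvg]. Its
    factors contain (pi/n cot (pi k/n))^2 in place of 1/k^2; by [cot2_bound] each replacement costs
    O(1/n^2), hence all N of them only O(1/n). *)
Lemma sine_product x : x != 0 ->
  \prod_(i < n) (1 - x ^+ 2 / i.+1%:R ^+ 2) @[n --> \oo] --> Csin (Cpi R * x) / (Cpi R * x).
Proof.
move=> x0; pose z := Ci R * (Cpi R * x).
have px0 : Cpi R * x != 0 by rewrite mulf_neq0// Cpi_neq0.
have i0 := Ci_neq0 R.
pose n N := (N + N).+1.
pose a N i : C := 1 - x ^+ 2 * ((pi / (n N)%:R * (cos (ang R (n N) i.+1) / sin (ang R (n N) i.+1))) ^+ 2)%:C.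
have nz N : ((n N)%:R : C) != 0 by rewrite pnatr_eq0.
have ha N : nrm (z / (n N)%:R) < 1 ->
   ((1 + z / (n N)%:R) ^+ (n N) - (1 + - z / (n N)%:R) ^+ (n N)) / (2 * z) = \prod_(i < N) a N i.
  move=> z1; rewrite mulNr (@pow_sub_prod R N _ z1).
  have -> : 2 * (z / (n N)%:R) * (n N)%:R = 2 * z by field; exact: nz.
  rewrite mulrC mulKf; last by rewrite mulf_neq0 ?pnatr_eq0// mulf_neq0.
  apply: eq_bigr => i _; rewrite /a -/(n N).
  rewrite [in RHS]exprMn [in RHS]rmorphM/= [in RHS]expr_div_n [in RHS]rmorphM/= fmorphV/= !rmorphXn/= rmorph_nat.
  rewrite /z !expr_div_n !exprMn Ci2 -/(Cpi R); move: ((cos _ / sin _)%:C) ((n N)%:R : C) (nz N) => s t t0.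
  by field.
have cva : \prod_(i < N) a N i @[N --> \oo] --> Csin (Cpi R * x) / (Cpi R * x).
  have -> : Csin (Cpi R * x) / (Cpi R * x) = (Cexp z - Cexp (- z)) / (2 * z).
    rewrite /Csin -/z; move: (Cexp z) (Cexp (- z)) => u v; rewrite /z.
    by move: (Cpi R * x) (Ci R) px0 i0 => p i p0 i0'; field; rewrite i0' p0.
  have h1 := @exp_approx_cvg R z; have h2 := @exp_approx_cvg R (- z).
  have h3 : ((1 + z / (n N)%:R) ^+ (n N) - (1 + - z / (n N)%:R) ^+ (n N)) / (2 * z)
     @[N --> \oo] --> (Cexp z - Cexp (- z)) / (2 * z).
    apply: cvgCM; last exact: cvgC_cst.
    by apply: cvgCB; [exact: h1|exact: h2].
  apply: cvgC_eq h3.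
  have /cvgrPdist_lt/(_ 1 ltr01) := @cvg_nat_inv R (nrm z).
  apply: filterS => N; rewrite sub0r normrN => hN; apply: ha.
  by rewrite nrmM nrmV nrm_nat; apply: le_lt_trans hN; exact: ler_norm.
have cvd : \prod_(i < N) (1 - x ^+ 2 / i.+1%:R ^+ 2) - \prod_(i < N) a N i @[N --> \oo] --> (0 : C).
  (* The first factor of [K] bounds the product of the majorants [M i], through [inv_sqr_wgt]; the
     second is n times the sum of the factor differences. *)
  pose K := expR (2 * nrm x ^+ 2) * (nrm x ^+ 2 * pi ^+ 2).
  apply: (@cvgC_squeeze _ _ _ _ _ _ (fun N => K / (N + N).+1%:R)); last exact: cvg_nat_inv.
  near=> N; rewrite subr0 -/(n N).
  pose M i : R := 1 + nrm x ^+ 2 / i.+1%:R ^+ 2.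
  have M1 i : 1 <= M i by rewrite lerDl divr_ge0// exprn_ge0// nrm_ge0.
  have n0 : (0 : R) < (n N)%:R by rewrite ltr0n.
  have angE i : ang R (n N) i.+1 = pi / (n N)%:R * i.+1%:R by rewrite /ang; ring.
  have rng i : (i < N)%N -> 0 < ang R (n N) i.+1 /\ ang R (n N) i.+1 < pi / 2.
    move=> iN; rewrite /ang; split; first by rewrite divr_gt0// mulr_gt0 ?pi_gt0 ?ltr0n.
    rewrite ltr_pdivrMr// -mulrA ltr_pM2l ?pi_gt0// mulrC ltr_pdivlMr// -natrM ltr_nat /n; lia.
  have diff i : (i < N)%N -> `|(pi / (n N)%:R * (cos (ang R (n N) i.+1) / sin (ang R (n N) i.+1))) ^+ 2
      - (i.+1%:R ^+ 2)^-1| <= pi ^+ 2 / (n N)%:R ^+ 2.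
    move=> iN; have [h1 h2] := rng i iN; have := cot2_bound h1 h2.
    set c := cos _ / sin _; rewrite {1}angE => h.
    have -> : (pi / (n N)%:R * c) ^+ 2 - (i.+1%:R ^+ 2)^-1 =
      (pi / (n N)%:R) ^+ 2 * (c ^+ 2 - (pi / (n N)%:R * i.+1%:R) ^- 2).
      have : (i.+1%:R : R) != 0 by rewrite pnatr_eq0.
      move: (i.+1%:R : R) (pi : R) (pi_gt0 R) ((n N)%:R : R) n0 => t p p0 m m0 t0; field.
      by rewrite t0 !gt_eqF.
    rewrite normrM ger0_norm ?sqr_ge0// -[leRHS]mulr1 -expr_div_n.
    by rewrite ler_wpM2l// sqr_ge0.
  have := @prod_sub_le R N (fun i => 1 - x ^+ 2 / i.+1%:R ^+ 2) (a N) M M1 _ _.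
  move=> /(_ _ _)/le_trans; apply.
  - move=> i iN; apply: (le_trans (nrmB _ _)); rewrite nrm1 lerD2l.
    by rewrite nrmM nrmV !nrmX nrm_nat.
  - move=> i iN; apply: (le_trans (nrmB _ _)); rewrite nrm1 lerD2l.
    rewrite nrmM nrmX ler_wpM2l ?exprn_ge0 ?nrm_ge0// nrmR ger0_norm ?sqr_ge0//.
    have [h1 h2] := rng i iN.
    have s0 : 0 < sin (ang R (n N) i.+1) by apply: sin_gt0_pihalf; rewrite h1.
    have c0 : 0 < cos (ang R (n N) i.+1).
      by apply: cos_gt0_pihalf; rewrite h2 andbT (lt_trans _ h1)// oppr_lt0 divr_gt0 ?pi_gt0.
    have i1 : (0 : R) < i.+1%:R by rewrite ltr0n.
    have p0 : 0 < pi / (n N)%:R :> R by rewrite divr_gt0 ?pi_gt0.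
    rewrite -exprVn ler_pXn2r ?nnegrE ?invr_ge0 ?(ltW i1)//; last first.
      by rewrite !mulr_ge0 ?invr_ge0 ?(ltW s0) ?(ltW c0) ?(ltW n0) ?pi_ge0.
    rewrite mulrA ler_pdivrMr// ler_pdivlMl//.
    by have := tan_ge_id h1 h2; rewrite {1}angE; lra.
  have PM : \prod_(i < N) M i <= expR (2 * nrm x ^+ 2).
    apply: (@le_trans _ _ (\prod_(i < N) expR (nrm x ^+ 2 * (2 * wgt R i)))).
      apply: ler_prod => i _; rewrite (le_trans ler01)//=.
      apply: le_trans (expR_ge1Dx _); rewrite lerD2l ler_wpM2l ?exprn_ge0 ?nrm_ge0//.
      exact: inv_sqr_wgt.
    rewrite -expR_sum ler_expR -big_distrr/= -big_distrr/= mulrA [X in X * _]mulrC.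
    by rewrite ler_piMr ?sum_wgt_le// mulr_ge0// exprn_ge0// nrm_ge0.
  have S0 i : 0 <= nrm (1 - x ^+ 2 / i.+1%:R ^+ 2 - a N i) by exact: nrm_ge0.
  have SS : \sum_(i < N) nrm (1 - x ^+ 2 / i.+1%:R ^+ 2 - a N i) <= nrm x ^+ 2 * pi ^+ 2 / (n N)%:R.
    apply: (@le_trans _ _ (\sum_(i < N) nrm x ^+ 2 * (pi ^+ 2 / (n N)%:R ^+ 2))).
      apply: ler_sum => i _; rewrite /a.
      set u := (_ ^+ 2)%:C.
      have -> : 1 - x ^+ 2 / i.+1%:R ^+ 2 - (1 - x ^+ 2 * u) = x ^+ 2 * (u - (i.+1%:R ^+ 2)^-1) by ring.
      rewrite nrmM nrmX ler_wpM2l ?exprn_ge0 ?nrm_ge0//.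
      have -> : (i.+1%:R : C) ^- 2 = ((i.+1%:R : R) ^- 2)%:C.
        by rewrite fmorphV/= rmorphXn/= rmorph_nat.
      by rewrite /u -rmorphB/= nrmR; exact: diff i (ltn_ord i).
    rewrite sumr_const card_ord -[leLHS]mulr_natl.
    have Nn : (N%:R : R) <= (n N)%:R by rewrite ler_nat /n; lia.
    have q0 : 0 <= nrm x ^+ 2 * (pi ^+ 2 / (n N)%:R ^+ 2).
      by rewrite mulr_ge0 ?exprn_ge0 ?nrm_ge0// divr_ge0// exprn_ge0// ?pi_ge0// ltW.
    apply: (le_trans (ler_wpM2r q0 Nn)).
    by rewrite le_eqVlt; apply/orP; left; apply/eqP; field; rewrite gt_eqF.
  apply: (@le_trans _ _ (expR (2 * nrm x ^+ 2) * (nrm x ^+ 2 * pi ^+ 2 / (n N)%:R))).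
    apply: ler_pM => //; last by apply: sumr_ge0 => i _.
    by apply: prodr_ge0 => i _; apply: le_trans (M1 i).
  by rewrite /K mulrA.
have := cvgCD cvd cva; rewrite add0r => h.
have {}h : \prod_(i < N) (1 - x ^+ 2 / i.+1%:R ^+ 2) - \prod_(i < N) a N i + \prod_(i < N) a N i
   @[N --> \oo] --> Csin (Cpi R * x) / (Cpi R * x) by exact: h.
by apply: cvgC_eq h; near=> N; rewrite subrK.
Unshelve. all: by end_near.
Qed.

Lemma inv_add_nat_cvg x : (forall i : nat, x + i%:R != 0) ->
  (x + k%:R)^-1 @[k --> \oo] --> (0 : C).
Proof.
move=> xi; have [c c0 hc] := add_nat_lower xi.
apply: (@cvgC_squeeze _ _ _ _ _ _ (fun k => c^-1 * k.+1%:R^-1)).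
  near=> k; rewrite subr0 nrmV -invfM lef_pV2 ?posrE ?mulr_gt0//; last first.
  by rewrite nrm_gt0 xi.
rewrite -(mulr0 c^-1); apply: cvgM; first exact: cvg_cst.
exact: cvg_harmonic.
Unshelve. all: by end_near.
Qed.

Lemma nonint_add x : ~ is_integer x -> forall k : int, x + k%:~R != 0.
Proof.
move=> xi k; apply/negP => /eqP e; apply: xi; exists (- k).
by rewrite rmorphN/=; apply/eqP; rewrite -addr_eq0 e.
Qed.

Lemma nonint_nonpole x : ~ is_integer x -> forall i : nat, x + i%:R != 0.
Proof. by move=> xi i; exact: (nonint_add xi i%:Z). Qed.

Lemma nonint_int x (k : int) : ~ is_integer x -> ~ is_integer (x + k%:~R).
Proof. by move=> xi [j e]; apply: xi; exists (j - k); rewrite rmorphB/= -e addrK. Qed.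

Lemma nonint_opp x : ~ is_integer x -> ~ is_integer (- x).
Proof. by move=> xi [j e]; apply: xi; exists (- j); rewrite rmorphN/= -e opprK. Qed.

Lemma nonint_opp_int x (k : int) : ~ is_integer x -> ~ is_integer (k%:~R - x).
Proof. by move=> /nonint_opp/(@nonint_int _ k); rewrite addrC. Qed.

(** The finite products cancel exactly: [gk x k], [gk (1 - x) k], the k-th sine product and [x]
    multiply to k/(1 - x + k), which tends to 1. *)
Lemma Gamma_reflection x : ~ is_integer x ->
  Gamma x * Gamma (1 - x) * Csin (Cpi R * x) = Cpi R.
Proof.
move=> xi.
have x0 : x != 0 by have := nonint_nonpole xi 0; rewrite addr0.
have g1 := Gamma_cvg (nonint_nonpole xi).
have xi' : ~ is_integer (1 - x) by exact: (@nonint_opp_int _ 1).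
have g2 := Gamma_cvg (nonint_nonpole xi').
have g3 := sine_product x0.
have h1 : gk x k * gk (1 - x) k * (\prod_(i < k) (1 - x ^+ 2 / i.+1%:R ^+ 2)) * x @[k --> \oo] -->
   Gamma x * Gamma (1 - x) * (Csin (Cpi R * x) / (Cpi R * x)) * x.
  apply: cvgCM; last exact: cvgC_cst.
  by apply: cvgCM; [apply: cvgCM; [exact: g1|exact: g2]|exact: g3].
have h2 : 1 - (1 - x) * (1 - x + k%:R)^-1 @[k --> \oo] --> (1 - (1 - x) * 0 : C).
  apply: cvgCB; first exact: cvgC_cst.
  by apply: cvgCM; [exact: cvgC_cst|exact: inv_add_nat_cvg (nonint_nonpole xi')].
have h3 : gk x k * gk (1 - x) k * (\prod_(i < k) (1 - x ^+ 2 / i.+1%:R ^+ 2)) * x @[k --> \oo] -->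
   (1 - (1 - x) * 0 : C).
  apply: cvgC_eq h2; near=> k.
  have k0 : (0 < k)%N by near: k; exists 1%N.
  rewrite /gk.
  have -> : \prod_(i < k.+1) (x + i%:R) = x * \prod_(i < k) (x + i.+1%:R).
    by rewrite big_ord_recl/= addr0.
  rewrite (big_ord_recr k (fun i : 'I_k.+1 => 1 - x + i%:R))/=.
  (* Here (x + (i + 1))((i + 1) - x) = (i + 1)^2 - x^2, factor by factor. *)
  have e : (\prod_(i < k) (x + i.+1%:R)) * (\prod_(i < k) (1 - x + i%:R)) =
      k`!%:R ^+ 2 * \prod_(i < k) (1 - x ^+ 2 / i.+1%:R ^+ 2).
    rewrite expr2 -!prod_nat_fact -!big_split/=; apply: eq_bigr => i _.
    have : (i.+1%:R : C) != 0 by rewrite pnatr_eq0.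
    rewrite nat1r -natr1; move: (i%:R : C) => t t0; by field.
  have eE : Cexp (x * (ln k%:R)%:C) * Cexp ((1 - x) * (ln k%:R)%:C) = k%:R.
    rewrite -CexpD -mulrDl addrC subrK mul1r Cexp_real lnK ?posrE ?ltr0n//.
    by rewrite rmorph_nat.
  have a0 : \prod_(i < k) (x + i.+1%:R) != 0.
    by apply/prodf_neq0 => i _; exact: nonint_nonpole.
  have b0 : \prod_(i < k) (1 - x + i%:R) != 0.
    by apply/prodf_neq0 => i _; exact: nonint_nonpole.
  have c0 := nonint_nonpole xi' k.
  have f0 : (k`!%:R : C) != 0 by rewrite pnatr_eq0 -lt0n fact_gt0.
  have -> : \prod_(i < k) (1 - x ^+ 2 / i.+1%:R ^+ 2) =
     (\prod_(i < k) (x + i.+1%:R)) * (\prod_(i < k) (1 - x + i%:R)) / k`!%:R ^+ 2.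
    by rewrite e mulrC mulKf// expf_neq0.
  move: (\prod_(i < k) (x + i.+1%:R)) (\prod_(i < k) (1 - x + i%:R)) (k`!%:R : C) a0 b0 f0
     (Cexp _) (Cexp _) eE => A B f A0 B0 f0 F E EF.
  move: (k%:R : C) c0 EF => t c0 EF.
  have -> : f * E / (x * A) * (f * F / (B * (1 - x + t))) * (A * B / f ^+ 2) * x =
    E * F / (1 - x + t) by field; rewrite x0 A0 B0 f0 c0.
  by rewrite EF; field.
have aux (g s p : C) : p != 0 -> g * (s / (p * x)) * x = 1 -> g * s = p.
  move=> p0 e; have -> : g * s = g * (s / (p * x)) * x * p by field; rewrite p0 x0.
  by rewrite e mul1r.
apply: (aux _ _ _ (Cpi_neq0 R)).
by rewrite (cvgC_unique h1 h3) mulr0 subr0.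
Unshelve. all: by end_near.
Qed.

End Reflection.

(** * Functional equations and derivatives of Gamma and psi *)

Section GammaPsi.
Variable R : realType.
Local Notation C := (CC R).
Implicit Types x h t : C.

Definition nonpole x := forall i : nat, x + i%:R != 0.

Lemma nonpoleS x : nonpole x -> nonpole (x + 1).
Proof. by move=> xi i; rewrite -addrA nat1r; exact: xi. Qed.

Lemma nonpole_addn x n : nonpole x -> nonpole (x + n%:R).
Proof. by move=> xi i; rewrite -addrA -natrD; exact: xi. Qed.

Lemma nonpole_nat n : nonpole (n.+1%:R).
Proof. by move=> i; rewrite -natrD pnatr_eq0. Qed.

Lemma nonpole_cases x : nonpole x \/ is_nonpos_integer x.
Proof.
have [xp|xn] := pselect (is_nonpos_integer x); first by right.
by left; apply/nonpoleP.
Qed.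

Lemma cvg_nrm_le (f : nat -> C) (l a : C) (b : R) :
  f n @[n --> \oo] --> l -> (forall n, nrm (f n - a) <= b) -> nrm (l - a) <= b.
Proof.
move=> /cvgC_nearP fl fb; apply/ler_addgt0Pr => e /fl[N _ /(_ N (leqnn N))/= fN].
apply: (le_trans (nrm_tri _ (f N) _)); rewrite addrC lerD//.
by rewrite nrmBC ltW.
Qed.

(** The quotient of [gk (x + 1) k] by [gk x k] is x k/(x + 1 + k), which tends to x. *)
Lemma GammaS x : nonpole x -> Gamma (x + 1) = x * Gamma x.
Proof.
move=> xi.
have x0 : x != 0 by have := xi 0%N; rewrite addr0.
have h1 := Gamma_cvg (nonpoleS xi).
have h2 : gk x k * (x * (1 - (x + 1) * (x + 1 + k%:R)^-1)) @[k --> \oo]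
    --> Gamma x * (x * (1 - (x + 1) * 0)).
  apply: cvgCM; first exact: Gamma_cvg.
  apply: cvgCM; first exact: cvgC_cst.
  apply: cvgCB; first exact: cvgC_cst.
  apply: cvgCM; first exact: cvgC_cst.
  by apply: inv_add_nat_cvg; exact: nonpoleS.
rewrite mulr0 subr0 mulr1 mulrC in h2.
apply: (cvgC_unique h1); apply: cvgC_eq h2; near=> k.
have k0 : (0 < k)%N by near: k; exists 1%N.
rewrite /gk [(x + 1) * (ln _)%:C]mulrDl CexpD mul1r Cexp_real lnK ?posrE ?ltr0n// rmorph_nat.
rewrite (big_ord_recr k (fun i : 'I_k.+1 => x + 1 + i%:R))/= big_ord_recl/= addr0.
have -> : \prod_(i < k) (x + (lift ord0 i)%:R) = \prod_(i < k) (x + 1 + i%:R).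
  by apply: eq_bigr => i _; rewrite lift0 -nat1r addrA.
have : \prod_(i < k) (x + 1 + i%:R) != 0.
  by apply/prodf_neq0 => i _; exact: nonpoleS.
have := nonpoleS xi k; move: (\prod_(i < k) _) (k%:R : C) (Cexp _) (_`!%:R) => A u E f u0 A0.
by field; rewrite x0 A0 u0.
Unshelve. all: by end_near.
Qed.

Lemma Gamma_addn x n : nonpole x -> Gamma (x + n%:R) = \prod_(i < n) (x + i%:R) * Gamma x.
Proof.
move=> xi; elim: n => [|n IH]; first by rewrite big_ord0 mul1r addr0.
rewrite big_ord_recr/= -natr1 addrA GammaS; last exact: nonpole_addn.
by rewrite IH; ring.
Qed.

Lemma Gamma1 : Gamma (1 : C) = 1.
Proof.
have h : nonpole (1 : C) by exact: (@nonpole_nat 0).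
exact: (cvgC_unique (Gamma_cvg h) (@gk1_cvg R)).
Qed.

Lemma Gamma_nat n : Gamma (n.+1%:R : C) = n`!%:R.
Proof.
rewrite -nat1r Gamma_addn; last exact: (@nonpole_nat 0).
by rewrite prod_nat_fact Gamma1 mulr1.
Qed.

(** Once k reaches the order of the pole, the denominator of Gauss' product contains a zero factor,
    and [0^-1 = 0] makes the sequence vanish. *)
Lemma Gamma_pole x : is_nonpos_integer x -> Gamma x = 0.
Proof.
move=> [n ->]; apply: limC; apply: (@cvgC_eq _ _ _ _ (fun=> 0)); last exact: cvgC_cst.
near=> k; apply/esym.
rewrite (_ : \prod_(i < k.+1) _ = 0) ?invr0 ?mulr0//.
have nk : (n < k.+1)%N by near: k; exists n => // k /=; rewrite ltnS.
by apply/eqP/prodf_eq0; exists (Ordinal nk) => //=; rewrite addNr.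
Unshelve. all: by end_near.
Qed.

Lemma Csin_pi_neq0 x : ~ is_integer x -> Csin (Cpi R * x) != 0.
Proof.
move=> /Gamma_reflection h; apply/eqP => s0; have := Cpi_neq0 R.
by rewrite -h s0 mulr0 eqxx.
Qed.

Lemma Gamma_neq0 x : nonpole x -> Gamma x != 0.
Proof.
move=> xi; have [[[n|n] e]|ni] := pselect (is_integer x).
- case: n => [|n] in e; first by have := xi 0%N; rewrite e addr0 eqxx.
  by rewrite e -pmulrn Gamma_nat pnatr_eq0 -lt0n fact_gt0.
- by have := xi n.+1; rewrite e NegzE mulrNz addNr eqxx.
apply/eqP => g0; have := Cpi_neq0 R.
by rewrite -(Gamma_reflection ni) g0 !mul0r eqxx.
Qed.

Definition cl x : C := lim (ck x k @[k --> \oo]).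

Lemma cl_cvg x : nonpole x -> ck x k @[k --> \oo] --> cl x.
Proof. by move=> /ck_cvg[l h]; rewrite /cl (limC h). Qed.

Lemma clS x : nonpole x -> cl (x + 1) = cl x + x^-1.
Proof.
move=> xi; have h1 := cl_cvg (nonpoleS xi).
have h2 : ck x k + (x^-1 - (x + 1 + k%:R)^-1) @[k --> \oo] --> cl x + (x^-1 - 0).
  apply: cvgCD; first exact: cl_cvg.
  apply: cvgCB; first exact: cvgC_cst.
  by apply: inv_add_nat_cvg; exact: nonpoleS.
rewrite subr0 in h2; apply: (cvgC_unique h1); apply: cvgC_eq h2; near=> k.
rewrite /ck big_ord_recl/= addr0 [in RHS]big_ord_recr/=.
have -> : \sum_(i < k) (x + (lift ord0 i)%:R)^-1 = \sum_(i < k) (x + 1 + i%:R)^-1.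
  by apply: eq_bigr => i _; rewrite lift0 -nat1r addrA.
ring.
Unshelve. all: by end_near.
Qed.

(** In the limit [gk_split] becomes Gamma (x + h) = Gamma x * exp (h * cl x) * P, where P is an
    infinite product with P - 1 = O(h^2). Hence [cl x] is the logarithmic derivative. *)
Lemma Gamma_deriv_cl x : nonpole x -> has_deriv (@Gamma R) x (Gamma x * cl x).
Proof.
move=> xi; have [c c0 hc] := add_nat_lower xi.
pose L := nrm (cl x) + 1.
have L0 : 0 < L by rewrite ltr_wpDl ?nrm_ge0.
(* The radius keeps |h|/c below 1/8 and |h cl x| below 1/2, as the estimates of P and of the
   exponential ask. In [B], 8 L^2 is the exponential remainder times |P| <= 2, and 64/c^2 comes from
   |P - 1| <= 2 s times |1 + h d| <= 2. *)
pose B := nrm (Gamma x) * (8 * L ^+ 2 + 64 / c ^+ 2).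
apply: (@has_deriv_sq _ _ _ _ B (Num.min (c / 8) (2^-1 / L))).
  by rewrite lt_min !divr_gt0.
move=> h; rewrite lt_min => /andP[hc8 hL].
have h0 := nrm_ge0 h.
have ige (i : nat) : (1 : R) <= i.+1%:R by rewrite ler1n.
have cle (i : nat) : c <= c * i.+1%:R by rewrite ler_peMr// ltW.
have hxi : nonpole (h + x).
  move=> i; apply/eqP => e.
  have := hc i; have : x + i%:R = - h by apply/eqP; rewrite -addr_eq0 addrC addrA e.
  move=> ->; rewrite nrmN; have := cle i; lra.
have wb i : nrm (wf x h i - 1) <= 16 * (nrm h / c) ^+ 2 * wgt R i.
  have -> : 16 = 8 / 2^-1 :> R by rewrite invrK -natrM.
  apply: wf_bound => //; rewrite ?invr_gt0//; first by have := cle i; lra.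
  have v1 : nrm (h / (x + i%:R)) <= 2^-1.
    rewrite nrmM nrmV ler_pdivrMr ?nrm_gt0//; have := hc i; have := cle i; lra.
  have := nrm_ge_sub 1 (- (h / (x + i%:R))); rewrite opprK nrmN nrm1; lra.
have [P hP] : exists P : C, \prod_(i < n) wf x h i @[n --> \oo] --> P.
  exact: (eventually_prod_wgt (N := 0%N) (fun i _ => wb i)).
set s := 16 * (nrm h / c) ^+ 2 in wb.
have hcq : nrm h / c <= 8^-1 by rewrite ler_pdivrMr//; lra.
have hcq0 : 0 <= nrm h / c by rewrite divr_ge0// ltW.
have s0 : 0 <= s by rewrite /s mulr_ge0// exprn_ge0.
have s1 : s <= 2^-1.
  have : (nrm h / c) ^+ 2 <= 8^-1 ^+ 2 by rewrite ler_pXn2r// nnegrE invr_ge0.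
  rewrite /s; lra.
have P1 : nrm (P - 1) <= 2 * s.
  apply: (cvg_nrm_le hP) => n.
  have -> : \prod_(i < n) wf x h i = \prod_(i < n) (1 + (wf x h i - 1)).
    by apply: eq_bigr => i _; rewrite addrC subrK.
  apply: (le_trans (@prod_sub1_le R n (fun i => wf x h i - 1) (fun i => s * wgt R i) wb)).
  rewrite -big_distrr/=.
  have w1 := sum_wgt_le R n.
  have w0 : 0 <= \sum_(i < n) wgt R i by apply: sumr_ge0 => i _; exact: wgt_ge0.
  set q := s * _.
  have qs : q <= s by rewrite ler_piMr.
  have q0 : 0 <= q by rewrite mulr_ge0.
  have := @expR_sub_le R q; rewrite ger0_norm// => /(_ (le_trans qs s1)).
  rewrite ler_norml => /andP[_]; have : q ^+ 2 <= q * 2^-1 by rewrite expr2 ler_wpM2l// (le_trans qs).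
  lra.
have GE : Gamma (h + x) = Gamma x * (Cexp (h * cl x) * P).
  apply: (cvgC_unique (Gamma_cvg hxi)); under eq_fun do rewrite gk_split//.
  apply: cvgCM; first exact: Gamma_cvg.
  apply: cvgCM; first by apply: cvg_Cexp; apply: cvgCM; [exact: cvgC_cst|exact: cl_cvg].
  by apply: (cvg_comp (fun k => k.+1) (fun n => \prod_(i < n) wf x h i)); [exact: cvg_addnl 1%N|exact: hP].
set d := cl x in GE L B L0 hL *; set E := Cexp (h * d) in GE *.
have -> : Gamma (h + x) - Gamma x - h * (Gamma x * d) =
   Gamma x * ((E - 1 - h * d) * P + (1 + h * d) * (P - 1)) by rewrite GE; ring.
rewrite nrmM /B -mulrA ler_wpM2l ?nrm_ge0//.
have hd : nrm (h * d) <= 2^-1.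
  rewrite nrmM; move: hL; rewrite ltr_pdivlMr// /L => hL.
  have := nrm_ge0 d; nra.
have E1 : nrm (E - 1 - h * d) <= 4 * (nrm h ^+ 2 * L ^+ 2).
  apply: (le_trans (Cexp_sub_le hd)); rewrite ler_wpM2l// nrmM -exprMn.
  rewrite ler_pXn2r// ?nnegrE ?mulr_ge0 ?nrm_ge0 ?(ltW L0)//.
  by rewrite ler_wpM2l// /L lerDl.
have Pn : nrm P <= 2 by have := nrmD (P - 1) 1; rewrite subrK nrm1; lra.
have hdn : nrm (1 + h * d) <= 2 by apply: (le_trans (nrmD _ _)); rewrite nrm1; lra.
apply: (le_trans (nrmD _ _)); rewrite !nrmM.
have q1 := ler_pM (nrm_ge0 _) (nrm_ge0 _) E1 Pn.
have q2 := ler_pM (nrm_ge0 _) (nrm_ge0 _) hdn P1.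
have -> : (8 * L ^+ 2 + 64 / c ^+ 2) * nrm h ^+ 2 = 4 * (nrm h ^+ 2 * L ^+ 2) * 2 + 2 * (2 * s).
  by rewrite /s; field; rewrite gt_eqF.
exact: lerD.
Qed.

Lemma psiE x : nonpole x -> psi x = cl x.
Proof.
move=> xi; rewrite /psi (has_deriv_derive1 (Gamma_deriv_cl xi)).
by rewrite mulrC mulKf// Gamma_neq0.
Qed.

Lemma Gamma_deriv x : nonpole x -> has_deriv (@Gamma R) x (Gamma x * psi x).
Proof. by move=> xi; rewrite psiE//; exact: Gamma_deriv_cl. Qed.

Lemma psiS x : nonpole x -> psi (x + 1) = psi x + x^-1.
Proof. by move=> xi; rewrite !psiE ?clS//; exact: nonpoleS. Qed.

(** At the poles the default value [Gamma = 0] makes both sides 0, so this is the functional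
    equation of the entire function 1/Gamma. *)
Lemma invGammaS x : (Gamma x)^-1 = x * (Gamma (x + 1))^-1.
Proof.
have [xi|[[|n] e]] := nonpole_cases x.
- rewrite GammaS// invfM mulVKf//; by have := xi 0%N; rewrite addr0.
- by rewrite e oppr0 mul0r Gamma_pole ?invr0//; exists 0%N; rewrite oppr0.
rewrite !Gamma_pole ?invr0 ?mulr0//; last by exists n.+1.
by exists n; rewrite e -natr1 opprD subrK.
Qed.

Lemma invGamma_addn x n : (Gamma x)^-1 = \prod_(i < n) (x + i%:R) * (Gamma (x + n%:R))^-1.
Proof.
elim: n => [|n IH]; first by rewrite big_ord0 mul1r addr0.
by rewrite IH big_ord_recr/= invGammaS -natr1 addrA -mulrA.
Qed.

Lemma cvg_shift0 (f : C -> C) x (l : C) : f (h + x) @[h --> (0 : C)^'] --> l ->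
  f y @[y --> x^'] --> l.
Proof.
move=> /cvgC_nearP fl; apply/cvgC_nearP => e /fl/nbhsC_dP[d d0 fd].
apply/nbhsC_dP; exists d => // y yx yd.
by have := fd (y - x); rewrite subrK subr0 subr_eq0; exact.
Qed.

(** Near the pole -k, 1/Gamma (t) = (t + k) g t with g t = t (t + 1) ... (t + k - 1)/Gamma (t + k +
    1), so the derivative is g (-k) = (-1)^k k!, the negative of the conventional value of
    psi/Gamma. *)
Lemma invGamma_deriv x : has_deriv (fun t => (Gamma t)^-1) x (- psi_div_Gamma x).
Proof.
rewrite /psi_div_Gamma; case: pselect => [xp|xn].
  case: (cid xp) => /= k -> {xp}.
  pose g t := \prod_(i < k) (t + i%:R) * (Gamma (t + k.+1%:R))^-1.
  have eg t : (Gamma t)^-1 = (t + k%:R) * g t.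
    by rewrite (invGamma_addn t k.+1) big_ord_recr/= /g; ring.
  have idc : (fun h : C => h) h @[h --> (0 : C)^'] --> (0 : C).
    by apply/cvgC_nearP => e e0; apply/nbhsC_dP; exists e.
  have gc : g (h - k%:R) @[h --> (0 : C)^'] --> \prod_(i < k) (0 - k%:R + i%:R) * (1 : C)^-1.
    apply: cvgCM.
      apply: cvg_prodC => i _; apply: cvgCD; last exact: cvgC_cst.
      by apply: cvgCB; [exact: idc|exact: cvgC_cst].
    apply: cvgCV; first exact: oner_neq0.
    have gd := has_deriv_cvg (Gamma_deriv (@nonpole_nat 0 : nonpole 1)).
    rewrite Gamma1 in gd; apply: cvgC_eq gd; apply/nbhsC_dP; exists 1 => // h h0 _.
    by rewrite -natr1 addrA subrK.
  have -> : - ((-1) ^+ k.+1 * k`!%:R) = \prod_(i < k) (0 - k%:R + i%:R) * (1 : C)^-1.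
    rewrite invr1 mulr1 exprS mulN1r mulNr opprK -prod_nat_fact.
    rewrite (reindex_inj rev_ord_inj)/= -[(-1) ^+ k](_ : \prod_(i < k) -1 = _); last first.
      by rewrite prodr_const card_ord.
    rewrite -big_split/=; apply: eq_bigr => i _.
    rewrite natrB ?ltn_ord// -natr1; ring.
  rewrite /has_deriv; apply: cvgC_eq gc; apply/nbhsC_dP; exists 1 => // h h0 _.
  by rewrite !eg subrK addNr mul0r subr0 mulKf.
have xi : nonpole x by apply/nonpoleP.
have g0 := Gamma_neq0 xi.
have := has_derivV g0 (Gamma_deriv xi).
suff -> : - (Gamma x * psi x) / Gamma x ^+ 2 = - (psi x / Gamma x) by [].
by field.
Qed.

Lemma Csin_pi_shift x (k : int) : Csin (Cpi R * (x + k%:~R)) = (-1) ^ k * Csin (Cpi R * x).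
Proof.
have s1 y : Csin (Cpi R * (y + 1)) = - Csin (Cpi R * y).
  rewrite /Csin mulrDr mulr1 mulrDr opprD !CexpD Cexp_Ci Cexp_NCi cospi sinpi oppr0.
  rewrite complexr0 realCN mulrN1 mulrN1; field; exact: Ci_neq0.
have sn y (n : nat) : Csin (Cpi R * (y + n%:R)) = (-1) ^+ n * Csin (Cpi R * y).
  elim: n => [|n IH]; first by rewrite addr0 mul1r.
  by rewrite -natr1 addrA s1 IH exprS mulN1r mulNr.
case: k => n; first exact: sn.
rewrite NegzE mulrNz -exprnN.
have := sn (x - n.+1%:R) n.+1; rewrite subrK => ->.
by rewrite mulKf// expf_neq0// oppr_eq0 oner_eq0.
Qed.

Lemma CsinN x : Csin (- x) = - Csin x.
Proof. by rewrite /Csin mulrN opprK -[RHS]mulNr opprB. Qed.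

Lemma Cexp_deriv (a : C) x : has_deriv (fun t => Cexp (a * t)) x (a * Cexp (a * x)).
Proof.
pose A := nrm a + 1; have A0 : 0 < A by rewrite ltr_wpDl ?nrm_ge0.
apply: (@has_deriv_sq _ _ _ _ (nrm (Cexp (a * x)) * (4 * A ^+ 2)) (2^-1 / A)).
  by rewrite divr_gt0.
move=> h; rewrite ltr_pdivlMr// => hA.
have ah : nrm (a * h) <= 2^-1.
  by rewrite nrmM; move: hA; rewrite /A; have := nrm_ge0 h; have := nrm_ge0 a; nra.
have -> : Cexp (a * (h + x)) - Cexp (a * x) - h * (a * Cexp (a * x)) =
   Cexp (a * x) * (Cexp (a * h) - 1 - a * h) by rewrite mulrDr CexpD; ring.
rewrite nrmM -mulrA ler_wpM2l ?nrm_ge0//; apply: (le_trans (Cexp_sub_le ah)).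
rewrite -mulrA ler_wpM2l// nrmM exprMn ler_wpM2r ?exprn_ge0 ?nrm_ge0//.
by rewrite ler_pXn2r ?nnegrE ?nrm_ge0 ?(ltW A0)// lerDl.
Qed.

Lemma has_deriv_ext (f g : C -> C) x d : f =1 g -> has_deriv f x d -> has_deriv g x d.
Proof. by move=> fg; rewrite (funext fg). Qed.

Lemma Csin_pi_deriv x : has_deriv (fun t => Csin (Cpi R * t)) x (Cpi R * Ccos (Cpi R * x)).
Proof.
have i0 := Ci_neq0 R.
have h1 := @Cexp_deriv (Ci R * Cpi R) x.
have h2 := @Cexp_deriv (- (Ci R * Cpi R)) x.
have h3 := has_derivD (has_derivM h1 (@has_deriv_cst _ (2 * Ci R)^-1 x))
   (has_derivM h2 (@has_deriv_cst _ (- (2 * Ci R)^-1) x)).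
have e1 : (fun t : C => Cexp (Ci R * Cpi R * t) / (2 * Ci R) +
   Cexp (- (Ci R * Cpi R) * t) * - (2 * Ci R)^-1) =1 (fun t => Csin (Cpi R * t)).
  by move=> t; rewrite /Csin !mulNr mulrA; ring.
have := has_deriv_ext e1 h3.
suff -> : Ci R * Cpi R * Cexp (Ci R * Cpi R * x) / (2 * Ci R) + Cexp (Ci R * Cpi R * x) * 0 +
   (- (Ci R * Cpi R) * Cexp (- (Ci R * Cpi R) * x) * - (2 * Ci R)^-1 +
    Cexp (- (Ci R * Cpi R) * x) * 0) = Cpi R * Ccos (Cpi R * x) by [].
rewrite /Ccos [Ci R * (Cpi R * x)]mulrA [- _ * x]mulNr; move: (Cpi R) (Ci R) i0 (Cexp _) (Cexp _) => p i i0 u v.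
by field.
Qed.

Lemma nonint_open x : ~ is_integer x ->
  exists2 e : R, 0 < e & forall h, nrm h < e -> ~ is_integer (h + x).
Proof.
move=> xi.
have [c c0 hc] := add_nat_lower (nonint_nonpole xi).
have [d d0 hd] := add_nat_lower (nonint_nonpole (nonint_opp xi)).
exists (Num.min c d) => [|h]; first by rewrite lt_min c0.
rewrite lt_min => /andP[hc' hd'] [k e].
have key (i : nat) : (1 : R) <= i.+1%:R by rewrite ler1n.
case: k e => n e.
  have := hd n; rewrite (_ : - x + n%:R = h); last by rewrite [n%:R]pmulrn -e addrCA addNr addr0.
  have := key n; nra.
have := hc n.+1; rewrite (_ : x + n.+1%:R = - h); last first.
  have -> : (n.+1%:R : C) = - (h + x) by rewrite e NegzE mulrNz opprK.
  by ring.
rewrite nrmN; have := key n.+1; nra.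
Qed.

(** The product in [Gamma_reflection] is constant near [x]; its derivative by the product rule
    therefore vanishes. *)
Lemma psi_reflection x : ~ is_integer x -> psi (1 - x) - psi x = Cpi R * Ccot (Cpi R * x).
Proof.
move=> xi; have xi' : ~ is_integer (1 - x) by exact: (@nonint_opp_int _ _ 1).
have h1 := Gamma_deriv (nonint_nonpole xi).
have h2 := has_deriv_refl (Gamma_deriv (nonint_nonpole xi')).
have h3 := has_derivM (has_derivM h1 h2) (@Csin_pi_deriv x).
have h4 : has_deriv (fun t => Gamma t * Gamma (1 - t) * Csin (Cpi R * t)) x 0.
  have [e e0 he] := nonint_open xi.
  apply: (has_deriv_eq e0 _ (@has_deriv_cst _ (Cpi R) x)) => h hh.
  by rewrite Gamma_reflection//; exact: he.
have := has_deriv_unique h3 h4.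
rewrite /Ccot; have s0 := Csin_pi_neq0 xi.
have g1 := Gamma_neq0 (nonint_nonpole xi); have g2 := Gamma_neq0 (nonint_nonpole xi').
move: (Cpi R) (Ccos _) (Csin _) s0 (psi (1 - x)) (psi x) (Gamma (1 - x)) g2 (Gamma x) g1.
move=> p c s s0 v u b b0 a a0 e.
apply: (mulfI (x := a * b * s)); first by rewrite !mulf_neq0.
apply/eqP; rewrite -subr_eq0; apply/eqP; rewrite -[RHS]oppr0 -e.
by field.
Qed.

End GammaPsi.

(** * Power and Laurent series *)

Section GeomSum.
Variable R : realType.
Local Notation C := (CC R).
Implicit Types (u v : nat -> C) (S T z : C).

Definition geom_bounded u :=
  exists (M q : R), [/\ 0 <= M, 0 < q, q < 1 & forall n, nrm (u n) <= M * q ^+ n].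

Definition gsum u S := geom_bounded u /\ series u n @[n --> \oo] --> S.

Lemma expn_le (a b : R) (n : nat) : 0 <= a -> a <= b -> a ^+ n <= b ^+ n.
Proof. by move=> a0 ab; apply: lerXn2r; rewrite ?nnegrE// (le_trans a0). Qed.

Lemma geom_bounded_gsum u : geom_bounded u -> exists S, gsum u S.
Proof.
move=> gu; have [M [q [M0 q0 q1 uM]]] := gu.
have [S hS] : exists S : C, series u n @[n --> \oo] --> S.
  apply: (cvg_seriesC uM); apply: is_cvg_geometric_series.
  by rewrite ger0_norm// ltW.
by exists S.
Qed.

Lemma gsum_lim u S : gsum u S -> limn (series u) = S.
Proof. by move=> [_ /limC]. Qed.

Lemma gsum_unique u S T : gsum u S -> gsum u T -> S = T.
Proof. by move=> /gsum_lim <- /gsum_lim. Qed.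

Lemma gsum_ext u v S : u =1 v -> gsum u S -> gsum v S.
Proof. by move=> /funext ->. Qed.

Lemma geom_boundedD u v : geom_bounded u -> geom_bounded v -> geom_bounded (fun n => u n + v n).
Proof.
move=> [M [q [M0 q0 q1 uM]]] [M' [q' [M'0 q'0 q'1 vM]]].
exists (M + M'), (Num.max q q'); split; rewrite ?addr_ge0 ?lt_max ?gt_max ?q0 ?q1//.
move=> n; apply: (le_trans (nrmD _ _)); rewrite mulrDl; apply: lerD.
  apply: (le_trans (uM n)); apply: (ler_wpM2l M0); apply: expn_le; first exact: ltW.
  by rewrite le_max lexx.
apply: (le_trans (vM n)); apply: (ler_wpM2l M'0); apply: expn_le; first exact: ltW.
by rewrite le_max lexx orbT.
Qed.

Lemma gsumD u v S T : gsum u S -> gsum v T -> gsum (fun n => u n + v n) (S + T).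
Proof.
move=> [gu hu] [gv hv]; split; first exact: geom_boundedD.
have -> : series (fun n => u n + v n) = fun n => series u n + series v n.
  by apply/funext => n; rewrite /series/= big_split.
by apply: cvgCD; [exact: hu|exact: hv].
Qed.

Lemma gsumZ (a : C) u S : gsum u S -> gsum (fun n => a * u n) (a * S).
Proof.
move=> [[M [q [M0 q0 q1 uM]]] hu]; split.
  exists (nrm a * M), q; split=> //; first by rewrite mulr_ge0 ?nrm_ge0.
  by move=> n; rewrite nrmM -mulrA ler_wpM2l ?nrm_ge0.
have -> : series (fun n => a * u n) = fun n => a * series u n.
  by apply/funext => n; rewrite /series/= big_distrr.
by apply: cvgCM; [exact: cvgC_cst|exact: hu].
Qed.

Definition delay (d : nat) u (n : nat) : C := if (n < d)%N then 0 else u (n - d)%N.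

Lemma gsum_delay d u S : gsum u S -> gsum (delay d u) S.
Proof.
move=> [[M [q [M0 q0 q1 uM]]] hu]; split.
  exists (M * q ^- d), q; split=> //; first by rewrite mulr_ge0// invr_ge0 exprn_ge0// ltW.
  move=> n; rewrite /delay; case: ltnP => nd.
    by rewrite nrm0 !mulr_ge0// ?invr_ge0 exprn_ge0// ltW.
  apply: (le_trans (uM _)); rewrite -mulrA ler_wpM2l// -{2}(subnK nd) exprD.
  by rewrite mulrC mulfK// expf_neq0// gt_eqF.
have e n : series (delay d u) (n + d)%N = series u n.
  rewrite /series/= addnC /index_iota subn0 iotaD big_cat/= add0n big1_seq ?add0r.
    rewrite -[in LHS](addn0 d) iotaDl big_map subn0; apply: eq_bigr => i _.
    by rewrite /delay addn0 ltnNge leq_addr/= addKn.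
  by move=> i /andP[_]; rewrite mem_iota add0n => /andP[_ id]; rewrite /delay id.
rewrite -(cvg_shiftn d); have -> : (fun n => series (delay d u) (n + d)%N) = series u by apply/funext.
exact: hu.
Qed.

(** With [s] the square root of [q], one factor s^n remains as rate and the other absorbs n + 1 by
    Bernoulli's inequality for (1/s)^n. *)
Lemma Bernoulli_geom (q : R) : 0 < q -> q < 1 ->
  exists (K s : R), [/\ 0 <= K, 0 < s, s < 1 & forall n, n.+1%:R * q ^+ n <= K * s ^+ n].
Proof.
move=> q0 q1; pose s := Num.sqrt q.
have s0 : 0 < s by rewrite sqrtr_gt0.
have s1 : s < 1 by rewrite -(sqrtr1 R) ltr_sqrt.
have ss : q = s * s by rewrite -expr2 sqr_sqrtr// ltW.
pose t := s^-1 - 1.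
have t0 : 0 < t by rewrite subr_gt0 invf_gt1.
exists (Num.max 1 t^-1), s; split=> //; first by rewrite le_max ler01.
move=> n; rewrite ss exprMn mulrA ler_wpM2r ?exprn_ge0 ?(ltW s0)//.
have b : 1 + n%:R * t <= s^-1 ^+ n.
  have -> : s^-1 = 1 + t by rewrite /t addrC subrK.
  elim: n => [|n IH]; first by rewrite mul0r addr0.
  rewrite exprS; have := ler_wpM2l (ltW (addr_gt0 ltr01 t0)) IH; apply: le_trans.
  have : 0 <= n%:R * t * t by rewrite !mulr_ge0// ltW.
  by rewrite -natr1; lra.
rewrite -[s ^+ n]invrK -exprVn ler_pdivrMr ?exprn_gt0 ?invr_gt0//.
have K0 : 0 <= Num.max 1 t^-1 by rewrite le_max ler01.
apply: le_trans (ler_wpM2l K0 b); rewrite mulrDr mulr1 -natr1 addrC lerD//.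
  by rewrite le_max lexx.
rewrite mulrCA ler_peMr// -(mulVf (lt0r_neq0 t0)) ler_wpM2r ?(ltW t0)//.
by rewrite le_max lexx orbT.
Qed.

Lemma nat_geom_cvg0 (q : R) : 0 < q -> q < 1 -> n%:R ^+ 2 * q ^+ n @[n --> \oo] --> (0 : R).
Proof.
move=> q0 q1; have [K [s [K0 s0 s1 hK]]] := Bernoulli_geom q0 q1.
have [K' [t [K'0 t0 t1 hK']]] := Bernoulli_geom s0 s1.
have h : K * K' * t ^+ n @[n --> \oo] --> (0 : R).
  rewrite -(mulr0 (K * K')); apply: cvgM; first exact: cvg_cst.
  by apply: cvg_expr; rewrite ger0_norm// ltW.
apply: (squeeze_cvgr _ (cvg_cst 0) h); near=> n.
have qn : 0 <= q ^+ n by rewrite exprn_ge0// ltW.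
rewrite mulr_ge0 ?exprn_ge0 ?(ltW q0)//=.
apply: (@le_trans _ _ (n.+1%:R * (n.+1%:R * q ^+ n))).
  by rewrite mulrA; apply: (ler_wpM2r qn); rewrite expr2; apply: ler_pM; rewrite ?ler_nat.
apply: (le_trans (ler_wpM2l (ler0n _ _) (hK n))).
rewrite mulrCA -mulrA ler_wpM2l//; exact: hK'.
Unshelve. all: by end_near.
Qed.

Definition cauchy u v (n : nat) : C := \sum_(k < n.+1) u k * v (n - k)%N.

(** The partial sums of the Cauchy product omit from the product of partial sums the pairs k, j < n
    with k + j >= n: at most n^2 products, each bounded by M M' q^n. *)
Lemma gsumM u v S T : gsum u S -> gsum v T -> gsum (cauchy u v) (S * T).
Proof.
move=> [[M [q1 [M0 q10 q11 uM]]] hu] [[M' [q2 [M'0 q20 q21 vM]]] hv].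
pose q := Num.max q1 q2.
have q0 : 0 < q by rewrite lt_max q10.
have qlt1 : q < 1 by rewrite gt_max q11.
have {}uM n : nrm (u n) <= M * q ^+ n.
  apply: (le_trans (uM n)); apply: (ler_wpM2l M0); apply: expn_le; first exact: ltW.
  by rewrite le_max lexx.
have {}vM n : nrm (v n) <= M' * q ^+ n.
  apply: (le_trans (vM n)); apply: (ler_wpM2l M'0); apply: expn_le; first exact: ltW.
  by rewrite le_max lexx orbT.
split.
  have [K [s [K0 s0 s1 hK]]] := Bernoulli_geom q0 qlt1.
  exists (M * M' * K), s; split=> //; first by rewrite !mulr_ge0.
  move=> n; apply: (le_trans (nrm_sum _ _ _)).
  apply: (@le_trans _ _ (\sum_(k < n.+1) M * M' * q ^+ n)).
    apply: ler_sum => k _; rewrite nrmM.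
    apply: (le_trans (ler_pM (nrm_ge0 _) (nrm_ge0 _) (uM k) (vM _))).
    have kn : (k <= n)%N by rewrite -ltnS.
    by rewrite mulrACA -exprD subnKC.
  rewrite sumr_const card_ord -[leLHS]mulr_natl -[leRHS]mulrA.
  by rewrite mulrCA ler_wpM2l ?mulr_ge0// hK.
have h0 : M * M' * (n%:R ^+ 2 * q ^+ n) @[n --> \oo] --> (0 : R).
  rewrite -(mulr0 (M * M')); apply: cvgM; first exact: cvg_cst.
  exact: nat_geom_cvg0.
have e n : series u n * series v n - series (cauchy u v) n =
    \sum_(0 <= k < n) \sum_(n - k <= j < n) u k * v j.
  have -> : series (cauchy u v) n = \sum_(0 <= k < n) \sum_(0 <= j < n - k) u k * v j.
    rewrite /series/= /cauchy.
    under eq_bigr do rewrite -(big_mkord xpredT (fun k => u k * v (_ - k)%N)).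
    elim: n => [|n IH]; first by rewrite !big_geq.
    rewrite big_nat_recr//= IH [in RHS]big_nat_recr//= subSn// subnn big_nat1.
    rewrite [X in _ + X]big_nat_recr//= subnn addrA; congr (_ + _).
    rewrite -big_split/=; apply: eq_big_nat => k /andP[_ kn].
    by rewrite subSn ?(ltnW kn)// big_nat_recr.
  rewrite /series/= mulr_suml -sumrB; apply: eq_big_nat => k /andP[_ kn].
  rewrite mulr_sumr (big_cat_nat (n := (n - k)%N) (p := n))//= ?leq_subr//.
  by rewrite addrAC subrr add0r.
have hd : series u n * series v n - series (cauchy u v) n @[n --> \oo] --> (0 : C).
  apply: (cvgC_squeeze _ h0); near=> n; rewrite subr0 e.
  apply: (le_trans (nrm_sum _ _ _)).
  apply: (@le_trans _ _ (\sum_(0 <= k < n) \sum_(0 <= j < n) M * M' * q ^+ n)).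
    apply: ler_sum_nat => k /andP[_ kn].
    apply: (le_trans (nrm_sum _ _ _)).
    rewrite [leRHS](big_cat_nat (n := (n - k)%N))//= ?leq_subr//.
    apply: ler_wpDl.
      by apply: sumr_ge0 => j _; rewrite !mulr_ge0// exprn_ge0// ltW.
    apply: ler_sum_nat => j /andP[j1 j2]; rewrite nrmM.
    apply: (le_trans (ler_pM (nrm_ge0 _) (nrm_ge0 _) (uM k) (vM _))).
    rewrite mulrACA -exprD ler_wpM2l ?mulr_ge0//.
    by apply: ler_wiXn2l; rewrite ?(ltW q0) ?(ltW qlt1)//; lia.
  by rewrite !big_const_nat !subn0 !iter_addr_0 -mulr_natl -mulr_natl expr2; lra.
have h1 : series u n * series v n - (series u n * series v n - series (cauchy u v) n)
    @[n --> \oo] --> S * T - 0.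
  by apply: cvgCB; [apply: cvgCM; [exact: hu|exact: hv]|exact: hd].
by rewrite subr0 in h1; apply: cvgC_eq h1; near=> n; rewrite opprB addrC subrK.
Unshelve. all: by end_near.
Qed.

End GeomSum.

Section Laurent.
Variable R : realType.
Local Notation C := (CC R).
Implicit Types (f g : int -> C) (S T z : C).

(* f n is the coefficient of z^n. Asking for a geometric bound, and not only for
   convergence, makes Cauchy products available. *)
Definition has_lsum z (K : nat) f S :=
  (forall i : int, i < - K%:Z -> f i = 0) /\
  gsum (fun n : nat => f (n%:Z - K%:Z) * z ^ (n%:Z - K%:Z)) S.

Lemma lsum_ext z K f g S : f =1 g -> has_lsum z K f S -> has_lsum z K g S.
Proof. by move=> /funext ->. Qed.

Lemma lsum_unique z K f S T : has_lsum z K f S -> has_lsum z K f T -> S = T.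
Proof. by move=> [_ h] [_]; exact: gsum_unique. Qed.

Lemma lsumD z K f g S T : has_lsum z K f S -> has_lsum z K g T ->
  has_lsum z K (fun i => f i + g i) (S + T).
Proof.
move=> [f0 fS] [g0 gT]; split; first by move=> i iK; rewrite f0// g0// addr0.
by apply: gsum_ext (gsumD fS gT) => n; rewrite mulrDl.
Qed.

Lemma lsumZ z K a f S : has_lsum z K f S -> has_lsum z K (fun i => a * f i) (a * S).
Proof.
move=> [f0 fS]; split; first by move=> i iK; rewrite f0// mulr0.
by apply: gsum_ext (gsumZ a fS) => n; rewrite mulrA.
Qed.

Lemma lsumB z K f g S T : has_lsum z K f S -> has_lsum z K g T ->
  has_lsum z K (fun i => f i - g i) (S - T).
Proof.
move=> fS /(lsumZ (-1)) gT; rewrite -[S - T]/(S + - T) -mulN1r.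
by apply: lsum_ext (lsumD fS gT) => i; rewrite mulN1r.
Qed.

Lemma lsum_shift z K f S (j : int) (K' : nat) : z != 0 -> has_lsum z K f S ->
  K%:Z - j <= K'%:Z -> has_lsum z K' (fun i => f (i - j)) (z ^ j * S).
Proof.
move=> z0 [f0 fS] KK; split; first by move=> i iK; apply: f0; lia.
have [d dE] : exists d : nat, d%:Z = K'%:Z + j - K%:Z by exists (absz (K'%:Z + j - K%:Z)%R); lia.
apply: gsum_ext (gsumZ (z ^ j) (gsum_delay d fS)) => n; rewrite /delay.
case: ltnP => nd.
  by rewrite mulr0 f0 ?mul0r//; lia.
have -> : n%:Z - K'%:Z - j = (n - d)%N%:Z - K%:Z by lia.
rewrite mulrCA -expfzDr//; congr (_ * _ ^ _); lia.
Qed.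

(** The coefficient at [l] of the product of series starting at - K and - K'; [u] counts from the
    lowest exponent, and a negative count means that no pair of exponents adds up to [l]. *)
Definition conv (K K' : nat) f g (l : int) : C :=
  if l + K%:Z + K'%:Z is Posz n then
    \sum_(u < n.+1) f (u%:Z - K%:Z) * g (l - (u%:Z - K%:Z)) else 0.

Lemma lsumM z K K' f g S T : z != 0 -> has_lsum z K f S -> has_lsum z K' g T ->
  has_lsum z (K + K')%N (conv K K' f g) (S * T).
Proof.
move=> z0 [f0 fS] [g0 gT]; split.
  move=> i iK; rewrite /conv; case e : (i + K%:Z + K'%:Z) => [n|//]; lia.
apply: gsum_ext (gsumM fS gT) => n; rewrite /conv /cauchy.
have -> : n%:Z - (K + K')%N%:Z + K%:Z + K'%:Z = n%:Z by lia.
rewrite mulr_suml; apply: eq_bigr => k _; have kn : (k <= n)%N by rewrite -ltnS.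
have -> : n%:Z - (K + K')%N%:Z - (k%:Z - K%:Z) = (n - k)%N%:Z - K'%:Z by lia.
rewrite mulrACA -expfzDr//; congr (_ * _ ^ _); lia.
Qed.

Lemma gsum_fin (u : nat -> C) (N : nat) : (forall n, (N <= n)%N -> u n = 0) ->
  gsum u (\sum_(n < N) u n).
Proof.
move=> u0; split.
  exists (\sum_(n < N) nrm (u n) * 2 ^+ n), 2^-1; split; rewrite ?invr_gt0 ?invf_lt1 ?ltr1n//.
    by apply: sumr_ge0 => i _; rewrite mulr_ge0 ?nrm_ge0// exprn_ge0.
  move=> n; have [nN|/u0 ->] := ltnP n N.
    rewrite exprVn ler_pdivlMr ?exprn_gt0//.
    rewrite (bigD1 (Ordinal nN))//= lerDl.
    by apply: sumr_ge0 => i _; rewrite mulr_ge0 ?nrm_ge0// exprn_ge0.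
  rewrite nrm0 mulr_ge0 ?exprn_ge0 ?invr_ge0//.
  by apply: sumr_ge0 => i _; rewrite mulr_ge0 ?nrm_ge0// exprn_ge0.
apply: (@cvgC_eq _ _ _ _ (fun=> \sum_(n < N) u n)); last exact: cvgC_cst.
near=> n; have Nn : (N <= n)%N by near: n; exists N.
rewrite /series/= (big_cat_nat (n := N))//= big_mkord [X in _ + X]big1_seq ?addr0//.
by move=> i /andP[_]; rewrite mem_index_iota => /andP[/u0].
Unshelve. all: by end_near.
Qed.

Definition of_ps (a : nat -> C) (i : int) : C := if i is Posz k then a k else 0.

Lemma lsum_ps z (a : nat -> C) S : gsum (fun k => a k * z ^+ k) S -> has_lsum z 0 (of_ps a) S.
Proof.
move=> aS; split; first by case=> // n; lia.
by apply: gsum_ext aS => n; rewrite subr0.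
Qed.

End Laurent.

(** * Coefficient sequences of subexponential growth *)

Section Subexp.
Variable R : realType.
Local Notation C := (CC R).
Implicit Types (a b : nat -> C) (x y z : C).

(* Coefficients a_k whose power series has radius of convergence at least 1; the
   class is closed under sums and products. *)
Definition subexp a := forall q : R, 0 < q -> q < 1 ->
  exists M : R, forall k, nrm (a k) * q ^+ k <= M.

(** With [s] the square root of |z|, one power s^k is spent on the growth of [a] and the other is
    the geometric rate. *)
Lemma subexp_gsum a z : z != 0 -> nrm z < 1 -> subexp a ->
  exists S, gsum (fun k => a k * z ^+ k) S.
Proof.
move=> z0 z1 ha; apply: geom_bounded_gsum.
have n0 : 0 < nrm z by rewrite nrm_gt0.
pose s := Num.sqrt (nrm z).
have s0 : 0 < s by rewrite sqrtr_gt0.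
have s1 : s < 1 by rewrite -(sqrtr1 R) ltr_sqrt.
have ss : nrm z = s * s by rewrite -expr2 sqr_sqrtr// ltW.
have [M hM] := ha s s0 s1; exists M, s; split=> //.
  by apply: le_trans (hM 0%N); rewrite mulr_ge0 ?nrm_ge0// exprn_ge0// ltW.
by move=> n; rewrite nrmM nrmX ss exprMn mulrA ler_wpM2r ?exprn_ge0 ?(ltW s0).
Qed.

Lemma subexp_cst x : subexp (fun=> x).
Proof.
move=> q q0 q1; exists (nrm x) => k; rewrite ler_piMr ?nrm_ge0//.
by rewrite exprn_ile1// ltW.
Qed.

Lemma subexpD a b : subexp a -> subexp b -> subexp (fun k => a k + b k).
Proof.
move=> ha hb q q0 q1; have [M hM] := ha q q0 q1; have [M' hM'] := hb q q0 q1.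
exists (M + M') => k; apply: le_trans (lerD (hM k) (hM' k)); rewrite -mulrDl.
by rewrite ler_wpM2r ?nrmD// exprn_ge0// ltW.
Qed.

Lemma subexpM a b : subexp a -> subexp b -> subexp (fun k => a k * b k).
Proof.
move=> ha hb q q0 q1; pose s := Num.sqrt q.
have s0 : 0 < s by rewrite sqrtr_gt0.
have s1 : s < 1 by rewrite -(sqrtr1 R) ltr_sqrt.
have ss : q = s * s by rewrite -expr2 sqr_sqrtr// ltW.
have [M hM] := ha s s0 s1; have [M' hM'] := hb s s0 s1.
exists (M * M') => k; rewrite nrmM ss exprMn mulrACA.
by apply: ler_pM => //; rewrite mulr_ge0 ?nrm_ge0// exprn_ge0// ltW.
Qed.

Lemma subexp_ext a b : a =1 b -> subexp a -> subexp b.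
Proof. by move=> /funext ->. Qed.

Lemma bounded_tail (w : nat -> R) (N : nat) (M : R) : (forall k, (N <= k)%N -> w k <= M) ->
  exists M', forall k, w k <= M'.
Proof.
elim: N M => [|N IH] M h; first by exists M => k; exact: h.
apply: (IH (Num.max M (w N))) => k; rewrite leq_eqVlt => /orP[/eqP <-|/h hk].
  by rewrite le_max lexx orbT.
by rewrite le_max hk.
Qed.

Lemma subexp_addn a (N : nat) : subexp (fun k => a (k + N)%N) -> subexp a.
Proof.
move=> h q q0 q1; have [M hM] := h q q0 q1.
apply: (@bounded_tail _ N (M * q ^+ N)) => k Nk.
rewrite -(subnK Nk) exprD mulrA ler_wpM2r ?exprn_ge0 ?(ltW q0)//; exact: hM.
Qed.

(** The ratio test: eventually |w| <= 1/q, after which |a_k| q^k is nonincreasing. *)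
Lemma subexp_ratio a (w : nat -> C) (N : nat) :
  (forall k, (N <= k)%N -> a k.+1 = w k * a k) -> w k @[k --> \oo] --> (1 : C) -> subexp a.
Proof.
move=> aw /cvgC_nearP hw q q0 q1.
have /hw[N' _ hN'] : 0 < q^-1 - 1 by rewrite subr_gt0 invf_gt1.
pose m := maxn N N'.
apply: (@bounded_tail _ m (nrm (a m) * q ^+ m)) => k mk; rewrite -(subnK mk).
elim: (k - m)%N => [|d IH]; first by [].
apply: le_trans IH; rewrite addSn aw; last by rewrite /m; lia.
rewrite nrmM exprS mulrACA ler_piMl ?mulr_ge0 ?nrm_ge0 ?exprn_ge0 ?(ltW q0)//.
have : nrm (w (d + m)%N - 1) < q^-1 - 1 by apply: hN' => /=; rewrite /m; lia.
have := nrmD (w (d + m)%N - 1) 1; rewrite subrK nrm1 => h1 h2.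
by rewrite -ler_pdivlMr// mul1r; lra.
Qed.

Lemma subexp_le a b : (forall k, nrm (a k) <= nrm (b k)) -> subexp b -> subexp a.
Proof.
move=> ab hb q q0 q1; have [M hM] := hb q q0 q1; exists M => k.
by apply: le_trans (hM k); rewrite ler_wpM2r// exprn_ge0// ltW.
Qed.

Lemma inv_addn_cvg0 y : (y + k%:R)^-1 @[k --> \oo] --> (0 : C).
Proof.
have [/inv_add_nat_cvg//|[n ->]] := nonpole_cases y.
rewrite -(cvg_shiftn n.+1).
have -> : (fun k => (- n%:R + (k + n.+1)%N%:R)^-1) = (fun k => (1 + k%:R)^-1 : C).
  by apply/funext => k; congr (_^-1); rewrite natrD -natr1; ring.
exact: inv_add_nat_cvg (@nonpole_nat _ 0).
Qed.

Lemma subexp_Gamma x : nonpole x -> subexp (fun k => Gamma (x + k%:R) / k`!%:R).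
Proof.
move=> xi; apply: (@subexp_ratio _ (fun k => 1 + (x - 1) * (1 + k%:R)^-1) 0).
  move=> k _; rewrite -natr1 addrA GammaS; last exact: nonpole_addn.
  rewrite factS natrM -[k.+1%:R]nat1r invfM.
  have : (1 + k%:R : C) != 0 by rewrite nat1r pnatr_eq0.
  have : (k`!%:R : C) != 0 by rewrite pnatr_eq0 -lt0n fact_gt0.
  move: (k%:R : C) (k`!%:R : C) (Gamma _) => t f g f0 t0.
  by field; rewrite f0 t0.
have h : 1 + (x - 1) * (1 + k%:R)^-1 @[k --> \oo] --> 1 + (x - 1) * 0.
  apply: cvgCD; first exact: cvgC_cst.
  by apply: cvgCM; [exact: cvgC_cst|exact: inv_addn_cvg0].
by rewrite mulr0 addr0 in h; exact: h.
Qed.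

Lemma eventually_neq0 y : exists N : nat, forall k, (N <= k)%N -> y + k%:R != 0.
Proof.
have [yi|[n ->]] := nonpole_cases y; first by exists 0%N => k _; exact: yi.
by exists n.+1 => k nk; rewrite addrC subr_eq0 eqr_nat gtn_eqF.
Qed.

Lemma subexp_invGamma y : subexp (fun k => k`!%:R / Gamma (y + k%:R)).
Proof.
have [N hN] := eventually_neq0 y.
apply: (@subexp_ratio _ (fun k => 1 + (1 - y) * (y + k%:R)^-1) N).
  move=> k /hN yk; rewrite [(Gamma (y + k%:R))^-1]invGammaS -addrA natr1.
  rewrite factS natrM -[k.+1%:R in X in X * _]nat1r.
  by move: (_^-1) => g; field.
have h : 1 + (1 - y) * (y + k%:R)^-1 @[k --> \oo] --> 1 + (1 - y) * 0.
  apply: cvgCD; first exact: cvgC_cst.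
  by apply: cvgCM; [exact: cvgC_cst|exact: inv_addn_cvg0].
by rewrite mulr0 addr0 in h; exact: h.
Qed.

Lemma subexp_nat : subexp (fun k => k.+1%:R).
Proof.
apply: (@subexp_ratio _ (fun k => 1 + (1 + k%:R)^-1) 0).
  move=> k _; rewrite nat1r -[k.+2%:R]natr1.
  have : (k.+1%:R : C) != 0 by rewrite pnatr_eq0.
  by move: (k.+1%:R) => t t0; field.
have h : 1 + (1 + k%:R)^-1 @[k --> \oo] --> (1 + 0 : C).
  by apply: cvgCD; [exact: cvgC_cst|exact: inv_addn_cvg0].
by rewrite addr0 in h; exact: h.
Qed.

(** By [psiS] the digamma grows by 1/(x + k) per step, which is bounded, so it grows at most
    linearly. *)
Lemma subexp_psi x : nonpole x -> subexp (fun k => psi (x + k%:R)).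
Proof.
move=> xi; have [c c0 hc] := add_nat_lower xi.
pose M := nrm (psi x) + c^-1.
have M0 : 0 <= M by rewrite addr_ge0 ?nrm_ge0// invr_ge0 ltW.
apply: (@subexp_le _ (fun k => (M%:C : C) * k.+1%:R)); last first.
  by apply: subexpM; [exact: subexp_cst|exact: subexp_nat].
move=> k; rewrite nrmM nrmR ger0_norm// nrm_nat.
elim: k => [|k IH]; first by rewrite addr0 mulr1 /M lerDl invr_ge0 ltW.
rewrite -natr1 addrA psiS; last exact: nonpole_addn.
apply: (le_trans (nrmD _ _)); rewrite -[k.+2%:R]natr1 mulrDr mulr1 lerD//.
rewrite nrmV; apply: (@le_trans _ _ c^-1); last by rewrite /M lerDr nrm_ge0.
rewrite lef_pV2 ?posrE ?nrm_gt0 ?xi//; apply: le_trans (hc k).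
by rewrite ler_peMr ?(ltW c0)// ler1n.
Qed.

(** After a shift by [N] the argument is past all poles, where psi/Gamma is an honest quotient; the
    shifted factorial is written as a Gamma value to fit [subexp_Gamma]. *)
Lemma subexp_psi_div_Gamma y : subexp (fun k => psi_div_Gamma (y + k%:R) * k`!%:R).
Proof.
have [N yN] : exists N : nat, nonpole (y + N%:R).
  have [yi|[n ->]] := nonpole_cases y; first by exists 0%N; rewrite addr0.
  by exists n.+1; rewrite -natr1 addrA addNr add0r; exact: (@nonpole_nat _ 0).
apply: (@subexp_addn _ N).
have h : subexp (fun k => psi (y + N%:R + k%:R) * (k`!%:R / Gamma (y + N%:R + k%:R)) *
    (Gamma (N.+1%:R + k%:R) / k`!%:R)).
  apply: subexpM; last by apply: subexp_Gamma; exact: nonpole_nat.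
  by apply: subexpM; [exact: subexp_psi|exact: subexp_invGamma].
apply: subexp_ext h => k.
have hN : ~ is_nonpos_integer (y + N%:R + k%:R) by apply/nonpoleP; exact: nonpole_addn.
rewrite /psi_div_Gamma natrD [k%:R + _]addrC addrA; case: pselect => [yp|_].
  by case: hN.
rewrite -[N.+1%:R + _]natrD addSn Gamma_nat [(N + k)%N]addnC.
have : (k`!%:R : C) != 0 by rewrite pnatr_eq0 -lt0n fact_gt0.
move: (k`!%:R : C) => f f0; move: (_^-1) => g; move: (psi _) => p.
by field.
Qed.

End Subexp.

(** * Vanishing of the high coefficients *)

Section Lagrange.
Variable F : fieldType.

(** The sum is the coefficient of X^(#|I| - 1) in the Lagrange interpolant of [p] at the nodes. The
    interpolant equals [p], whose degree is smaller. *)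
Lemma lagrange_sum0 (I : finType) (x : I -> F) (p : {poly F}) :
  injective x -> (size p < #|I|)%N ->
  \sum_i p.[x i] / \prod_(j | j != i) (x i - x j) = 0.
Proof.
move=> xinj sp.
pose w i := \prod_(j | j != i) (x i - x j).
pose l i : {poly F} := \prod_(j | j != i) ('X - (x j)%:P).
have w0 i : w i != 0.
  by apply/prodf_neq0 => j ji; rewrite subr_eq0 (inj_eq xinj) eq_sym.
have li i : (l i).[x i] = w i.
  by rewrite horner_prod; apply: eq_bigr => j _; rewrite hornerXsubC.
have lj i j : j != i -> (l i).[x j] = 0.
  by move=> ji; rewrite horner_prod (bigD1 j)//= hornerXsubC subrr mul0r.
have sl i : size (l i) = #|I|.
  have I1 : (0 < #|I|)%N by apply/card_gt0P; exists i.
  rewrite /l -big_filter size_prod_XsubC -(prednK I1) -(cardC1 i) cardE /enum_mem.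
  by rewrite -enumT enumT; congr (size _).+1; apply: eq_filter => j; rewrite !inE.
have ml i : l i \is monic by rewrite /l; apply: monic_prod => j _; exact: monicXsubC.
pose q := \sum_i (p.[x i] / w i) *: l i.
have qx i : q.[x i] = p.[x i].
  rewrite /q horner_sum (bigD1 i)//= hornerZ li divfK// big1 ?addr0// => j ji.
  by rewrite hornerZ lj ?mulr0// eq_sym.
have sq : (size q <= #|I|)%N.
  apply: (leq_trans (size_sum _ _ _)); apply/bigmax_leqP => i _.
  by apply: (leq_trans (size_scale_leq _ _)); rewrite sl.
have qp : q = p.
  apply/eqP; rewrite -subr_eq0; apply/eqP.
  apply: (@roots_geq_poly_eq0 _ _ [seq x i | i <- enum I]).
  - by apply/allP => _ /mapP[i _ ->]; rewrite rootE hornerD hornerN qx subrr.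
  - by rewrite map_inj_uniq ?enum_uniq.
  rewrite size_map -cardE.
  by apply: (leq_trans (size_polyD _ _)); rewrite size_polyN geq_max sq ltnW.
have I0 : (0 < #|I|)%N by exact: leq_ltn_trans sp.
have : q`_(#|I|.-1) = 0 by rewrite qp nth_default// -ltnS prednK.
rewrite /q coef_sum => e; rewrite -[RHS]e; apply: eq_bigr => i _.
rewrite coefZ -(sl i) -[(l i)`_ _]/(lead_coef (l i)) (monicP (ml i)).
by rewrite mulr1.
Qed.

Lemma size_shift_sub (p : {poly F}) (c : F) (d : nat) : (size p <= d.+1)%N ->
  (size (p \Po ('X - c%:P) - p)%R <= d)%N.
Proof.
move=> sp; have sX : size ('X - c%:P) = 2 by rewrite size_XsubC.
have sc : size (p \Po ('X - c%:P)) = size p by rewrite size_comp_poly2.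
apply/leq_sizeP => j; rewrite leq_eqVlt => /orP[/eqP <-|dj]; last first.
  by rewrite coefB !nth_default ?subr0// ?sc; apply: leq_trans sp _.
rewrite coefB; apply/eqP; rewrite subr_eq0; apply/eqP.
move: sp; rewrite leq_eqVlt => /orP[/eqP sp|sp]; last by rewrite !nth_default ?sc.
have -> : p`_d = lead_coef p by rewrite lead_coefE sp.
have -> : (p \Po ('X - c%:P))`_d = lead_coef (p \Po ('X - c%:P)) by rewrite lead_coefE sc sp.
by rewrite lead_coef_comp ?sX// lead_coefXsubC expr1n mulr1.
Qed.

Definition shp (p : {poly F}) (c : nat) : {poly F} := p \Po ('X - c%:R%:P).

Lemma shp_comp p c : shp p c \Po ('X - 1%:P) = shp p c.+1.
Proof.
rewrite /shp -comp_polyA; congr (_ \Po _).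
by rewrite comp_polyB comp_polyX comp_polyC -natr1 polyCD; ring.
Qed.

Lemma shp0 p : shp p 0 = p.
Proof. by rewrite /shp polyC0 subr0 comp_polyXr. Qed.

Variables A B : {poly F}.

(** In [csum_vanish], with n = E and v = E - t, the first product raises the numerator from level J
    - E to J - t, and the second restores the linear factors of levels J - t + 1 to J, so that all
    [csum (J - t)] share one denominator. *)
Definition Fnv (n v : nat) : {poly F} :=
  (\prod_(0 <= c < v) shp B c) * \prod_(v <= c < n) shp A c.+1.

(* The leading terms cancel as in an n-th finite difference, because
   Q_(n+1)(s) = B(s) Q_n(s-1) - A(s-n-1) Q_n(s) with A, B monic of equal degree. *)
Definition Qn (n : nat) : {poly F} :=
  \sum_(v < n.+1) ('C(n, v)%:R * (-1) ^+ (n - v)) *: Fnv n v.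

Lemma FnvS n v : Fnv n.+1 v.+1 = B * (Fnv n v \Po ('X - 1%:P)).
Proof.
rewrite /Fnv comp_polyM !rmorph_prod/= big_nat_recl// shp0.
rewrite -mulrA; congr (_ * (_ * _)).
  by apply: eq_bigr => c _; rewrite -shp_comp.
by rewrite big_add1/=; apply: eq_bigr => c _; rewrite -shp_comp.
Qed.

Lemma FnvSr n v : (v <= n)%N -> Fnv n.+1 v = Fnv n v * shp A n.+1.
Proof. by move=> vn; rewrite /Fnv big_nat_recr//= mulrA. Qed.

(** Pascal's rule splits the binomial; one half gains a factor of [B] in front, the other a factor
    of [A] at the end. *)
Lemma QnS n : Qn n.+1 = B * (Qn n \Po ('X - 1%:P)) - shp A n.+1 * Qn n.
Proof.
have e1 : B * (Qn n \Po ('X - 1%:P)) =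
    \sum_(v < n.+1) ('C(n, v)%:R * (-1) ^+ (n - v)) *: Fnv n.+1 v.+1.
  rewrite /Qn rmorph_sum/= mulr_sumr; apply: eq_bigr => v _.
  by rewrite comp_polyZ -scalerAr FnvS.
have e2 : - (shp A n.+1 * Qn n) =
    \sum_(v < n.+1) ('C(n, v)%:R * (-1) ^+ (n.+1 - v)) *: Fnv n.+1 v.
  rewrite /Qn mulr_sumr -sumrN; apply: eq_bigr => v _.
  have vn : (v <= n)%N by rewrite -ltnS.
  by rewrite FnvSr// -scalerAr -scaleNr subSn// exprS mulN1r mulrN [shp A _ * _]mulrC.
rewrite e1 e2 /Qn big_ord_recl/= bin0 subn0 [X in _ = _ + X]big_ord_recl/= bin0 subn0.
rewrite addrCA; congr (_ + _).
rewrite [X in X + _]big_ord_recr/= binn subnn addrAC.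
rewrite [LHS]big_ord_recr/= binn subnn; congr (_ + _).
rewrite -big_split/=; apply: eq_bigr => v _.
by rewrite /bump leq0n add1n binS natrD subSS mulrDl scalerDl addrC.
Qed.

Lemma size_Qn (r n : nat) : A \is monic -> B \is monic ->
  size A = r.+2 -> size B = r.+2 -> (size (Qn n) <= (r * n).+1)%N.
Proof.
move=> mA mB sA sB; elim: n => [|n IH].
  rewrite /Qn big_ord1 bin0 subnn mul1r scale1r /Fnv !big_geq// mulr1 muln0.
  by rewrite size_poly1.
rewrite QnS.
set Q1 := Qn n \Po _; set A1 := shp A n.+1.
have sX : size ('X - n.+1%:R%:P : {poly F}) = 2 by rewrite size_XsubC.
have sA1 : size A1 = r.+2 by rewrite /A1 /shp size_comp_poly2.
have mA1 : A1 \is monic.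
  by rewrite monicE /A1 /shp lead_coef_comp ?sX// lead_coefXsubC expr1n mulr1.
have sQ1 : size Q1 = size (Qn n) by rewrite /Q1 size_comp_poly2// size_XsubC.
(* Each bracket loses one degree: [B] and [A1] are monic of equal degree, and a shift of the
   variable preserves the leading coefficient of [Qn n]. *)
have -> : B * Q1 - A1 * Qn n = (B - A1) * Q1 + A1 * (Q1 - Qn n) by ring.
have sd : (size (B - A1)%R <= r.+1)%N.
  apply/leq_sizeP => j; rewrite leq_eqVlt => /orP[/eqP <-|dj]; last first.
    by rewrite coefB !nth_default ?subr0// ?sA1 ?sB.
  have bB : B`_r.+1 = 1 by have := monicP mB; rewrite lead_coefE sB.
  have aA : A1`_r.+1 = 1 by have := monicP mA1; rewrite lead_coefE sA1.
  by rewrite coefB bB aA subrr.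
have sh : (size (Q1 - Qn n)%R <= r * n)%N by exact: size_shift_sub.
apply: (leq_trans (size_polyD _ _)); rewrite geq_max; apply/andP; split.
  by apply: (leq_trans (size_polyMleq _ _)); rewrite sQ1; lia.
by apply: (leq_trans (size_polyMleq _ _)); rewrite sA1; lia.
Qed.

End Lagrange.

(** * Interpolation applied to the inner sums of Delta *)

Section Vanishing.
Variable R : realType.
Local Notation C := (CC R).

Lemma fact_neq0 (k : nat) : (k`!%:R : C) != 0.
Proof. by rewrite pnatr_eq0 -lt0n fact_gt0. Qed.

Definition rp (w : C) (a : int) (c : nat) : C := \prod_(s < c) (w - (a + s%:Z)%:~R).

Lemma rpS w a c : rp w a c.+1 = rp w a c * (w - (a + c%:Z)%:~R).
Proof. by rewrite /rp big_ord_recr. Qed.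

Lemma rp_Gamma w a c : ~ is_integer w ->
  rp w a c = Gamma (w - a%:~R + 1) / Gamma (w - (a + c%:Z)%:~R + 1).
Proof.
move=> wi; elim: c => [|c IH].
  rewrite /rp big_ord0 addr0 divff//; apply: Gamma_neq0; apply: nonint_nonpole.
  have -> : w - a%:~R + 1 = w + (1 - a)%:~R by rewrite intrB; ring.
  exact: nonint_int.
rewrite rpS IH.
have np : nonpole (w - (a + c%:Z)%:~R).
  by apply: nonint_nonpole; have := @nonint_int _ _ (- (a + c%:Z)) wi; rewrite rmorphN.
have -> : w - (a + c.+1%:Z)%:~R + 1 = w - (a + c%:Z)%:~R.
  by rewrite -[c.+1]addn1 PoszD addrA [(_ + 1)%:~R]rmorphD/= opprD addrA subrK.
rewrite (GammaS np); have g0 := Gamma_neq0 np; have w0 := np 0%N; rewrite addr0 in w0.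
move: (Gamma (_ - a%:~R + 1)) (w - (a + c%:Z)%:~R) w0 g0 => g y w0.
by move: (Gamma y) => gy g0; field; rewrite g0 w0.
Qed.

Lemma prod_sub_ne (W u : nat) : (u < W)%N ->
  \prod_(v < W | (v : nat) != u) (u%:R - v%:R) =
    u`!%:R * (-1) ^+ (W - u.+1) * (W - u.+1)`!%:R :> C.
Proof.
move=> uW.
rewrite -(big_mkord (fun v => v != u) (fun v => u%:R - v%:R)).
rewrite (big_cat_nat (n := u))//=; last exact: ltnW.
rewrite [X in _ * X]big_ltn_cond// eqxx/= -mulrA; congr (_ * _).
  rewrite -prod_nat_fact big_nat_rev/= add0n big_mkord.
  apply: eq_big => [v|v _]; first by have := ltn_ord v; lia.
  have vu := ltn_ord v.
  by rewrite natrB// -nat1r; ring.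
rewrite -prod_nat_fact -[(-1) ^+ _](_ : \prod_(i < W - u.+1) -1 = _); last first.
  by rewrite prodr_const card_ord.
rewrite -big_split/= -{1}[u.+1]add0n big_addn big_mkord.
apply: eq_big => [v|v _]; first by lia.
by rewrite natrD -[u.+1%:R]natr1; ring.
Qed.

Lemma prod_falling (u c : nat) :
  \prod_(s < c) (u%:R - s%:R) = (if (u < c)%N then 0 else u`!%:R / (u - c)`!%:R) :> C.
Proof.
case: ltnP => uc.
  by rewrite (bigD1 (Ordinal uc))//= subrr mul0r.
elim: c uc => [|c IH] uc; first by rewrite big_ord0 subn0 divff// fact_neq0.
rewrite big_ord_recr/= IH ?(ltnW uc)//.
have -> : (u - c = (u - c.+1).+1)%N by lia.
rewrite factS natrM -natrB ?(ltnW uc)//.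
have -> : (u - c = (u - c.+1).+1)%N by lia.
have f0 := fact_neq0 (u - c.+1); have p0 : ((u - c.+1).+1%:R : C) != 0 by rewrite pnatr_eq0.
by move: (_.+1%:R : C) p0 => d d0; field; rewrite f0 d0.
Qed.

Lemma prod_rising (k t : nat) : \prod_(s < t) (k.+1%:R + s%:R) = (k + t)`!%:R / k`!%:R :> C.
Proof.
elim: t => [|t IH]; first by rewrite big_ord0 addn0 divff// fact_neq0.
rewrite big_ord_recr/= IH addnS factS natrM -natrD addSn; ring.
Qed.

Variables (r : nat) (al be : nat -> C) (n m : nat -> int).

(* The k-th term of the i-th series in the l-th inner sum of Delta_raw, in a form
   that is an evaluation of N_l / D' at alpha_i + l - k (see csum_vanish). *)
Definition Tform (i : nat) (l : int) (k : nat) : C :=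
  \prod_(j < r) (Gamma (1 - be j + al i - k%:R + (m j + l)%:~R)
                 / Gamma (1 - be j + al i - k%:R))
  * \prod_(j < r | (j : nat) != i)
      (Gamma (al i - al j - k%:R) / Gamma (al i - al j - k%:R + (n j + l + 1)%:~R))
  * ((-1) ^+ k / (k`!%:R * (absz (n i + l) - k)`!%:R)).

Definition Tsum (i : nat) (l : int) : C :=
  if n i + l is Posz N then \sum_(k < N.+1) Tform i l k else 0.

Definition csum (l : int) : C := \sum_(i < r) Tsum i l.

Hypothesis al_nonint : forall i j : nat, (i < r)%N -> (j < r)%N -> i != j ->
  ~ is_integer (al i - al j).
Hypothesis be_nonint : forall i j : nat, (i < r)%N -> (j < r)%N -> ~ is_integer (be j - al i).

(* The left-hand side is sum_x P(x) / prod_(y != x) (x - y) over the points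
   x = alpha_i + u - L, 0 <= u < W, where P = NN is a product of linear factors
   times Q_E; the degree hypothesis makes this sum vanish by lagrange_sum0. *)
Lemma csum_vanish (J : int) (E : nat) : (0 < r)%N ->
  \sum_(j < r) m j - \sum_(i < r) n i - r%:Z + 1 < E%:Z ->
  (forall j : nat, (j < r)%N -> 0 <= m j + (J - E%:Z)) ->
  \sum_(t < E.+1) 'C(E, t)%:R * (-1) ^+ t * csum (J - t%:Z) = 0.
Proof.
move=> r0 degE mJ.
(* All exponents occurring lie between - L and J; the [W = J + L + 1] nodes attached to each [al i]
   enumerate them. *)
have [L LP] : exists L : nat, 0 <= J + L%:Z + 1 /\ forall i : nat, (i < r)%N -> n i <= L%:Z.
  exists (absz J + \sum_(i < r) absz (n i))%N; split; first by lia.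
  move=> i ir; have : (absz (n i) <= \sum_(i < r) absz (n i))%N.
    by rewrite (bigD1 (Ordinal ir))//= leq_addr.
  lia.
case: LP => LJ Ln.
have [W WE] : exists W : nat, W%:Z = J + L%:Z + 1 by exists (absz (J + L%:Z + 1)%R); lia.
pose l0 := J - E%:Z.
pose cm j := absz (m j + l0).
have cmE j : (j < r)%N -> (cm j)%:Z = m j + l0 by move=> /mJ h; rewrite /cm /l0; lia.
pose cn i := absz (L%:Z - n i).
have cnE i : (i < r)%N -> (cn i)%:Z = L%:Z - n i by move=> /Ln h; rewrite /cn; lia.
pose rpp (b : C) (a : int) (c : nat) : {poly C} := \prod_(s < c) ('X - (b + (a + s%:Z)%:~R)%:P).
have rppE b a c x : (rpp b a c).[x] = rp (x - b) a c.
  by rewrite horner_prod; apply: eq_bigr => s _; rewrite hornerXsubC opprD addrA.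
have srpp b a c : size (rpp b a c) = c.+1.
  by rewrite /rpp size_prod_XsubC /index_enum -enumT size_enum_ord.
(* The numerator shared by all t: for each beta_j the levels from - m_j up to J - E - 1, and for
   each alpha_i the levels from - L to - n_i - 1, where the i-th series has not yet begun. *)
pose Com := (\prod_(j < r) rpp (be j) (- m j) (cm j)) * (\prod_(i < r) rpp (al i) (- L%:Z) (cn i)).
pose A : {poly C} := \prod_(i < r) ('X - (al i + l0%:~R)%:P).
pose B : {poly C} := \prod_(j < r) ('X - (be j + l0%:~R)%:P).
have mA : A \is monic by apply: monic_prod => i _; exact: monicXsubC.
have mB : B \is monic by apply: monic_prod => i _; exact: monicXsubC.
have [r' rE] : exists r', r = r'.+1 by exists r.-1; rewrite prednK.
have sA : size A = r'.+2 by rewrite /A size_prod_XsubC /index_enum -enumT size_enum_ord rE.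
have sB : size B = r'.+2 by rewrite /B size_prod_XsubC /index_enum -enumT size_enum_ord rE.
pose NN := Com * Qn A B E.
pose x (p : 'I_r * 'I_W) : C := al p.1 + (p.2%:Z - L%:Z)%:~R.
have xinj : injective x.
  move=> [i u] [i' u']; rewrite /x/= => e.
  have [ii|ii] := eqVneq (i : nat) i'.
    have ii' : i = i' by exact: val_inj.
    move: e; rewrite ii' => /addrI/eqP; rewrite eqr_int => /eqP e.
    by congr (_, _); apply: val_inj => /=; lia.
  exfalso; apply: (al_nonint (ltn_ord i) (ltn_ord i') ii).
  exists (u'%:Z - u%:Z); apply/eqP; rewrite subr_eq addrC; apply/eqP.
  apply: (addIr ((u%:Z - L%:Z)%:~R)); rewrite e -addrA -rmorphD/=.
  by congr (_ + _%:~R); lia.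
have size_prod_le (I : finType) (f : I -> {poly C}) (d : I -> nat) :
    (forall i, size (f i) <= (d i).+1)%N -> (size (\prod_i f i)%R <= (\sum_i d i).+1)%N.
  move=> fd; elim/big_rec2: _ => [|i y1 y2 _ h]; first by rewrite size_poly1.
  by apply: (leq_trans (size_polyMleq _ _)); have := fd i; lia.
have card : #|{: 'I_r * 'I_W}| = (r * W)%N by rewrite card_prod !card_ord.
(* The degree is sum m - sum n + r J + r L - E. It is smaller than r W - 1 precisely by the
   hypothesis [degE]; the saving of E comes from [size_Qn]. *)
have sNN : (size NN < #|{: 'I_r * 'I_W}|)%N.
  rewrite card /NN; apply: (leq_ltn_trans (size_polyMleq _ _)).
  have h1 : (size Com <= (\sum_(j < r) cm j + \sum_(i < r) cn i).+1)%N.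
    have a1 : (size (\prod_(j < r) rpp (be j) (- m j) (cm j))%R <= (\sum_(j < r) cm j).+1)%N.
      by apply: size_prod_le => i; rewrite srpp.
    have a2 : (size (\prod_(j < r) rpp (al j) (- L%:Z) (cn j))%R <= (\sum_(j < r) cn j).+1)%N.
      by apply: size_prod_le => i; rewrite srpp.
    by apply: (leq_trans (size_polyMleq _ _)); lia.
  have h2 := @size_Qn _ A B r' E mA mB sA sB.
  have e1 : (\sum_(j < r) cm j)%N%:Z = \sum_(j < r) m j + r%:Z * l0.
    rewrite (big_morph Posz PoszD (erefl _)) (eq_bigr (fun j : 'I_r => m j + l0)).
      by rewrite big_split/= sumr_const card_ord -mulr_natl natz.
    by move=> j _; rewrite cmE.
  have e2 : (\sum_(j < r) cn j)%N%:Z = r%:Z * L%:Z - \sum_(j < r) n j.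
    rewrite (big_morph Posz PoszD (erefl _)) (eq_bigr (fun j : 'I_r => L%:Z - n j)).
      by rewrite sumrB sumr_const card_ord -mulr_natl natz.
    by move=> j _; rewrite cnE.
  have e3 : (r * W)%N%:Z = r%:Z * (J + L%:Z + 1) by rewrite PoszM WE.
  have e4 : (r' * E)%N%:Z = r%:Z * E%:Z - E%:Z by rewrite PoszM rE -addn1 PoszD mulrDl mul1r addrK.
  have e5 : r%:Z * l0 = r%:Z * J - r%:Z * E%:Z by rewrite /l0 mulrBr.
  have e6 : r%:Z * (J + L%:Z + 1) = r%:Z * J + r%:Z * L%:Z + r%:Z by rewrite !mulrDr mulr1.
  move: h1 h2 e1 e2 e3 e4 degE; rewrite e5 e6.
  move: (\sum_(j < r) cm j)%N (\sum_(j < r) cn j)%N (r' * E)%N (r * W)%N (size Com) (size (Qn _ _ _)).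
  move: (\sum_(j < r) m j) (\sum_(j < r) n j) (r%:Z * J) (r%:Z * E%:Z) (r%:Z * L%:Z).
  lia.
have xw (i u j : nat) : (i < r)%N -> (j < r)%N -> i != j ->
    ~ is_integer (al i + (u%:Z - L%:Z)%:~R - al j).
  move=> ir jr ij; have := @nonint_int _ _ (u%:Z - L%:Z) (al_nonint ir jr ij).
  by rewrite addrAC.
have xb (i u j : nat) : (i < r)%N -> (j < r)%N -> ~ is_integer (al i + (u%:Z - L%:Z)%:~R - be j).
  move=> ir jr; have := nonint_opp (@nonint_int _ _ (- (u%:Z - L%:Z)) (be_nonint ir jr)).
  have -> // : - (be j - al i + (- (u%:Z - L%:Z))%:~R) = al i + (u%:Z - L%:Z)%:~R - be j.
  by rewrite [(- _)%:~R]rmorphN/=; ring.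
have nzG w (a : int) : ~ is_integer w -> Gamma (w - a%:~R + 1) != 0 :> C.
  move=> wi; apply: Gamma_neq0; apply: nonint_nonpole.
  have -> : w - a%:~R + 1 = w + (1 - a)%:~R by rewrite intrB; ring.
  exact: nonint_int.
have FnvE x0 (t : nat) : (t <= E)%N -> (Fnv A B E (E - t)).[x0] =
    \prod_(j < r) rp (x0 - be j) l0 (E - t) * \prod_(i < r) rp (x0 - al i) (J - t%:Z + 1) t.
  move=> tE; rewrite /Fnv hornerM !horner_prod; congr (_ * _).
    rewrite big_mkord /rp exchange_big/=; apply: eq_bigr => c _.
    rewrite /shp horner_comp hornerXsubC horner_prod; apply: eq_bigr => j _.
    by rewrite hornerXsubC intrD -pmulrn; ring.
  rewrite -{1}[(E - t)%N]add0n big_addn subKn// big_mkord /rp exchange_big/=.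
  apply: eq_bigr => c _.
  rewrite /shp horner_comp hornerXsubC horner_prod; apply: eq_bigr => j _.
  rewrite hornerXsubC.
  have -> : J - t%:Z + 1 + c%:Z = (c + (E - t)).+1%:Z + l0 by rewrite /l0; lia.
  by rewrite intrD -pmulrn; ring.
(* The factors belonging to the node's own [al i]. They vanish unless the exponent u - L lies
   between - n_i and J - t, that is, unless it belongs to the terminating series; otherwise they
   give its sign and factorials. *)
have self (i u t : nat) : (i < r)%N -> (u < W)%N -> (t <= E)%N ->
    rp (u%:Z - L%:Z)%:~R (- L%:Z) (cn i) * rp (u%:Z - L%:Z)%:~R (J - t%:Z + 1) t
    / \prod_(v < W | (v : nat) != u) (u%:R - v%:R) =
    if (- n i <= u%:Z - L%:Z) && (u%:Z - L%:Z <= J - t%:Z) then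
      (-1) ^+ (absz (J - t%:Z - (u%:Z - L%:Z))%R) /
      ((absz (J - t%:Z - (u%:Z - L%:Z))%R)`!%:R *
       (absz (n i + (J - t%:Z))%R - absz (J - t%:Z - (u%:Z - L%:Z))%R)`!%:R) else 0 :> C.
  move=> ir uW tE; have cni := cnE i ir.
  have -> : rp (u%:Z - L%:Z)%:~R (- L%:Z) (cn i) = \prod_(s < cn i) (u%:R - s%:R) :> C.
    apply: eq_bigr => s _; rewrite -rmorphB/=.
    have -> : u%:Z - L%:Z - (- L%:Z + s%:Z) = u%:Z - s%:Z by lia.
    by rewrite intrB -!pmulrn.
  rewrite prod_falling; have [ucn|ucn] := ltnP u (cn i).
    by rewrite !mul0r; case: ifP => // /andP[]; lia.
  have [ul|ul] := leP (u%:Z - L%:Z) (J - t%:Z); last first.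
    rewrite andbF; suff -> : rp (u%:Z - L%:Z)%:~R (J - t%:Z + 1) t = 0 :> C by rewrite mulr0 mul0r.
    have sE : exists s : nat, (s < t)%N /\ u%:Z - L%:Z = J - t%:Z + 1 + s%:Z.
      by exists (absz (u%:Z - L%:Z - (J - t%:Z + 1))%R); lia.
    case: sE => s [st se]; rewrite /rp (bigD1 (Ordinal st))//= se subrr mul0r //.
  have -> : (- n i <= u%:Z - L%:Z) by lia.
  have [k kE] : exists k : nat, J - t%:Z - (u%:Z - L%:Z) = k%:Z.
    by exists (absz (J - t%:Z - (u%:Z - L%:Z))%R); lia.
  rewrite kE absz_nat /=.
  have -> : (absz (n i + (J - t%:Z))%R - k = u - cn i)%N by lia.
  have -> : rp (u%:Z - L%:Z)%:~R (J - t%:Z + 1) t = (-1) ^+ t * ((k + t)`!%:R / k`!%:R) :> C.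
    rewrite -prod_rising -[(-1) ^+ _](_ : \prod_(i < t) -1 = _); last first.
      by rewrite prodr_const card_ord.
    rewrite -big_split/=; apply: eq_bigr => s _; rewrite -rmorphB/=.
    have -> : u%:Z - L%:Z - (J - t%:Z + 1 + s%:Z) = - (k.+1 + s)%N%:Z by lia.
    by rewrite rmorphN/= -pmulrn natrD mulN1r.
  rewrite prod_sub_ne//; have -> : (W - u.+1 = k + t)%N by lia.
  rewrite exprD.
  have := fact_neq0 (k + t); have := fact_neq0 u; have := fact_neq0 k.
  have := fact_neq0 (u - cn i).
  have : ((-1) ^+ t : C) != 0 by rewrite expf_neq0// oppr_eq0 oner_eq0.
  have : ((-1) ^+ k : C) != 0 by rewrite expf_neq0// oppr_eq0 oner_eq0.
  have : ((-1) ^+ k : C) * (-1) ^+ k = 1 by rewrite -expr2 sqrr_sign.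
  move: ((-1) ^+ k : C) ((-1) ^+ t : C) ((k + t)`!%:R : C) (u`!%:R : C) (k`!%:R : C) ((u - cn i)`!%:R : C).
  move=> a b f1 f2 f3 f4 aa a0 b0 f40 f30 f20 f10.
  have -> : a / (f3 * f4) = a * a / (a * (f3 * f4)) by field; rewrite a0 f30 f40.
  by rewrite aa; field; rewrite a0 b0 f10 f20 f30 f40.
(* The remaining factors become quotients of Gamma values by [rp_Gamma], so a Lagrange summand is a
   term of [Tform] with k = J - t - (u - L). *)
have key (i : 'I_r) (u : 'I_W) (t : nat) : (t <= E)%N ->
    (Com * Fnv A B E (E - t)).[x (i, u)] / \prod_(p | p != (i, u)) (x (i, u) - x p) =
    if (- n i <= u%:Z - L%:Z) && (u%:Z - L%:Z <= J - t%:Z) then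
      Tform i (J - t%:Z) (absz (J - t%:Z - (u%:Z - L%:Z))%R) else 0.
  move=> tE; set X := x (i, u).
  have XE : X = al i + (u%:Z - L%:Z)%:~R by [].
  have -> : \prod_(p | p != (i, u)) (X - x p) =
     \prod_(v < W | (v : nat) != u) (u%:R - v%:R) *
     \prod_(j < r | (j : nat) != i) rp (X - al j) (- L%:Z) W.
    rewrite -(pair_big_dep xpredT (fun j v => (j, v) != (i, u)) (fun j v => X - x (j, v)))/=.
    rewrite (bigD1 i)//=; congr (_ * _).
      apply: eq_big => [v|v _]; first by rewrite xpair_eqE eqxx.
      rewrite XE /x/= !rmorphB/= -!pmulrn; ring.
    apply: eq_big => [j //|j ji]; apply: eq_big => [v|v _].
      by rewrite xpair_eqE (negbTE ji).
    by rewrite /x/= rmorphB rmorphD rmorphN/= -!pmulrn; ring.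
  rewrite hornerM /Com hornerM FnvE// !horner_prod.
  rewrite (eq_bigr (fun j : 'I_r => rp (X - be j) (- m j) (cm j))); last by move=> j _; rewrite rppE.
  rewrite [X in _ * X * _](eq_bigr (fun j : 'I_r => rp (X - al j) (- L%:Z) (cn j))); last first.
    by move=> j _; rewrite rppE.
  rewrite [\prod_(j < r) rp (X - al j) _ _](bigD1 i)//= [\prod_(j < r) rp (X - al j) _ t](bigD1 i)//=.
  have -> : X - al i = (u%:Z - L%:Z)%:~R by rewrite XE addrAC subrr add0r.
  have sf := @self i u t (ltn_ord i) (ltn_ord u) tE.
  set a1 := rp _ (- L%:Z) (cn i) in sf *; set a2 := rp _ _ t in sf *.
  set a3 := \prod_(v < W | _) _ in sf *.
  set b1 := \prod_(j < r) rp (X - be j) _ _; set b2 := \prod_(j < r) rp (X - be j) _ _.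
  set c1 := \prod_(j < r | j != i) rp _ _ _; set c2 := \prod_(j < r | j != i) rp _ _ _.
  set c3 := \prod_(j < r | _) rp _ _ _.
  have -> : b1 * (a1 * c1) * (b2 * (a2 * c2)) / (a3 * c3) = (b1 * b2) * (c1 * c2 / c3) * (a1 * a2 / a3).
    by rewrite invfM; ring.
  rewrite sf; case: ifP => [/andP[q1 q2]|_]; last by rewrite mulr0.
  have [k kE] : exists k : nat, J - t%:Z - (u%:Z - L%:Z) = k%:Z.
    by exists (absz (J - t%:Z - (u%:Z - L%:Z))%R); lia.
  rewrite kE absz_nat /Tform.
  have XE' : X = al i - k%:R + (J - t%:Z)%:~R.
    have ul : u%:Z - L%:Z = J - t%:Z - k%:Z by lia.
    by rewrite XE ul (intrB _ (J - t%:Z)) -pmulrn; ring.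
  congr (_ * _ * _).
    rewrite /b1 /b2 -big_split/=; apply: eq_bigr => j _.
    have wi := @xb i u j (ltn_ord i) (ltn_ord j); rewrite -XE in wi.
    rewrite !rp_Gamma//.
    have -> : - m j + (cm j)%:Z = l0 by rewrite cmE//; lia.
    have -> : l0 + (E - t)%N%:Z = J - t%:Z by rewrite /l0; lia.
    have g0 := nzG _ l0 wi.
    rewrite mulrA divfK//; congr (Gamma _ / Gamma _).
      by rewrite XE' rmorphN/= rmorphD/=; ring.
    by rewrite XE'; ring.
  rewrite /c1 /c2 /c3 -big_split/= -prodf_div; apply: eq_bigr => j ji.
  have ij : (i : nat) != j by rewrite eq_sym.
  have wi := @xw i u j (ltn_ord i) (ltn_ord j) ij; rewrite -XE in wi.
  rewrite !rp_Gamma//.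
  have -> : - L%:Z + (cn j)%:Z = - n j by rewrite cnE//; lia.
  have -> : - L%:Z + W%:Z = J + 1 by lia.
  have -> : J - t%:Z + 1 + t%:Z = J + 1 by lia.
  have g1 := nzG _ (- L%:Z) wi; have g2 := nzG _ (J + 1) wi; have g3 := nzG _ (- n j) wi.
  have -> : Gamma (al i - al j - k%:R) = Gamma (X - al j - (J - t%:Z + 1)%:~R + 1).
    by congr Gamma; rewrite XE' [(_ + 1)%:~R]rmorphD/=; ring.
  have -> : Gamma (al i - al j - k%:R + (n j + (J - t%:Z) + 1)%:~R) = Gamma (X - al j - (- n j)%:~R + 1).
    by congr Gamma; rewrite XE' ![(_ + _)%:~R]rmorphD rmorphN/=; ring.
  move: (Gamma _) (Gamma _) (Gamma _) (Gamma _) g1 g2 g3 => ga gb gc gd g1 g2 g3.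
  by field; rewrite ?g1 ?g2 ?g3.
(* Nodes increase with u while k decreases, hence the reversal of the range after cutting off the
   zero terms at both ends. *)
have TsumE (i : 'I_r) (t : nat) : (t <= E)%N -> \sum_(u < W)
    (if (- n i <= u%:Z - L%:Z) && (u%:Z - L%:Z <= J - t%:Z) then
      Tform i (J - t%:Z) (absz (J - t%:Z - (u%:Z - L%:Z))%R) else 0) = Tsum i (J - t%:Z).
  move=> tE; rewrite /Tsum; case NE : (n i + (J - t%:Z)) => [N|N]; last first.
    by apply: big1 => u _; case: ifP => // /andP[]; lia.
  have nL := Ln i (ltn_ord i).
  have [Z ZE] : exists Z : nat, J - t%:Z + L%:Z = Z%:Z by exists (absz (J - t%:Z + L%:Z)%R); lia.
  pose G (u : nat) := (if (- n i <= u%:Z - L%:Z) && (u%:Z - L%:Z <= J - t%:Z) then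
      Tform i (J - t%:Z) (absz (J - t%:Z - (u%:Z - L%:Z))%R) else 0).
  rewrite -(big_mkord xpredT G) (big_cat_nat (n := (Z - N)%N))//=; last by lia.
  rewrite [X in X + _]big1_seq ?add0r; last first.
    by move=> v /andP[_]; rewrite mem_index_iota /G => h; case: ifP => // /andP[]; lia.
  rewrite (big_cat_nat (n := Z.+1))//=; [|lia|lia].
  rewrite [X in _ + X]big1_seq ?addr0; last first.
    by move=> v /andP[_]; rewrite mem_index_iota /G => h; case: ifP => // /andP[]; lia.
  rewrite -{1}[(Z - N)%N]add0n big_addn.
  have -> : (Z.+1 - (Z - N) = N.+1)%N by lia.
  rewrite big_nat_rev/= add0n big_mkord; apply: eq_bigr => k _; have := ltn_ord k => kN.
  rewrite /G; have -> : (- n i <= (N.+1 - k.+1 + (Z - N))%N%:Z - L%:Z) && ((N.+1 - k.+1 + (Z - N))%N%:Z - L%:Z <= J - t%:Z) by lia.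
  by congr Tform; lia.
have := lagrange_sum0 xinj sNN.
have NNE p : NN.[x p] / \prod_(j | j != p) (x p - x j) =
    \sum_(t < E.+1) 'C(E, t)%:R * (-1) ^+ t *
     ((Com * Fnv A B E (E - t)).[x p] / \prod_(j | j != p) (x p - x j)).
  rewrite /NN /Qn (reindex_inj rev_ord_inj)/= hornerM horner_sum mulr_sumr mulr_suml.
  apply: eq_bigr => t _; have tE : (t <= E)%N by rewrite -ltnS.
  by rewrite subSS bin_sub// subKn// hornerZ [in RHS]hornerM; ring.
rewrite (eq_bigr _ (fun p _ => NNE p)) exchange_big/= => e; rewrite -[RHS]e.
apply: eq_bigr => t _; have tE : (t <= E)%N by rewrite -ltnS.
rewrite -mulr_sumr; congr (_ * _); rewrite /csum.
rewrite -(pair_bigA _ (fun i u => (Com * Fnv A B E (E - t)).[x (i, u)] /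
   \prod_(j | j != (i, u)) (x (i, u) - x j)))/=.
apply: eq_bigr => i _; rewrite -TsumE//; apply: eq_bigr => u _.
by rewrite key.
Qed.

End Vanishing.

(** * Pochhammer symbols and the generic Delta *)

Section Poch.
Variable R : realType.
Local Notation C := (CC R).
Implicit Types x y : C.

Lemma nonint_near x : exists2 e : R, 0 < e & forall y, y != x -> nrm (y - x) < e -> ~ is_integer y.
Proof.
have [[k xk]|xi] := pselect (is_integer x); last first.
  have [e e0 he] := nonint_open xi; exists e => // y _ ye.
  by have := he _ ye; rewrite subrK.
exists 1 => // y yx y1 [j yj]; move: yx y1; rewrite xk yj -rmorphB/= => yx.
have jk : j - k != 0 by apply: contraNneq yx => /eqP; rewrite subr_eq0 => /eqP ->.
rewrite -(rmorph_int (real_complex R)) nrmR -intr_norm -[X in _ < X](mulr1z 1) ltr_int.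
by move: jk; lia.
Qed.

Lemma nonint_dnbhs x : \forall y \near x^', ~ is_integer y.
Proof. by have [e e0 h] := nonint_near x; apply/nbhsC_dP; exists e. Qed.

Lemma nonpos_integer x : is_nonpos_integer x -> is_integer x.
Proof. by move=> [k ->]; exists (- k%:Z); rewrite rmorphN. Qed.

Lemma poch_pole x (k : int) : is_nonpos_integer x ->
  poch x k = lim (Gamma (y + k%:~R) / Gamma y @[y --> x^']).
Proof. by move=> xp; rewrite /poch; case: (pselect _) => h; [|case: h]. Qed.

Lemma poch_nonpole x (k : int) : nonpole x -> poch x k = Gamma (x + k%:~R) / Gamma x.
Proof. by move=> /nonpoleP xi; rewrite /poch; case: (pselect _) => h; [case: xi|]. Qed.

Lemma poch_nonint x (k : int) : ~ is_integer x -> poch x k = Gamma (x + k%:~R) / Gamma x.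
Proof. by move=> xi; apply: poch_nonpole; exact: nonint_nonpole. Qed.

(** The Pochhammer symbol of natural index as a polynomial, hence continuous everywhere, poles of
    Gamma included. *)
Definition rise x (k : nat) : C := \prod_(i < k) (x + i%:R).

Lemma cvg_id_dnbhs x : y @[y --> x^'] --> x.
Proof. by apply/cvgC_nearP => e e0; apply/nbhsC_dP; exists e. Qed.

Lemma rise_cont (T : Type) (F : set_system T) {FF : Filter F} (f : T -> C) x (k : nat) :
  f t @[t --> F] --> x -> rise (f t) k @[t --> F] --> rise x k.
Proof.
move=> fx; rewrite /rise; apply: cvg_prodC => i _.
by apply: cvgCD; [exact: fx|exact: cvgC_cst].
Qed.

Lemma rise_Gamma x (k : nat) : nonpole x -> rise x k = Gamma (x + k%:R) / Gamma x.
Proof. by move=> xi; rewrite Gamma_addn// mulfK// Gamma_neq0. Qed.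

Lemma poch_dnbhs x (k : int) : \forall y \near x^', poch y k = Gamma (y + k%:~R) / Gamma y.
Proof. by apply: filterS (nonint_dnbhs x) => y; exact: poch_nonint. Qed.

Lemma Gamma_cont x : nonpole x -> Gamma y @[y --> x^'] --> Gamma x.
Proof. by move=> xi; apply: cvg_shift0; exact: has_deriv_cvg (Gamma_deriv xi). Qed.

Lemma poch_nat x (k : nat) : poch x k%:Z = rise x k.
Proof.
have [xi|xp] := nonpole_cases x; first by rewrite poch_nonpole// rise_Gamma.
rewrite poch_pole//; apply: limC.
apply: (@cvgC_eq _ _ _ _ (fun y => rise y k)); last first.
  by apply: rise_cont; exact: cvg_id_dnbhs.
apply: filterS (nonint_dnbhs x) => y yi; rewrite rise_Gamma//; exact: nonint_nonpole.
Qed.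

Lemma cvg_shift_cst (f : C -> C) x c (l : C) : f y @[y --> (x + c)^'] --> l ->
  f (y + c) @[y --> x^'] --> l.
Proof.
move=> /cvgC_nearP fl; apply/cvgC_nearP => e /fl/nbhsC_dP[d d0 fd].
apply/nbhsC_dP; exists d => // y yx yd; apply: fd.
  by rewrite (inj_eq (addIr c)).
by rewrite opprD addrACA subrr addr0.
Qed.

Lemma cvg_refl_cst (f : C -> C) x c (l : C) : f y @[y --> (c - x)^'] --> l ->
  f (c - y) @[y --> x^'] --> l.
Proof.
move=> /cvgC_nearP fl; apply/cvgC_nearP => e /fl/nbhsC_dP[d d0 fd].
apply/nbhsC_dP; exists d => // y yx yd; apply: fd.
  by rewrite (inj_eq (addrI c)) eqr_opp.
by rewrite opprD opprK addrACA subrr add0r addrC nrmBC.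
Qed.

(** Off the poles finiteness makes [x + k] a non-pole as well, and Gamma is continuous. At a pole
    the quotient of Gammas is a polynomial, or for negative index the reciprocal of one that does
    not vanish there. *)
Lemma poch_cont x (k : int) : poch_finite x k -> poch y k @[y --> x^'] --> poch x k.
Proof.
move=> fin.
have h : Gamma (y + k%:~R) / Gamma y @[y --> x^'] --> poch x k.
  have [xi|xp] := nonpole_cases x.
    have xk : nonpole (x + k%:~R) by apply/nonpoleP => /fin; exact/nonpoleP.
    rewrite poch_nonpole//; apply: cvgC_divf; first exact: Gamma_neq0.
      by apply: cvg_shift_cst; exact: Gamma_cont.
    exact: Gamma_cont.
  suff [l hl] : exists l : C, Gamma (y + k%:~R) / Gamma y @[y --> x^'] --> l.
    have e := poch_pole k xp; rewrite (limC hl) in e; rewrite e; exact: hl.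
  case: k fin => k _.
    exists (rise x k); apply: (@cvgC_eq _ _ _ _ (fun y => rise y k)); last first.
      by apply: rise_cont; exact: cvg_id_dnbhs.
    by apply: filterS (nonint_dnbhs x) => y yi; rewrite rise_Gamma//; exact: nonint_nonpole.
  exists (rise (x + (Negz k)%:~R) k.+1)^-1.
  apply: (@cvgC_eq _ _ _ _ (fun y => (rise (y + (Negz k)%:~R) k.+1)^-1)); last first.
    apply: cvgCV; last first.
      apply: rise_cont; apply: cvgCD; [exact: cvg_id_dnbhs|exact: cvgC_cst].
    case: xp => j ->; apply/prodf_neq0 => i _.
    rewrite NegzE rmorphN/= -!opprD -pmulrn addrC subr_eq0 -natrD eqr_nat.
    by have := ltn_ord i; lia.
  apply: filterS (nonint_dnbhs x) => y yi.
  have yk : nonpole (y + (Negz k)%:~R) by apply: nonint_nonpole; exact: nonint_int.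
  by rewrite rise_Gamma// invfM invrK mulrC NegzE rmorphN/= -pmulrn subrK.
apply: cvgC_eq h; apply: filterS (poch_dnbhs x k) => y -> //.
Qed.

Lemma nonint_poch_finite x (k : int) : ~ is_integer x -> poch_finite x k.
Proof. by move=> xi /nonpos_integer xk; case: (@nonint_int _ x k xi). Qed.

(** Used to turn rising factorials in k into Gamma values whose argument contains - k, the shape
    needed for [Tform]. *)
Lemma rise_refl x (k : nat) : ~ is_integer x ->
  rise x k = (-1) ^+ k * (Gamma (1 - x) / Gamma (1 - x - k%:R)).
Proof.
move=> xi; have xk : ~ is_integer (1 - x - k%:R).
  have := @nonint_opp_int _ _ (1 - k%:Z) xi; rewrite intrB -pmulrn.
  by have -> : 1%:~R - k%:R - x = 1 - x - k%:R by rewrite addrAC.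
have e : Gamma (1 - x) = \prod_(i < k) (1 - x - k%:R + i%:R) * Gamma (1 - x - k%:R).
  by rewrite -Gamma_addn ?subrK//; exact: nonint_nonpole.
rewrite e mulfK; last by apply: Gamma_neq0; exact: nonint_nonpole.
rewrite -[(-1) ^+ k](_ : \prod_(i < k) -1 = _); last by rewrite prodr_const card_ord.
rewrite /rise (reindex_inj rev_ord_inj)/= -big_split/=; apply: eq_bigr => i _.
by rewrite natrB ?ltn_ord// -natr1; ring.
Qed.

End Poch.

(** * The inner sums as coefficients of products of two series *)

Section ProductForm.
Variable R : realType.
Local Notation C := (CC R).
Variables (r : nat) (al be : nat -> C) (n m : nat -> int).

(* C_i, F_i and G_i: the terms of V3, and the same products for i = 0, 1. *)
Definition VC (i : nat) : C :=
  \prod_(j < r) poch (1 + al i - be j) (m j - n i)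
  / \prod_(j < r | (j : nat) != i) poch (al i - al j) (n j - n i + 1).

Definition VF (i k : nat) : C :=
  \prod_(j < r) rise (be j - al i) k
  / \prod_(j < r | (j : nat) != i) rise (al j + (1 - al i)) k / k`!%:R.

Definition VG (i k : nat) : C :=
  \prod_(j < r) rise (1 + al i - be j + (m j - n i)%:~R) k
  / \prod_(j < r | (j : nat) != i) rise (1 + al i - al j + (n j - n i)%:~R) k / k`!%:R.

Definition VT (i : nat) (l : int) : C :=
  if n i + l is Posz N then VC i * \sum_(k < N.+1) VF i k * VG i (N - k) else 0.

Definition Draw (i : nat) (l : int) (N k : nat) : C :=
  \prod_(j < r) poch (1 + al i - be j) (m j + l)
  / (\prod_(j < r | (j : nat) != i) poch (al i - al j) (n j + l + 1) * N`!%:R)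
  * (rise (- N%:R) k * \prod_(j < r) rise (be j - al i) k
     * \prod_(j < r | (j : nat) != i) rise (al j - al i + (- n j - l)%:~R) k
     / (\prod_(j < r) rise (be j - al i + (- m j - l)%:~R) k
        * \prod_(j < r | (j : nat) != i) rise (al j + (1 - al i)) k) / k`!%:R).

Variable i : nat.
Hypothesis ir : (i < r)%N.
Hypothesis al_nonint : forall j : nat, (j < r)%N -> j != i -> ~ is_integer (al i - al j).
Hypothesis be_nonint : forall j : nat, (j < r)%N -> ~ is_integer (be j - al i).

Let bn (j : nat) (d : int) : (j < r)%N -> ~ is_integer (1 - be j + al i + d%:~R).
Proof.
move=> jr; have := @nonint_opp_int _ _ (1 + d) (be_nonint jr).
by have -> : (1 + d)%:~R - (be j - al i) = 1 - be j + al i + d%:~R by rewrite intrD; ring.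
Qed.

Let an (j : nat) (d : int) : (j < r)%N -> j != i -> ~ is_integer (al i - al j + d%:~R).
Proof. by move=> jr ji; apply: nonint_int; exact: al_nonint. Qed.

Let bnG (j : nat) (d : int) : (j < r)%N -> Gamma (1 - be j + al i + d%:~R) != 0 :> C.
Proof. by move=> jr; apply: Gamma_neq0; apply: nonint_nonpole; exact: bn. Qed.

Let anG (j : nat) (d : int) : (j < r)%N -> j != i -> Gamma (al i - al j + d%:~R) != 0 :> C.
Proof. by move=> jr ji; apply: Gamma_neq0; apply: nonint_nonpole; exact: an. Qed.

(** The identity holds factor by factor in j. Reflecting the rises produces signs that cancel in
    every quotient; the sign in [Tform] comes from [rise (- N) k]. *)
Lemma Draw_Tform (l : int) (N k : nat) : n i + l = N%:Z -> (k <= N)%N ->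
  Draw i l N k = Tform r al be n m i l k.
Proof.
move=> NE kN; rewrite /Draw /Tform NE absz_nat.
have -> : rise (- N%:R) k = (-1) ^+ k * (N`!%:R / (N - k)`!%:R) :> C.
  have -> : N`!%:R / (N - k)`!%:R = \prod_(s < k) (N%:R - s%:R) :> C.
    by rewrite prod_falling ltnNge kN.
  rewrite -[(-1) ^+ k](_ : \prod_(i < k) -1 = _); last by rewrite prodr_const card_ord.
  by rewrite /rise -big_split/=; apply: eq_bigr => s _; ring.
set a1 := \prod_(j < r) _; set a2 := \prod_(j < r | _) poch _ _.
set a3 := \prod_(j < r) rise (be j - al i) k; set a4 := \prod_(j < r | _) rise (al j - al i + _) k.
set a5 := \prod_(j < r) rise _ _; set a6 := \prod_(j < r | _) rise (al j + _) _.
have f1 := fact_neq0 R N; have f2 := fact_neq0 R k; have f3 := fact_neq0 R (N - k).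
have -> : a1 / (a2 * N`!%:R) * ((-1) ^+ k * (N`!%:R / (N - k)`!%:R) * a3 * a4 / (a5 * a6) / k`!%:R)
   = (a1 * (a3 / a5)) * (a4 / a6 / a2) * ((-1) ^+ k / (k`!%:R * (N - k)`!%:R)).
  rewrite !invfM; move: (a5^-1) (a6^-1) (a2^-1) => b5 b6 b2; field.
  by rewrite f1 f2 f3.
congr (_ * _ * _).
  rewrite /a1 /a3 /a5 -prodf_div -big_split/=; apply: eq_bigr => j _.
  have jr := ltn_ord j.
  have b0 : ~ is_integer (1 + al i - be j).
    have := @bn j 0 jr; rewrite addr0.
    by have -> : 1 - be j + al i = 1 + al i - be j by ring.
  rewrite poch_nonint// rise_refl; last exact: be_nonint.
  rewrite rise_refl; last by apply: nonint_int; exact: be_nonint.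
  have g1 := @bnG j 0 jr; have g2 := @bnG j (- k%:Z) jr.
  have g3 := @bnG j (m j + l) jr; have g4 := @bnG j (m j + l - k%:Z) jr.
  have -> : 1 + al i - be j + (m j + l)%:~R = 1 - be j + al i + (m j + l)%:~R by ring.
  have -> : 1 + al i - be j = 1 - be j + al i + 0%:~R by rewrite addr0; ring.
  have -> : 1 - (be j - al i) - k%:R = 1 - be j + al i + (- k%:Z)%:~R.
    by rewrite rmorphN/= -pmulrn; ring.
  have -> : 1 - (be j - al i) = 1 - be j + al i + 0%:~R by rewrite addr0; ring.
  have -> : 1 - (be j - al i + (- m j - l)%:~R) - k%:R = 1 - be j + al i + (m j + l - k%:Z)%:~R.
    by rewrite !(intrB, intrD, rmorphN)/= -pmulrn; ring.
  have -> : 1 - (be j - al i + (- m j - l)%:~R) = 1 - be j + al i + (m j + l)%:~R.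
    by rewrite !(intrB, intrD, rmorphN)/=; ring.
  have -> : 1 - be j + al i - k%:R + (m j + l)%:~R = 1 - be j + al i + (m j + l - k%:Z)%:~R.
    by rewrite !(intrB, intrD)/= -pmulrn; ring.
  have -> : 1 - be j + al i - k%:R = 1 - be j + al i + (- k%:Z)%:~R.
    by rewrite rmorphN/= -pmulrn; ring.
  have s0 : ((-1) ^+ k : C) != 0 by rewrite expf_neq0// oppr_eq0 oner_eq0.
  move: ((-1) ^+ k : C) s0 (Gamma (_ + 0%:~R)) g1 (Gamma (_ + (- k%:Z)%:~R)) g2
    (Gamma (_ + (m j + l)%:~R)) g3 (Gamma (_ + (m j + l - _)%:~R)) g4.
  by move=> s s0 h1 g1 h2 g2 h3 g3 h4 g4; field; rewrite s0 g1 g2 g3 g4.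
rewrite /a2 /a4 /a6 -!prodf_div; apply: eq_bigr => j ji.
have jr := ltn_ord j.
rewrite poch_nonint; last by have := @an j 0 jr ji; rewrite addr0.
have ai : ~ is_integer (al j - al i) by rewrite -opprB; apply: nonint_opp; have := @an j 0 jr ji; rewrite addr0.
rewrite rise_refl; last exact: nonint_int.
rewrite rise_refl; last first.
  by have := @nonint_int _ _ 1 ai; have -> : al j - al i + 1%:~R = al j + (1 - al i) by ring.
have g1 := @anG j 0 jr ji; have g2 := @anG j (- k%:Z) jr ji.
have g3 := @anG j (n j + l + 1) jr ji; have g4 := @anG j (n j + l + 1 - k%:Z) jr ji.
have -> : 1 - (al j - al i + (- n j - l)%:~R) - k%:R = al i - al j + (n j + l + 1 - k%:Z)%:~R.
  by rewrite !(intrB, intrD, rmorphN)/= -pmulrn; ring.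
have -> : 1 - (al j - al i + (- n j - l)%:~R) = al i - al j + (n j + l + 1)%:~R.
  by rewrite !(intrB, intrD, rmorphN)/=; ring.
have -> : 1 - (al j + (1 - al i)) - k%:R = al i - al j + (- k%:Z)%:~R.
  by rewrite rmorphN/= -pmulrn; ring.
have -> : 1 - (al j + (1 - al i)) = al i - al j + 0%:~R by rewrite addr0; ring.
have -> : al i - al j - k%:R + (n j + l + 1)%:~R = al i - al j + (n j + l + 1 - k%:Z)%:~R.
  by rewrite !(intrB, intrD)/= -pmulrn; ring.
have -> : al i - al j - k%:R = al i - al j + (- k%:Z)%:~R by rewrite rmorphN/= -pmulrn.
rewrite -[Gamma (al i - al j)](_ : Gamma (al i - al j + 0%:~R) = _); last by rewrite addr0.
have s0 : ((-1) ^+ k : C) != 0 by rewrite expf_neq0// oppr_eq0 oner_eq0.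
move: ((-1) ^+ k : C) s0 (Gamma (_ + 0%:~R)) g1 (Gamma (_ + (- k%:Z)%:~R)) g2
    (Gamma (_ + (n j + l + 1)%:~R)) g3 (Gamma (_ + (n j + l + 1 - _)%:~R)) g4.
by move=> s s0 h1 g1 h2 g2 h3 g3 h4 g4; field; rewrite s0 g1 g2 g3 g4.
Qed.

(** The reflected rises of [VF], the prefactor [VC] and the rises of [VG] of index N - k telescope,
    for each j, into the Gamma quotient of [Tform]. The 2 r - 1 reflections leave the sign
    (-1)^k. *)
Lemma VT_Tsum (l : int) : VT i l = Tsum r al be n m i l.
Proof.
rewrite /VT /Tsum; case NE : (n i + l) => [N|//].
rewrite mulr_sumr; apply: eq_bigr => k _; have kN : (k <= N)%N by rewrite -ltnS.
rewrite /VC /VF /VG /Tform NE absz_nat.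
set a1 := \prod_(j < r) poch _ _; set a2 := \prod_(j < r | _) poch _ _.
set a3 := \prod_(j < r) rise _ k; set a4 := \prod_(j < r | _) rise _ k.
set a5 := \prod_(j < r) rise _ (N - k); set a6 := \prod_(j < r | _) rise _ (N - k).
have s0 : ((-1) ^+ k : C) != 0 by rewrite expf_neq0// oppr_eq0 oner_eq0.
have -> : a1 / a2 * (a3 / a4 / k`!%:R * (a5 / a6 / (N - k)`!%:R)) =
   (a1 * a3 * a5) * (a2^-1 / a4 / a6) / (k`!%:R * (N - k)`!%:R).
  by rewrite invfM; ring.
have -> : a1 * a3 * a5 = ((-1) ^+ k) ^+ r * \prod_(j < r) (Gamma (1 - be j + al i - k%:R + (m j + l)%:~R)
                 / Gamma (1 - be j + al i - k%:R)).
  rewrite -[((-1) ^+ k) ^+ r](_ : \prod_(j < r) (-1) ^+ k = _); last by rewrite prodr_const card_ord.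
  rewrite /a1 /a3 /a5 -!big_split/=; apply: eq_bigr => j _; have jr := ltn_ord j.
  have b0 : ~ is_integer (1 + al i - be j).
    have := @bn j 0 jr; rewrite addr0.
    by have -> : 1 - be j + al i = 1 + al i - be j by ring.
  rewrite poch_nonint// rise_refl; last exact: be_nonint.
  rewrite rise_Gamma; last by apply: nonint_nonpole; exact: nonint_int.
  have g1 := @bnG j 0 jr; have g2 := @bnG j (- k%:Z) jr.
  have g3 := @bnG j (m j - n i) jr.
  have -> : 1 + al i - be j + (m j - n i)%:~R + (N - k)%:R = 1 - be j + al i - k%:R + (m j + l)%:~R.
    have -> : m j + l = m j - n i + N%:Z by rewrite -NE; ring.
    by rewrite natrB// (intrD _ (m j - n i)) -pmulrn; ring.
  have -> : 1 + al i - be j + (m j - n i)%:~R = 1 - be j + al i + (m j - n i)%:~R by ring.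
  have -> : 1 + al i - be j = 1 - be j + al i + 0%:~R by rewrite addr0; ring.
  have -> : 1 - (be j - al i) - k%:R = 1 - be j + al i + (- k%:Z)%:~R.
    by rewrite rmorphN/= -pmulrn; ring.
  have -> : 1 - (be j - al i) = 1 - be j + al i + 0%:~R by rewrite addr0; ring.
  move: (Gamma (_ - k%:R + _)) => h5.
  have -> : 1 - be j + al i - k%:R = 1 - be j + al i + (- k%:Z)%:~R.
    by rewrite rmorphN/= -pmulrn.
  move: ((-1) ^+ k : C) s0 (Gamma (_ + 0%:~R)) g1 (Gamma (_ + (- k%:Z)%:~R)) g2
    (Gamma (_ + (m j - n i)%:~R)) g3.
  by move=> s s0 h1 g1 h2 g2 h3 g3; field; rewrite g1 g2 g3.
have -> : a2^-1 / a4 / a6 = ((-1) ^+ k) ^+ r.-1 * \prod_(j < r | (j : nat) != i)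
      (Gamma (al i - al j - k%:R) / Gamma (al i - al j - k%:R + (n j + l + 1)%:~R)).
  have -> : ((-1) ^+ k) ^+ r.-1 = \prod_(j < r | (j : nat) != i) (-1) ^+ k :> C.
    rewrite prodr_const; congr (_ ^+ _).
    have := cardC1 (Ordinal ir); rewrite card_ord => <-.
    by apply: eq_card => j; rewrite !inE.
  rewrite /a2 /a4 /a6 -!prodfV -!big_split/=; apply: eq_bigr => j ji; have jr := ltn_ord j.
  rewrite poch_nonint; last by have := @an j 0 jr ji; rewrite addr0.
  have ai : ~ is_integer (al j - al i) by rewrite -opprB; apply: nonint_opp; have := @an j 0 jr ji; rewrite addr0.
  rewrite rise_refl; last first.
    by have := @nonint_int _ _ 1 ai; have -> : al j - al i + 1%:~R = al j + (1 - al i) by ring.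
  have e1 : 1 + al i - al j + (n j - n i)%:~R = al i - al j + (n j - n i + 1)%:~R.
    by rewrite (intrD _ (n j - n i)); ring.
  rewrite e1 rise_Gamma; last by apply: nonint_nonpole; exact: an.
  have g1 := @anG j 0 jr ji; have g2 := @anG j (- k%:Z) jr ji.
  have g3 := @anG j (n j - n i + 1) jr ji.
  have -> : al i - al j + (n j - n i + 1)%:~R + (N - k)%:R = al i - al j - k%:R + (n j + l + 1)%:~R.
    have -> : n j + l + 1 = n j - n i + 1 + N%:Z by rewrite -NE; ring.
    by rewrite natrB// (intrD _ (n j - n i + 1)) -pmulrn; ring.
  have -> : 1 - (al j + (1 - al i)) - k%:R = al i - al j + (- k%:Z)%:~R.
    by rewrite rmorphN/= -pmulrn; ring.
  have -> : 1 - (al j + (1 - al i)) = al i - al j + 0%:~R by rewrite addr0; ring.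
  move: (Gamma (_ - k%:R + _)) => h5.
  have -> : al i - al j - k%:R = al i - al j + (- k%:Z)%:~R by rewrite rmorphN/= -pmulrn.
  rewrite -[Gamma (al i - al j)](_ : Gamma (al i - al j + 0%:~R) = _); last by rewrite addr0.
  have ss : ((-1) ^+ k : C) * (-1) ^+ k = 1 by rewrite -expr2 sqrr_sign.
  move: ((-1) ^+ k : C) s0 ss (Gamma (_ + 0%:~R)) g1 (Gamma (_ + (- k%:Z)%:~R)) g2
    (Gamma (_ + (n j - n i + 1)%:~R)) g3 h5.
  move=> s s0 ss h1 g1 h2 g2 h3 g3 h5; rewrite !invfM !invrK.
  have -> : s^-1 = s by apply: (mulfI s0); rewrite ss divff.
  by move: (h5^-1) => h6; field; rewrite g1 g3.
have -> : (-1) ^+ k / (k`!%:R * (N - k)`!%:R) =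
    ((-1) ^+ k) ^+ r * ((-1) ^+ k) ^+ r.-1 / (k`!%:R * (N - k)`!%:R) :> C.
  congr (_ / _).
  rewrite -exprD; have -> : (r + r.-1 = (r.-1).*2.+1)%N by rewrite -addnn; lia.
  by rewrite exprS -mul2n exprM sqrr_sign expr1n mulr1.
by ring.
Qed.

End ProductForm.

(** * From sequences to indexed products and sums *)

Section SeqForms.
Variable R : realType.
Local Notation C := (CC R).

Lemma prod_seq_nth (T : Type) (x0 : T) (s : seq T) (f : T -> C) (r : nat) : size s = r ->
  \prod_(a <- s) f a = \prod_(j < r) f (nth x0 s j).
Proof. by move=> <-; rewrite (big_nth x0) big_mkord. Qed.

Lemma prod_zip_nth (T U : Type) (x0 : T) (y0 : U) (s : seq T) (t : seq U) (f : T * U -> C) (r : nat) :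
  size s = r -> size t = r ->
  \prod_(a <- zip s t) f a = \prod_(j < r) f (nth x0 s j, nth y0 t j).
Proof.
move=> sr tr; have zr : size (zip s t) = r by rewrite size_zip sr tr minnn.
rewrite (prod_seq_nth (x0, y0) _ zr); apply: eq_bigr => j _.
by rewrite nth_zip// sr tr.
Qed.

Lemma rem_at_map (T U : Type) (f : T -> U) (i : nat) (s : seq T) :
  rem_at i (map f s) = map f (rem_at i s).
Proof. by rewrite /rem_at map_cat map_take map_drop. Qed.

Lemma rem_at_zip (T U : Type) (i : nat) (s : seq T) (t : seq U) : size s = size t ->
  zip (rem_at i s) (rem_at i t) = rem_at i (zip s t).
Proof.
move=> st; rewrite /rem_at zip_cat; last by rewrite !size_take st.
by congr (_ ++ _); [rewrite /take|]; elim: i s t st => [|i IH] [|a s] [|b t]//= [st]; rewrite ?drop0 ?IH.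
Qed.

Lemma prod_rem_at (T : Type) (x0 : T) (s : seq T) (i : nat) (f : T -> C) (r : nat) :
  size s = r -> (i < r)%N ->
  \prod_(a <- rem_at i s) f a = \prod_(j < r | (j : nat) != i) f (nth x0 s j).
Proof.
move=> sr ir; rewrite /rem_at big_cat/=.
rewrite -(big_mkord (fun j => j != i) (fun j => f (nth x0 s j))).
rewrite (big_cat_nat (n := i))//=; last exact: ltnW.
rewrite [X in _ = _ * X]big_ltn_cond// eqxx/=; congr (_ * _).
  have ti : size (take i s) = i by rewrite size_take sr ir.
  rewrite (big_nth x0) ti [in LHS]big_nat [in RHS]big_nat_cond.
  apply: eq_big => [j|j /andP[_ ji]]; last by rewrite nth_take.
  by case: ltngtP; rewrite ?andbF ?andbT.
rewrite (big_nth x0) size_drop sr.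
rewrite -[X in _ = \big[_/_]_(X <= _ < _ | _) _]add0n big_addn [in LHS]big_nat [in RHS]big_nat_cond.
apply: eq_big => [j|j _]; last by rewrite nth_drop addnC.
by case: (altP eqP) => [ji|_]; rewrite ?andbT// andbF; lia.
Qed.

Lemma pochv_nth (x : seq C) (k : seq int) (r : nat) : size x = r -> size k = r ->
  pochv x k = \prod_(j < r) poch x`_j k`_j.
Proof. exact: prod_zip_nth. Qed.

Lemma pochv_rem (x : seq C) (k : seq int) (r i : nat) : size x = r -> size k = r -> (i < r)%N ->
  pochv (rem_at i x) (rem_at i k) = \prod_(j < r | (j : nat) != i) poch x`_j k`_j.
Proof.
move=> xr kr ir; rewrite /pochv rem_at_zip ?xr//.
have zr : size (zip x k) = r by rewrite size_zip xr kr minnn.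
rewrite (prod_rem_at (0, 0) _ zr ir); apply: eq_bigr => j _.
by rewrite nth_zip ?xr.
Qed.

Lemma vmax_ge (s : seq int) a : a \in s -> a <= vmax s.
Proof.
rewrite /vmax; move: (head 0 s) => d; elim: s => [//|b s IH].
by rewrite inE big_cons le_max => /orP[/eqP ->|/IH ->]; rewrite ?lexx// orbT.
Qed.

Lemma vmin_le (s : seq int) a : a \in s -> vmin s <= a.
Proof.
rewrite /vmin; move: (head 0 s) => d; elim: s => [//|b s IH].
by rewrite inE big_cons ge_min => /orP[/eqP ->|/IH ->]; rewrite ?lexx// orbT.
Qed.

(** The truncation at [v] only drops terms where [f] vanishes, so the sum may run over the whole
    binomial range. *)
Lemma zrange_sum (f : int -> C) (v j : int) (E : nat) : (forall l, l < v -> f l = 0) ->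
  \sum_(l <- zrange (Num.max v (j - E%:Z)) j) 'C(E, absz (j - l)%R)%:R * (-1) ^+ absz (j - l)%R * f l
  = \sum_(t < E.+1) 'C(E, t)%:R * (-1) ^+ t * f (j - t%:Z).
Proof.
move=> fv; rewrite /zrange; set a := Num.max _ _.
have av : v <= a by rewrite /a le_max lexx.
have aE : j - E%:Z <= a by rewrite /a le_max lexx orbT.
have aor : a = v \/ a = j - E%:Z by rewrite /a maxEle; case: ifP; [right|left].
case: ifP => aj; last first.
  rewrite big_nil big1// => t _; rewrite fv ?mulr0//; lia.
pose D := absz (j - a)%R.
have DE : (D <= E)%N by rewrite /D; lia.
rewrite big_map -[iota 0 _]/(index_iota 0 D.+1) big_mkord (reindex_inj rev_ord_inj)/=.
rewrite -(big_mkord xpredT (fun t => 'C(E, t)%:R * (-1) ^+ t * f (j - t%:Z))).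
rewrite (big_cat_nat (n := D.+1))//= [X in _ + X]big1_seq ?addr0; last first.
  move=> t /andP[_]; rewrite mem_index_iota => tE; rewrite fv ?mulr0//; lia.
rewrite big_mkord; apply: eq_bigr => t _; have := ltn_ord t => tD.
have -> : a + (D.+1 - t.+1)%N%:Z = j - t%:Z by rewrite /D in tD *; lia.
by have -> : j - (j - t%:Z) = t%:Z by lia.
Qed.

End SeqForms.

Section DeltaRaw.
Variable R : realType.
Local Notation C := (CC R).
Variables (r : nat) (alpha beta : seq C) (n m : seq int).
Hypotheses (sa : size alpha = r) (sb : size beta = r) (sn : size n = r) (sm : size m = r).
Let al j := alpha`_j.
Let be j := beta`_j.
Let nn j := n`_j.
Let mm j := m`_j.

Lemma size_rsubv (c : C) (x : seq C) : size (rsubv c x) = size x.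
Proof. exact: size_map. Qed.

Lemma size_shiftv (x : seq C) (c : C) : size (shiftv x c) = size x.
Proof. exact: size_map. Qed.

Lemma size_addzv (x : seq C) (k : seq int) : size x = size k -> size (addzv x k) = size x.
Proof. by move=> xk; rewrite size_map size_zip xk minnn. Qed.

Lemma nth_rsubv (c : C) (x : seq C) j : (j < size x)%N -> (rsubv c x)`_j = c - x`_j.
Proof. by move=> jx; rewrite (nth_map 0). Qed.

Lemma nth_shiftv (x : seq C) (c : C) j : (j < size x)%N -> (shiftv x c)`_j = x`_j + c.
Proof. by move=> jx; rewrite (nth_map 0). Qed.

Lemma nth_addzv (x : seq C) (k : seq int) j : size x = size k -> (j < size x)%N ->
  (addzv x k)`_j = x`_j + (k`_j)%:~R.
Proof.
move=> xk jx; rewrite (nth_map (0, 0)) ?size_zip ?xk ?minnn -?xk//.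
by rewrite nth_zip.
Qed.

Lemma rem_at_rsubv i (c : C) (x : seq C) : rsubv c (rem_at i x) = rem_at i (rsubv c x).
Proof. by rewrite /rsubv rem_at_map. Qed.

Lemma rem_at_shiftv i (x : seq C) (c : C) : shiftv (rem_at i x) c = rem_at i (shiftv x c).
Proof. by rewrite /shiftv rem_at_map. Qed.

Lemma rem_at_addzv i (x : seq C) (k : seq int) : size x = size k ->
  addzv (rem_at i x) (rem_at i k) = rem_at i (addzv x k).
Proof. by move=> xk; rewrite /addzv rem_at_zip// rem_at_map. Qed.

Lemma hyperF_fin (x y : seq C) (z : C) (N : nat) :
  (forall k, (N < k)%N -> \prod_(a <- x) poch a k%:Z = 0) ->
  hyperF x y z = \sum_(k < N.+1) \prod_(a <- x) poch a k%:Z / \prod_(b <- y) poch b k%:Z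
                    * z ^+ k / k`!%:R.
Proof.
move=> h; apply: gsum_lim.
apply: (@gsum_fin _ (fun k => \prod_(a <- x) poch a k%:Z / \prod_(b <- y) poch b k%:Z
                    * z ^+ k / k`!%:R) N.+1).
by move=> k Nk; rewrite h// !mul0r.
Qed.

Lemma rise_neg0 (N k : nat) : (N < k)%N -> rise (- N%:R) k = 0 :> C.
Proof. by move=> Nk; rewrite /rise (bigD1 (Ordinal Nk))//= addNr mul0r. Qed.

Lemma Delta_summand (l : int) (i N : nat) : (i < r)%N -> l + nn i = N%:Z ->
  pochv (rsubv (1 + al i) beta) [seq mj + l | mj <- m]
        / (pochv (rsubv (al i) (rem_at i alpha)) [seq nj + l + 1 | nj <- rem_at i n]
             * (absz (l + nn i))`!%:R)
      * hyperF
          ((- (l + nn i))%:~R :: shiftv beta (- al i)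
             ++ addzv (shiftv (rem_at i alpha) (- al i)) [seq - nj - l | nj <- rem_at i n])
          (addzv (shiftv beta (- al i)) [seq - mj - l | mj <- m]
             ++ shiftv (rem_at i alpha) (1 - al i))
          1 = \sum_(k < N.+1) Draw r al be nn mm i l N k.
Proof.
move=> ir NE; rewrite NE absz_nat.
have -> : (- N%:Z)%:~R = - N%:R :> C by rewrite rmorphN.
rewrite (pochv_nth (r := r)) ?size_rsubv ?size_map//.
rewrite rem_at_rsubv -rem_at_map (pochv_rem (r := r)) ?size_rsubv ?size_map//.
rewrite (hyperF_fin _ _ (N := N)); last first.
  by move=> k Nk; rewrite big_cons poch_nat rise_neg0// mul0r.
rewrite mulr_sumr; apply: eq_bigr => k _.
rewrite /Draw expr1n mulr1 big_cons !big_cat/= poch_nat.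
have e1 : \prod_(j < r) poch (rsubv (1 + al i) beta)`_j [seq mj + l | mj <- m]`_j =
    \prod_(j < r) poch (1 + al i - be j) (mm j + l).
  by apply: eq_bigr => j _; rewrite nth_rsubv ?sb// (nth_map 0) ?sm.
have e2 : \prod_(j < r | (j : nat) != i) poch (rsubv (al i) alpha)`_j [seq nj + l + 1 | nj <- n]`_j =
    \prod_(j < r | (j : nat) != i) poch (al i - al j) (nn j + l + 1).
  by apply: eq_bigr => j _; rewrite nth_rsubv ?sa// (nth_map 0) ?sn.
have e3 : \prod_(a <- shiftv beta (- al i)) poch a k%:Z = \prod_(j < r) rise (be j - al i) k.
  rewrite (prod_seq_nth 0 _ (r := r)) ?size_shiftv//; apply: eq_bigr => j _.
  by rewrite nth_shiftv ?sb// poch_nat.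
have e4 : \prod_(a <- addzv (shiftv (rem_at i alpha) (- al i)) [seq - nj - l | nj <- rem_at i n]) poch a k%:Z
    = \prod_(j < r | (j : nat) != i) rise (al j - al i + (- nn j - l)%:~R) k.
  rewrite rem_at_shiftv -rem_at_map rem_at_addzv; last by rewrite size_shiftv size_map sa sn.
  have sz : size (shiftv alpha (- al i)) = size [seq - nj - l | nj <- n] by rewrite size_shiftv size_map sa sn.
  have szr : size (addzv (shiftv alpha (- al i)) [seq - nj - l | nj <- n]) = r.
    by rewrite size_addzv// size_shiftv.
  rewrite (prod_rem_at 0 _ szr ir); apply: eq_bigr => j _.
  by rewrite (nth_addzv sz) ?size_shiftv ?sa// nth_shiftv ?sa// (nth_map 0) ?sn// poch_nat.
have e5 : \prod_(a <- addzv (shiftv beta (- al i)) [seq - mj - l | mj <- m]) poch a k%:Z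
    = \prod_(j < r) rise (be j - al i + (- mm j - l)%:~R) k.
  have sz : size (shiftv beta (- al i)) = size [seq - nj - l | nj <- m] by rewrite size_shiftv size_map sb sm.
  have szr : size (addzv (shiftv beta (- al i)) [seq - mj - l | mj <- m]) = r.
    by rewrite size_addzv// size_shiftv.
  rewrite (prod_seq_nth 0 _ szr); apply: eq_bigr => j _.
  by rewrite (nth_addzv sz) ?size_shiftv ?sb// nth_shiftv ?sb// (nth_map 0) ?sm// poch_nat.
have e6 : \prod_(a <- shiftv (rem_at i alpha) (1 - al i)) poch a k%:Z
    = \prod_(j < r | (j : nat) != i) rise (al j + (1 - al i)) k.
  rewrite rem_at_shiftv (prod_rem_at 0 _ (r := r)) ?size_shiftv//; apply: eq_bigr => j _.
  by rewrite nth_shiftv ?sa// poch_nat.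
by rewrite e1 e2 e3 e4 e5 e6 !mulrA.
Qed.

Lemma Delta_raw_csum (j : int) (E : nat) : e_of n m + 1 = E%:Z ->
  (forall i j : nat, (i < r)%N -> (j < r)%N -> i != j -> ~ is_integer (al i - al j)) ->
  (forall i j : nat, (i < r)%N -> (j < r)%N -> ~ is_integer (be j - al i)) ->
  Delta_raw alpha beta n m j =
    \sum_(t < E.+1) 'C(E, t)%:R * (-1) ^+ t * csum r al be nn mm (j - t%:Z).
Proof.
move=> EE hal hbe.
rewrite -(@zrange_sum _ (csum r al be nn mm) (- vmax n)); last first.
  move=> l lv; rewrite /csum big1// => i _; rewrite /Tsum.
  case e : (nn i + l) => [N|//].
  have : nn i <= vmax n by apply: vmax_ge; rewrite /nn mem_nth// sn.
  lia.
rewrite /Delta_raw EE absz_nat.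
have -> : j - e_of n m - 1 = j - E%:Z by rewrite -EE; ring.
apply: eq_bigr => l _; congr (_ * _).
rewrite sa /csum -(big_mkord xpredT (fun i => Tsum r al be nn mm i l)) big_mkcond/= [in RHS]big_nat [in LHS]big_nat.
apply: eq_bigr => i /andP[_ ir]; rewrite /Tsum [nn i + l]addrC.
change (n`_i) with (nn i); change (alpha`_i) with (al i).
case e : (l + nn i) => [N|//] /=.
have := @Delta_summand l i N ir e; rewrite e absz_nat => ->.
apply: eq_bigr => k _; apply: Draw_Tform => //.
- by move=> q qr qi; apply: hal => //; rewrite eq_sym.
- by move=> q qr; exact: hbe.
- by rewrite addrC.
- by rewrite -ltnS.
Qed.

End DeltaRaw.

(** * The confluent limit *)

Section LogDeriv.
Variable R : realType.
Local Notation C := (CC R).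
Implicit Types (f g : C -> C) (x d : C).

(** Stated as f' = f d instead of f'/f = d, so that logarithmic derivatives add over products even
    where a factor is zero. *)
Definition has_logd f x d := has_deriv f x (f x * d).

Lemma logd_cst (c : C) x : has_logd (fun=> c) x 0.
Proof. by rewrite /has_logd mulr0; exact: has_deriv_cst. Qed.

Lemma logdM f g x d d' : has_logd f x d -> has_logd g x d' ->
  has_logd (fun t => f t * g t) x (d + d').
Proof.
move=> fd gd; rewrite /has_logd.
have -> : f x * g x * (d + d') = f x * d * g x + f x * (g x * d') by ring.
exact: (has_derivM fd gd).
Qed.

Lemma logd_div f g x d d' : g x != 0 -> has_logd f x d -> has_logd g x d' ->
  has_logd (fun t => f t / g t) x (d - d').
Proof.
move=> g0 fd gd; apply: (logdM fd); rewrite /has_logd.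
have -> : (g x)^-1 * - d' = - (g x * d') / g x ^+ 2 by field.
exact: has_derivV.
Qed.

Lemma logd_prod (I : Type) (s : seq I) (P : pred I) (f : I -> C -> C) (d : I -> C) x :
  (forall i, P i -> has_logd (f i) x (d i)) ->
  has_logd (fun t => \prod_(i <- s | P i) f i t) x (\sum_(i <- s | P i) d i).
Proof.
move=> h; elim: s => [|i s IH].
  rewrite big_nil (_ : (fun t => _) = fun=> 1); first exact: logd_cst.
  by apply/funext => t; rewrite big_nil.
rewrite big_cons.
have -> : (fun t => \prod_(j <- i :: s | P j) f j t) =
    (fun t => (if P i then f i t * \prod_(j <- s | P j) f j t else \prod_(j <- s | P j) f j t)).
  by apply/funext => t; rewrite big_cons.
case: ifP => [Pi|_]; last exact: IH.
by apply: logdM; [exact: h|exact: IH].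
Qed.

Lemma logd_Gamma (c : C) : nonpole c -> has_logd (fun t => Gamma (c + t)) 0 (psi c).
Proof.
move=> ci; rewrite /has_logd addr0.
apply: (@has_deriv_ext _ (fun t => Gamma (t + c))) => [t|]; first by rewrite addrC.
apply: has_deriv_shift; rewrite add0r; exact: Gamma_deriv.
Qed.

(* At a negative integer the junk value Gamma = 0 makes rho = 0, as it should. *)
Definition rho x : C := (Gamma (1 + x))^-1.
Definition rhod x : C := - psi_div_Gamma (1 + x).

Lemma rho_derivD (c : C) : has_deriv (fun t => rho (c + t)) 0 (rhod c).
Proof.
rewrite /rhod; apply: (@has_deriv_ext _ (fun t => (Gamma (t + (1 + c)))^-1)) => [t|].
  by rewrite /rho addrC addrA.
by apply: (@has_deriv_shift _ (fun t => (Gamma t)^-1)); rewrite add0r; exact: invGamma_deriv.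
Qed.

Lemma rho_derivB (c : C) : has_deriv (fun t => rho (c - t)) 0 (- rhod c).
Proof.
rewrite /rhod; apply: (@has_deriv_ext _ (fun t => (Gamma (1 + c - t))^-1)) => [t|].
  by rewrite /rho addrA.
apply: (@has_deriv_refl _ (fun t => (Gamma t)^-1)).
by rewrite subr0; exact: invGamma_deriv.
Qed.

Lemma rho_nat (k : nat) : rho k%:R = k`!%:R^-1.
Proof. by rewrite /rho addrC natr1 Gamma_nat. Qed.

Lemma rho_neg (k : int) : k < 0 -> rho k%:~R = 0.
Proof.
move=> k0; rewrite /rho Gamma_pole ?invr0//; exists (absz (k + 1)%R).
have -> : 1 + k%:~R = (1 + k)%:~R :> C by rewrite intrD.
by have -> : 1 + k = - (absz (k + 1)%R)%:Z; [lia|rewrite rmorphN].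
Qed.

End LogDeriv.

Section Confluent.
Variable R : realType.
Local Notation C := (CC R).
Variables (r : nat) (p : int) (A B : nat -> C) (n m : nat -> int).
Hypothesis A_nonint : forall j : nat, (1 < j < r)%N -> ~ is_integer (A j).
Hypothesis B_nonint : forall j : nat, (j < r)%N -> ~ is_integer (B j).

Let s : int := p + n 0%N - n 1%N.

Let AG (j : nat) (k : int) : (1 < j < r)%N -> nonpole (A j + k%:~R).
Proof. by move=> jr; apply: nonint_nonpole; apply: nonint_int; exact: A_nonint. Qed.

Let BG (j : nat) (k : int) : (j < r)%N -> nonpole (B j + k%:~R).
Proof. by move=> jr; apply: nonint_nonpole; apply: nonint_int; exact: B_nonint. Qed.

(** The factors of the two confluent terms that stay regular at d = 0, indexed by the exponents
    [kap] and [q] of the Frobenius solutions X and Y. The term i = 1 contributes it at d, the term i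
    = 0 at 0. *)
Definition gW (kap q : int) (d : C) : C :=
  \prod_(j < r) (Gamma (B j + (m j + q - n 1%N)%:~R + d) / Gamma (B j + (- kap)%:~R + d))
  * \prod_(j < r | (1 < j)%N)
     (Gamma (A j + (- 1 - kap)%:~R + d) / Gamma (A j + (n j + q - n 1%N)%:~R + d)).

Definition gWd (kap q : int) : C :=
  \sum_(j < r) (psi (B j + (m j + q - n 1%N)%:~R) - psi (B j + (- kap)%:~R))
  + \sum_(j < r | (1 < j)%N)
     (psi (A j + (- 1 - kap)%:~R) - psi (A j + (n j + q - n 1%N)%:~R)).

Lemma gW_logd kap q : has_logd (gW kap q) 0 (gWd kap q).
Proof.
apply: logdM; apply: logd_prod => j j1; have jr := ltn_ord j.
  apply: logd_div; first by rewrite addr0; apply: Gamma_neq0; exact: BG.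
    by apply: logd_Gamma; exact: BG.
  by apply: logd_Gamma; exact: BG.
apply: logd_div; first by rewrite addr0; apply: Gamma_neq0; apply: AG; rewrite j1.
  by apply: logd_Gamma; apply: AG; rewrite j1.
by apply: logd_Gamma; apply: AG; rewrite j1.
Qed.

(* pi / sin (pi d) * W d is the sum of the two terms i = 0, 1 with
   k = kap - p and k = kap; W vanishes at d = 0, so the poles cancel. *)
Definition W (kap q : int) (d : C) : C :=
  rho kap%:~R * rho q%:~R * rho ((kap - p)%:~R - d) * rho ((q + s)%:~R + d) * gW kap q d
  - rho (kap - p)%:~R * rho (q + s)%:~R * rho (kap%:~R + d) * rho (q%:~R - d) * gW kap q 0.

(** Up to the sign, this is the q-derivative minus the kap-derivative of the product of the four
    [rho] and [gW], with both indices treated as continuous variables. *)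
Definition Ulim (kap q : int) : C := (-1) ^ p * gW kap q 0 *
  (rho kap%:~R * rho (kap - p)%:~R
     * (rhod q%:~R * rho (q + s)%:~R + rho q%:~R * rhod (q + s)%:~R)
   - (rhod kap%:~R * rho (kap - p)%:~R + rho kap%:~R * rhod (kap - p)%:~R)
     * (rho q%:~R * rho (q + s)%:~R)
   + rho kap%:~R * rho (kap - p)%:~R * rho q%:~R * rho (q + s)%:~R * gWd kap q).

(** Since [W] vanishes at 0, [d^-1 * W d] is its difference quotient. *)
Lemma W_deriv kap q : (-1) ^ p * (d^-1 * W kap q d) @[d --> (0 : C)^'] --> Ulim kap q.
Proof.
have h1 : has_deriv (fun d : C => rho ((kap - p)%:~R - d) * rho ((q + s)%:~R + d) * gW kap q d) 0
    ((- rhod (kap - p)%:~R * rho ((q + s)%:~R + 0) + rho ((kap - p)%:~R - 0) * rhod (q + s)%:~R) * gW kap q 0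
      + (rho ((kap - p)%:~R - 0) * rho ((q + s)%:~R + 0)) * (gW kap q 0 * gWd kap q)).
  apply: has_derivM; last exact: gW_logd.
  by apply: has_derivM; [exact: rho_derivB|exact: rho_derivD].
have h2 : has_deriv (fun d : C => rho (kap%:~R + d) * rho (q%:~R - d)) 0
    (rhod kap%:~R * rho (q%:~R - 0) + rho (kap%:~R + 0) * - rhod q%:~R).
  by apply: has_derivM; [exact: rho_derivD|exact: rho_derivB].
rewrite !subr0 !addr0 in h1 h2.
have h : has_deriv (W kap q) 0
  ((0 * (rho (kap - p)%:~R * rho (q + s)%:~R * gW kap q 0) + rho kap%:~R * rho q%:~R *
  ((- rhod (kap - p)%:~R * rho (q + s)%:~R + rho (kap - p)%:~R * rhod (q + s)%:~R) * gW kap q 0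
      + (rho (kap - p)%:~R * rho (q + s)%:~R) * (gW kap q 0 * gWd kap q)))
  + (0 * (rho kap%:~R * rho q%:~R) + (- (rho (kap - p)%:~R * rho (q + s)%:~R * gW kap q 0)) *
     (rhod kap%:~R * rho q%:~R + rho kap%:~R * - rhod q%:~R))).
  apply: (@has_deriv_ext _ (fun d => (rho kap%:~R * rho q%:~R) *
     (rho ((kap - p)%:~R - d) * rho ((q + s)%:~R + d) * gW kap q d) +
     (- (rho (kap - p)%:~R * rho (q + s)%:~R * gW kap q 0)) * (rho (kap%:~R + d) * rho (q%:~R - d)))).
    by move=> d; rewrite /W; ring.
  apply: has_derivD.
    have := has_derivM (has_deriv_cst (rho kap%:~R * rho q%:~R) 0) h1.
    by rewrite subr0 addr0.
  have := has_derivM (has_deriv_cst (- (rho (kap - p)%:~R * rho (q + s)%:~R * gW kap q 0)) 0) h2.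
  by rewrite subr0 addr0.
rewrite /Ulim -mulrA; apply: cvgCM; first exact: cvgC_cst.
have -> : gW kap q 0 * (rho kap%:~R * rho (kap - p)%:~R
     * (rhod q%:~R * rho (q + s)%:~R + rho q%:~R * rhod (q + s)%:~R)
   - (rhod kap%:~R * rho (kap - p)%:~R + rho kap%:~R * rhod (kap - p)%:~R)
     * (rho q%:~R * rho (q + s)%:~R)
   + rho kap%:~R * rho (kap - p)%:~R * rho q%:~R * rho (q + s)%:~R * gWd kap q)
  = ((0 * (rho (kap - p)%:~R * rho (q + s)%:~R * gW kap q 0) + rho kap%:~R * rho q%:~R *
  ((- rhod (kap - p)%:~R * rho (q + s)%:~R + rho (kap - p)%:~R * rhod (q + s)%:~R) * gW kap q 0
      + (rho (kap - p)%:~R * rho (q + s)%:~R) * (gW kap q 0 * gWd kap q)))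
  + (0 * (rho kap%:~R * rho q%:~R) + (- (rho (kap - p)%:~R * rho (q + s)%:~R * gW kap q 0)) *
     (rhod kap%:~R * rho q%:~R + rho kap%:~R * - rhod q%:~R))).
  move: (rho (kap - p)%:~R) (rho (q + s)%:~R) (rho kap%:~R) (rho q%:~R)
   (rhod (kap - p)%:~R) (rhod (q + s)%:~R) (rhod kap%:~R) (rhod q%:~R) (gW kap q 0) (gWd kap q).
  by move=> x1 x2 x3 x4 y1 y2 y3 y4 g gd; ring.
apply: cvgC_eq h; near=> d; rewrite addr0.
have -> : W kap q 0 = 0.
  by rewrite /W !subr0 !addr0; ring.
by rewrite subr0.
Unshelve. all: by end_near.
Qed.

Lemma Cpi_div_sin_cvg : Cpi R / Csin (Cpi R * d) * d @[d --> (0 : C)^'] --> (1 : C).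
Proof.
have h := @Csin_pi_deriv R 0.
have c0 : Ccos (Cpi R * 0) = 1 :> C.
  by rewrite /Ccos !mulr0 oppr0 Cexp0 -[1 + 1]/2 divff// pnatr_eq0.
rewrite c0 mulr1 in h.
have s0 : Csin (Cpi R * 0) = 0 :> C by rewrite /Csin !mulr0 oppr0 subrr mul0r.
rewrite -(divff (Cpi_neq0 R)).
have h' : Cpi R / (x^-1 * (Csin (Cpi R * (x + 0)) - Csin (Cpi R * 0))) @[x --> (0 : C)^'] --> Cpi R / Cpi R.
  by apply: cvgC_divf; [exact: Cpi_neq0|exact: cvgC_cst|exact: h].
apply: cvgC_eq h'; near=> d; rewrite addr0 s0 subr0 invfM invrK.
by rewrite mulrA mulrAC.
Unshelve. all: by end_near.
Qed.

Lemma U_cvg kap q :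
  (-1) ^ p * (Cpi R / Csin (Cpi R * d) * W kap q d) @[d --> (0 : C)^'] --> Ulim kap q.
Proof.
rewrite -[Ulim kap q]mul1r.
have h : Cpi R / Csin (Cpi R * d) * d * ((-1) ^ p * (d^-1 * W kap q d)) @[d --> (0 : C)^'] --> 1 * Ulim kap q.
  by apply: cvgCM; [exact: Cpi_div_sin_cvg|exact: W_deriv].
apply: cvgC_eq h; apply/nbhsC_dP; exists 1 => // d d0 _.
by move: (W kap q d) => w; move: (_ / _) => t; field.
Qed.

End Confluent.

Section Sign.
Variable R : realType.
Local Notation C := (CC R).

Lemma signzV (k : int) : ((-1) ^ k : C)^-1 = (-1) ^ k.
Proof.
have h (j : nat) : ((-1) ^+ j : C)^-1 = (-1) ^+ j by rewrite -exprVn invrN1.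
case: k => k; first exact: h.
by change (((-1) ^+ k.+1 : C)^-1^-1 = ((-1) ^+ k.+1)^-1); rewrite !h.
Qed.

Lemma signzD (a b : int) : ((-1) ^ (a + b) : C) = (-1) ^ a * (-1) ^ b.
Proof. by rewrite expfzDr// oppr_eq0 oner_eq0. Qed.

Lemma signzN (k : int) : ((-1) ^ (- k) : C) = (-1) ^ k.
Proof. by rewrite -invr_expz signzV. Qed.

Lemma signzM (k : int) : ((-1) ^ k : C) * (-1) ^ k = 1.
Proof. by rewrite -[X in X * _]signzN -signzD addNr. Qed.

End Sign.

Section Conv2.
Variable R : realType.
Local Notation C := (CC R).

(* The sum of U a b over a + b = L with a >= - K and b >= - K'. *)
Definition conv2 (K K' : nat) (U : int -> int -> C) (L : int) : C :=
  if L + K%:Z + K'%:Z is Posz n then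
    \sum_(u < n.+1) U (u%:Z - K%:Z) (L - (u%:Z - K%:Z)) else 0.

Lemma conv_conv2 (K K' : nat) f g L : conv K K' f g L = conv2 K K' (fun a b => f a * g b) L.
Proof. by []. Qed.

Lemma conv2D (K K' : nat) U V L :
  conv2 K K' (fun a b => U a b + V a b) L = conv2 K K' U L + conv2 K K' V L.
Proof. by rewrite /conv2; case: (L + _ + _) => *; rewrite ?addr0 ?big_split. Qed.

Lemma conv2Z (K K' : nat) c U L :
  conv2 K K' (fun a b => c * U a b) L = c * conv2 K K' U L.
Proof. by rewrite /conv2; case: (L + _ + _) => *; rewrite ?mulr0 ?mulr_sumr. Qed.

Lemma conv2_ext (K K' : nat) U V L : (forall a b, U a b = V a b) ->
  conv2 K K' U L = conv2 K K' V L.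
Proof. by move=> h; congr conv2; apply/funext => a; apply/funext => b. Qed.

Lemma conv2_cvg (T : Type) (F : set_system T) {FF : Filter F} (K K' : nat)
    (U : T -> int -> int -> C) V L :
  (forall a b, U t a b @[t --> F] --> V a b) ->
  conv2 K K' (U t) L @[t --> F] --> conv2 K K' V L.
Proof.
move=> h; rewrite /conv2; case: (L + _ + _) => N; last exact: cvgC_cst.
by apply: cvg_sumC => u _; exact: h.
Qed.

(** The value depends only on the support. The two confluent terms begin at different exponents, and
    common bounds [K], [K'] allow them to be added under one sum. *)
Lemma conv2_supp (K K' : nat) (a0 b0 : int) U L :
  (forall a b, a < a0 \/ b < b0 -> U a b = 0) -> - K%:Z <= a0 -> - K'%:Z <= b0 ->
  conv2 K K' U L = if L - a0 - b0 is Posz N then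
    \sum_(k < N.+1) U (a0 + k%:Z) (L - (a0 + k%:Z)) else 0.
Proof.
move=> h Ka Kb; rewrite /conv2; case e : (L - a0 - b0) => [N|N]; last first.
  case: (L + _ + _) => u //; rewrite big1// => v _; apply: h; lia.
case e' : (L + K%:Z + K'%:Z) => [u|u]; last by lia.
pose D := absz (a0 + K%:Z)%R.
rewrite -(big_mkord xpredT (fun v => U (v%:Z - K%:Z) (L - (v%:Z - K%:Z)))).
rewrite (big_cat_nat (n := D))//=; last by rewrite /D; lia.
rewrite [X in X + _ = _]big1_seq ?add0r; last first.
  move=> v /andP[_]; rewrite mem_index_iota /D => vD; apply: h; left; lia.
rewrite (big_cat_nat (n := (N.+1 + D)%N))//=; [|by rewrite leq_addl|by rewrite /D; lia].
rewrite [X in _ + X = _]big1_seq ?addr0; last first.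
  move=> v /andP[_]; rewrite mem_index_iota /D => vD; apply: h; right; lia.
rewrite -{1}[D]add0n big_addn addnK big_mkord; apply: eq_bigr => k _.
have -> : (k + D)%N%:Z - K%:Z = a0 + k%:Z by rewrite /D; lia.
by [].
Qed.

End Conv2.

(** * Pairing the two confluent terms *)

Section PairSum.
Variable R : realType.
Local Notation C := (CC R).
Variables (r : nat) (p : int) (al be : nat -> C) (n m : nat -> int) (d : C).
Hypothesis r1 : (1 < r)%N.
Hypothesis al1 : al 1%N = al 0%N + p%:~R + d.
Hypothesis d_nonint : ~ is_integer d.
Let A j := 1 + al 0%N + p%:~R - al j.
Let B j := 1 + al 0%N + p%:~R - be j.
Let s : int := p + n 0%N - n 1%N.
Let sg : C := (-1) ^ p * (Cpi R / Csin (Cpi R * d)).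

(** The reflection formula isolates the pole: the singular factor pi/sin (pi x) is the same for all
    k, and what remains is a value of the entire function 1/Gamma. *)
Lemma Gamma_int_refl (x : C) (k : int) : ~ is_integer x ->
  Gamma (x + k%:~R) = Cpi R / Csin (Cpi R * x) * (-1) ^ k * rho (- x - k%:~R).
Proof.
move=> xi; have h := Gamma_reflection (@nonint_int _ x k xi).
have g0 : Gamma (1 + (- x - k%:~R)) != 0 :> C.
  apply: Gamma_neq0; apply: nonint_nonpole.
  have := @nonint_opp_int _ _ (1 - k) xi; rewrite intrB.
  by have -> : 1%:~R - k%:~R - x = 1 + (- x - k%:~R) by ring.
rewrite Csin_pi_shift in h; rewrite /rho -[X in X / Csin _ * _]h.
have -> : 1 - (x + k%:~R) = 1 + (- x - k%:~R) by ring.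
have s0 := Csin_pi_neq0 xi.
have k1 : ((-1) ^ k : C) * (-1) ^ k = 1.
  exact: signzM.
move: (Gamma _) (Gamma _) g0 (Csin _) s0 ((-1) ^ k) k1 => G G' g0 S s0 t t1.
have -> : G * G' * (t * S) / S * t / G' = G * (t * t) * (G' / G') * (S / S) by field; rewrite s0.
by rewrite t1 !divff// !mulr1.
Qed.

(** Only the factor j = 0 is singular as d -> 0; [sg] is extracted from it. Here kap = k and q = N -
    k. *)
Lemma Tform1E (l : int) (N k : nat) : n 1%N + l = N%:Z -> (k <= N)%N ->
  Tform r al be n m 1 l k = sg * (rho k%:~R * rho (N%:Z - k%:Z)%:~R
     * rho ((k%:Z - p)%:~R - d) * rho ((N%:Z - k%:Z + s)%:~R + d) * gW r A B n m k%:Z (N%:Z - k%:Z) d).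
Proof.
move=> NE kN; rewrite /Tform NE absz_nat /gW.
have r0 : (0 < r)%N by exact: ltnW.
rewrite [X in _ * X * _](bigD1 (Ordinal r0))//=.
have lE : l = N%:Z - n 1%N by rewrite -NE; ring.
have e1 : \prod_(j < r) (Gamma (1 - be j + al 1 - k%:R + (m j + l)%:~R) / Gamma (1 - be j + al 1 - k%:R))
  = \prod_(j < r) (Gamma (B j + (m j + (N%:Z - k%:Z) - n 1%N)%:~R + d) / Gamma (B j + (- k%:Z)%:~R + d)).
  apply: eq_bigr => j _; congr (Gamma _ / Gamma _).
    by rewrite al1 lE /B !(intrB, intrD) -!pmulrn; ring.
  by rewrite al1 /B rmorphN/= -!pmulrn; ring.
have e2 : \prod_(j < r | ((j : nat) != 1%N) && (j != Ordinal r0))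
   (Gamma (al 1 - al j - k%:R) / Gamma (al 1 - al j - k%:R + (n j + l + 1)%:~R))
  = \prod_(j < r | (1 < j)%N) (Gamma (A j + (- 1 - k%:Z)%:~R + d) / Gamma (A j + (n j + (N%:Z - k%:Z) - n 1%N)%:~R + d)).
  apply: eq_big => [j|j _].
    by rewrite -val_eqE/=; case: (nat_of_ord j) => [|[|]].
  congr (Gamma _ / Gamma _).
    by rewrite al1 /A !(intrB, intrD, rmorphN)/= -!pmulrn; ring.
  by rewrite al1 lE /A !(intrB, intrD)/= -!pmulrn; ring.
rewrite e1 e2.
have -> : Gamma (al 1 - al 0 - k%:R) = sg * (-1) ^+ k * rho ((k%:Z - p)%:~R - d).
  have -> : al 1 - al 0 - k%:R = d + (p - k%:Z)%:~R by rewrite al1 intrB -pmulrn; ring.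
  rewrite Gamma_int_refl// /sg; congr (_ * rho _); last by rewrite !intrB; ring.
  by rewrite signzD signzN -exprnP; ring.
have -> : Gamma (al 1 - al 0 - k%:R + (n 0 + l + 1)%:~R) = (rho ((N%:Z - k%:Z + s)%:~R + d))^-1.
  rewrite /rho invrK al1 lE /s; congr Gamma.
  by rewrite !(intrB, intrD) -!pmulrn; ring.
rewrite invrK -pmulrn rho_nat.
have -> : N%:Z - k%:Z = (N - k)%N by lia.
rewrite -[(Posz (N - k))%:~R]pmulrn rho_nat !invfM.
have k1 : ((-1) ^+ k : C) * (-1) ^+ k = 1 by rewrite -expr2 sqrr_sign.
set x1 := \prod_(j < r) _; set x2 := \prod_(j < r | _) _.
move: x1 x2 ((-1) ^+ k) k1 (rho _) (rho _) (k`!%:R^-1) ((N - k)`!%:R^-1).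
move=> x1 x2 t t1 x4 x3 x5 x6.
have -> : x1 * (sg * t * x3 * x4 * x2) * (t * (x5 * x6)) = (t * t) * (sg * (x5 * x6 * x3 * x4 * (x1 * x2))) by ring.
by rewrite t1 mul1r.
Qed.

(** As al 1 exceeds al 0 by p + d, the index is shifted to kap = p + k, and q + s = N - k. The minus
    sign is that of sin (- pi d), and it makes the poles of the two terms cancel. *)
Lemma Tform0E (l : int) (N k : nat) : n 0%N + l = N%:Z -> (k <= N)%N ->
  let kap := p + k%:Z in let q := l + n 1%N - kap in
  Tform r al be n m 0 l k = - (sg * (rho (kap - p)%:~R * rho (q + s)%:~R
     * rho (kap%:~R + d) * rho (q%:~R - d) * gW r A B n m kap q 0)).
Proof.
move=> NE kN kap q; rewrite /Tform NE absz_nat /gW.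
rewrite [X in _ * X * _](bigD1 (Ordinal r1))//=.
have e1 : \prod_(j < r) (Gamma (1 - be j + al 0 - k%:R + (m j + l)%:~R) / Gamma (1 - be j + al 0 - k%:R))
  = \prod_(j < r) (Gamma (B j + (m j + q - n 1%N)%:~R + 0) / Gamma (B j + (- kap)%:~R + 0)).
  apply: eq_bigr => j _; congr (Gamma _ / Gamma _).
    by rewrite /B /q /kap !(intrB, intrD) -!pmulrn; ring.
  by rewrite /B /kap rmorphN/= intrD -!pmulrn; ring.
have e2 : \prod_(j < r | ((j : nat) != 0%N) && (j != Ordinal r1))
   (Gamma (al 0 - al j - k%:R) / Gamma (al 0 - al j - k%:R + (n j + l + 1)%:~R))
  = \prod_(j < r | (1 < j)%N) (Gamma (A j + (- 1 - kap)%:~R + 0) / Gamma (A j + (n j + q - n 1%N)%:~R + 0)).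
  apply: eq_big => [j|j _].
    by rewrite -val_eqE/=; case: (nat_of_ord j) => [|[|]].
  congr (Gamma _ / Gamma _).
    by rewrite /A /kap !(intrB, intrD, rmorphN)/= -!pmulrn; ring.
  by rewrite /A /q /kap !(intrB, intrD)/= -!pmulrn; ring.
rewrite e1 e2.
have -> : Gamma (al 0 - al 1 - k%:R) = - (sg * (-1) ^+ k * rho (kap%:~R + d)).
  have -> : al 0 - al 1 - k%:R = - d + (- kap)%:~R by rewrite al1 /kap rmorphN/= intrD -pmulrn; ring.
  rewrite Gamma_int_refl; last exact: nonint_opp.
  rewrite mulrN CsinN invrN mulrN !mulNr; congr (- _).
  have -> : - - d - (- kap)%:~R = kap%:~R + d by rewrite rmorphN/=; ring.
  rewrite /sg; congr (_ * rho _).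
  by rewrite signzN /kap signzD -exprnP; ring.
have -> : Gamma (al 0 - al 1 - k%:R + (n 1 + l + 1)%:~R) = (rho (q%:~R - d))^-1.
  rewrite /rho invrK al1 /q /kap; congr Gamma.
  by rewrite !(intrB, intrD) -!pmulrn; ring.
have -> : kap - p = k by rewrite /kap; ring.
have -> : q + s = (N - k)%N by rewrite /q /kap /s; lia.
rewrite invrK -pmulrn rho_nat -[(Posz (N - k))%:~R]pmulrn rho_nat !invfM.
have k1 : ((-1) ^+ k : C) * (-1) ^+ k = 1 by rewrite -expr2 sqrr_sign.
set x1 := \prod_(j < r) _; set x2 := \prod_(j < r | _) _.
move: x1 x2 ((-1) ^+ k) k1 (rho _) (rho _) (k`!%:R^-1) ((N - k)`!%:R^-1).
move=> x1 x2 t t1 x4 x3 x5 x6.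
have -> : x1 * (- (sg * t * x3) * x4 * x2) * (t * (x5 * x6)) = - ((t * t) * (sg * (x5 * x6 * x3 * x4 * (x1 * x2)))) by ring.
by rewrite t1 mul1r.
Qed.

(** The ranges of the two sums are kap >= p, q >= - s and kap >= 0, q >= 0. Outside them the terms
    vanish because [rho] is 0 at negative integers, so both fit into one [conv2]. *)
Lemma Tsum01 (K K' : nat) (l : int) : `|p| <= K%:Z -> `|s| <= K'%:Z ->
  Tsum r al be n m 0 l + Tsum r al be n m 1 l =
  conv2 K K' (fun kap q => (-1) ^ p * (Cpi R / Csin (Cpi R * d) * W r p A B n m kap q d)) (l + n 1%N).
Proof.
move=> pK sK.
pose U1 (kap q : int) := sg * (rho kap%:~R * rho q%:~R * rho ((kap - p)%:~R - d) * rho ((q + s)%:~R + d) * gW r A B n m kap q d).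
pose U0 (kap q : int) := - (sg * (rho (kap - p)%:~R * rho (q + s)%:~R * rho (kap%:~R + d) * rho (q%:~R - d) * gW r A B n m kap q 0)).
rewrite (@conv2_ext _ K K' _ (fun a b => U0 a b + U1 a b)); last first.
  by move=> a b; rewrite /U0 /U1 /W -/s /sg; ring.
rewrite conv2D (conv2_supp (a0 := p) (b0 := - s)); [|move=> a b ab|lia|lia]; last first.
  have [z0|z0] : (a - p < 0) \/ (b + s < 0) by case: ab => ?; [left|right]; lia.
    by rewrite /U0 (rho_neg _ z0) !(mul0r, mulr0) oppr0.
  by rewrite /U0 (rho_neg _ z0) !(mul0r, mulr0) oppr0.
rewrite (conv2_supp (a0 := 0) (b0 := 0)); [|move=> a b ab|lia|lia]; last first.
  by case: ab => z0; rewrite /U1 (rho_neg _ z0) !(mul0r, mulr0).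
congr (_ + _).
  rewrite /Tsum; have -> : l + n 1%N - p - - s = n 0%N + l by rewrite /s; ring.
  case e : (n 0%N + l) => [N|//]; apply: eq_bigr => k _.
  by rewrite (Tform0E e)// -ltnS.
rewrite /Tsum; have -> : l + n 1%N - 0 - 0 = n 1%N + l by ring.
case e : (n 1%N + l) => [N|//]; apply: eq_bigr => k _.
rewrite (Tform1E e); last by rewrite -ltnS.
by rewrite add0r /U1 [l + _]addrC e.
Qed.

End PairSum.

Section Ext.
Variable R : realType.
Local Notation C := (CC R).

Lemma near_nonint (x b : C) : ~ is_integer (x - b) -> \forall y \near x^', ~ is_integer (y - b).
Proof.
move=> /nonint_open[e e0 h]; apply/nbhsC_dP; exists e => // y _ ye.
by have := h _ ye; rewrite addrA subrK.
Qed.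

Lemma near_nonint_eq (x b : C) : x = b -> \forall y \near x^', ~ is_integer (y - b).
Proof.
move=> <-; have [e e0 h] := @nonint_near R 0; apply/nbhsC_dP; exists e => // y yx ye.
by apply: h; [rewrite subr_eq0|rewrite subr0].
Qed.

Lemma sum_split01 (r : nat) (F : nat -> C) : (1 < r)%N ->
  \sum_(i < r) F i = F 0 + F 1 + \sum_(i < r | (1 < i)%N) F i.
Proof.
move=> r1; have r0 : (0 < r)%N by exact: ltnW.
rewrite (bigD1 (Ordinal r0))//= (bigD1 (Ordinal r1))//= addrA; congr (_ + _).
by apply: eq_bigl => j; rewrite -!val_eqE/=; case: (nat_of_ord j) => [|[|]].
Qed.

Lemma W_ext (r : nat) (p : int) (A A' B : nat -> C) (n m : nat -> int) kap q d :
  (forall j, (1 < j)%N -> A j = A' j) -> W r p A B n m kap q d = W r p A' B n m kap q d.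
Proof.
move=> h; have e x : gW r A B n m kap q x = gW r A' B n m kap q x.
  by rewrite /gW; congr (_ * _); apply: eq_bigr => j /h ->.
by rewrite /W !e.
Qed.

Lemma VT_be_ext (r : nat) (al be be' : nat -> C) (n m : nat -> int) i l :
  (forall j, (j < r)%N -> be j = be' j) -> VT r al be n m i l = VT r al be' n m i l.
Proof.
move=> h; rewrite /VT /VC /VF /VG; case: (n i + l) => // N; congr (_ / _ * _).
  by apply: eq_bigr => j _; rewrite h.
by apply: eq_bigr => k _; congr (_ / _ / _ * (_ / _ / _)); apply: eq_bigr => j _; rewrite h.
Qed.

(** Finiteness makes the Pochhammer symbols of [VC] continuous in the shift; all other factors that
    depend on beta are polynomials. *)
Lemma VT_shift_cvg (r : nat) (al be : nat -> C) (n m : nat -> int) i l :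
  (forall j, (j < r)%N -> poch_finite (1 + al i - be j) (m j - n i)) ->
  VT r al (fun j => be j + s) n m i l @[s --> (0 : C)^'] --> VT r al be n m i l.
Proof.
move=> fin; rewrite /VT; case: (n i + l) => N; last exact: cvgC_cst.
have idc : s @[s --> (0 : C)^'] --> (0 : C) by exact: cvg_id_dnbhs.
apply: cvgCM.
  apply: cvgCM; last exact: cvgC_cst.
  apply: cvg_prodC => j _.
  have h : poch (1 + al i - be j - s) (m j - n i) @[s --> (0 : C)^'] --> poch (1 + al i - be j) (m j - n i).
    apply: (@cvg_refl_cst _ (fun x => poch x (m j - n i)) 0).
    by rewrite subr0; apply: poch_cont; exact: fin.
  by apply: cvgC_eq h; apply: nearW => s; rewrite opprD addrA.
apply: cvg_sumC => k _; apply: cvgCM.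
  apply: cvgCM; last exact: cvgC_cst.
  apply: cvgCM; last exact: cvgC_cst.
  apply: cvg_prodC => j _; apply: rise_cont.
  have h : be j + s - al i @[s --> (0 : C)^'] --> be j + 0 - al i.
    by apply: cvgCB; [apply: cvgCD; [exact: cvgC_cst|exact: idc]|exact: cvgC_cst].
  by rewrite addr0 in h; exact: h.
apply: cvgCM; last exact: cvgC_cst.
apply: cvgCM; last exact: cvgC_cst.
apply: cvg_prodC => j _; apply: rise_cont.
have h : 1 + al i - (be j + s) + (m j - n i)%:~R @[s --> (0 : C)^']
    --> 1 + al i - (be j + 0) + (m j - n i)%:~R.
  apply: cvgCD; last exact: cvgC_cst.
  by apply: cvgCB; [exact: cvgC_cst|apply: cvgCD; [exact: cvgC_cst|exact: idc]].
by rewrite addr0 in h; exact: h.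
Qed.

Lemma rise_neq0 (x : C) k : nonpole x -> rise x k != 0.
Proof. by move=> xi; apply/prodf_neq0 => i _; exact: xi. Qed.

Lemma poch_nonint_neq0 (x : C) k : ~ is_integer x -> poch x k != 0.
Proof.
move=> xi; rewrite poch_nonint// mulf_neq0 ?invr_eq0//; apply: Gamma_neq0; apply: nonint_nonpole => //.
exact: nonint_int.
Qed.

Lemma VT_al_cvg (r : nat) (al be : nat -> C) (n m : nat -> int) i l (al' : C -> nat -> C) (c : C) :
  (forall j, (j < r)%N -> j != i -> ~ is_integer (al i - al j)) ->
  (forall y, al' y i = al i) ->
  (forall j, al' y j @[y --> c^'] --> al j) ->
  (forall j, (j < r)%N -> j != i -> forall k, poch (al i - al' y j) k @[y --> c^'] --> poch (al i - al j) k) ->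
  VT r (al' y) be n m i l @[y --> c^'] --> VT r al be n m i l.
Proof.
move=> hal ei hj hp; rewrite /VT; case: (n i + l) => N; last exact: cvgC_cst.
have nz j k : (j < r)%N -> j != i -> ~ is_integer (al i - al j + k%:~R).
  by move=> jr ji; apply: nonint_int; exact: hal.
apply: cvgCM.
  rewrite /VC; apply: cvgC_divf.
  - by apply/prodf_neq0 => j ji; apply: poch_nonint_neq0; exact: hal.
  - apply: cvg_prodC => j _.
    have h : poch (1 + al i - be j) (m j - n i) @[y --> c^'] --> poch (1 + al i - be j) (m j - n i).
      exact: cvgC_cst.
    by apply: cvgC_eq h; apply: nearW => y; rewrite ei.
  apply: cvg_prodC => j ji.
  apply: cvgC_eq (hp j (ltn_ord j) ji (n j - n i + 1)); apply: nearW => y; by rewrite ei.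
apply: cvg_sumC => k _; apply: cvgCM.
  rewrite /VF; apply: cvgCM; last exact: cvgC_cst.
  apply: cvgC_divf.
  - apply/prodf_neq0 => j ji; apply: rise_neq0; apply: nonint_nonpole.
    have := nonint_opp (nz j (-1) (ltn_ord j) ji).
    by have -> : - (al i - al j + (-1)%:~R) = al j + (1 - al i) by ring.
  - apply: cvg_prodC => j _.
    have h : rise (be j - al i) k @[y --> c^'] --> rise (be j - al i) k by exact: cvgC_cst.
    by apply: cvgC_eq h; apply: nearW => y; rewrite ei.
  apply: cvg_prodC => j ji; apply: rise_cont.
  have h : al' y j + (1 - al i) @[y --> c^'] --> al j + (1 - al i).
    by apply: cvgCD; [exact: hj|exact: cvgC_cst].
  by apply: cvgC_eq h; apply: nearW => y; rewrite ei.
rewrite /VG; apply: cvgCM; last exact: cvgC_cst.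
apply: cvgC_divf.
- apply/prodf_neq0 => j ji; apply: rise_neq0; apply: nonint_nonpole.
  have := nz j (1 + (n j - n i)) (ltn_ord j) ji.
  by have -> : al i - al j + (1 + (n j - n i))%:~R = 1 + al i - al j + (n j - n i)%:~R by rewrite (intrD _ 1); ring.
- apply: cvg_prodC => j _; apply: rise_cont.
  have h : 1 + al i - be j + (m j - n i)%:~R @[y --> c^'] --> 1 + al i - be j + (m j - n i)%:~R by exact: cvgC_cst.
  by apply: cvgC_eq h; apply: nearW => y; rewrite ei.
apply: cvg_prodC => j ji; apply: rise_cont.
have h : 1 + al i - al' y j + (n j - n i)%:~R @[y --> c^'] --> 1 + al i - al j + (n j - n i)%:~R.
  apply: cvgCD; last exact: cvgC_cst.
  by apply: cvgCB; [exact: cvgC_cst|exact: hj].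
by apply: cvgC_eq h; apply: nearW => y; rewrite ei.
Qed.

Lemma nonint_pair_sym (r : nat) (alpha : seq C) :
  (forall i j : nat, (i < j < r)%N -> (i, j) <> (0%N, 1%N) -> ~ is_integer (alpha`_i - alpha`_j)) ->
  forall i j : nat, (i < r)%N -> (j < r)%N -> i != j -> ((1 < i) || (1 < j))%N ->
  ~ is_integer (alpha`_i - alpha`_j).
Proof.
move=> al_nonint i j ir jr ij i1; case: (ltngtP i j) ij => // h _.
  by apply: al_nonint; [rewrite h|case=> ? ?; subst].
rewrite -opprB; apply: nonint_opp; apply: al_nonint; [by rewrite h|by case=> ? ?; subst].
Qed.

End Ext.

(** * The limits defining Delta *)

Section DeltaLimit.
Variable R : realType.
Local Notation C := (CC R).
Variables (r : nat) (p : int) (alpha beta : seq C) (n m : seq int).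
Hypotheses (sa : size alpha = r) (sb : size beta = r) (sn : size n = r) (sm : size m = r).
Hypothesis r1 : (1 < r)%N.
Hypothesis al1 : alpha`_1 = alpha`_0 + p%:~R.
Hypothesis al_nonint : forall i j : nat, (i < j < r)%N -> (i, j) <> (0%N, 1%N) ->
  ~ is_integer (alpha`_i - alpha`_j).
Hypothesis B_nonint : forall j : nat, (j < r)%N -> ~ is_integer (1 + alpha`_0 + p%:~R - beta`_j).
Hypothesis fin : forall i j : nat, (1 < i < r)%N -> (j < r)%N ->
  poch_finite (1 - beta`_j + alpha`_i) (m`_j - n`_i).
Let c : C := alpha`_0 + p%:~R.
Let A j := 1 + alpha`_0 + p%:~R - alpha`_j.
Let B j := 1 + alpha`_0 + p%:~R - beta`_j.

Let aly y := set_nth 0 alpha 1 y.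

Let alyE y j : (aly y)`_j = if j == 1%N then y else alpha`_j.
Proof. by rewrite nth_set_nth. Qed.

(** Generic position of alpha_2 = y. Integrality of beta_j - alpha_i can be excluded by moving y
    only for i < 2; for the other i it is removed by the shift of beta. *)
Let good (y : C) := [/\ ~ is_integer (y - c),
  forall i j : nat, (i < r)%N -> (j < r)%N -> i != j -> ~ is_integer ((aly y)`_i - (aly y)`_j) &
  forall i j : nat, (i < 2)%N -> (j < r)%N -> ~ is_integer (beta`_j - (aly y)`_i)].

Let good_near : \forall y \near c^', good y.
Proof.
have h1 : \forall y \near c^', ~ is_integer (y - c) by exact: near_nonint_eq.
have h2 : \forall y \near c^', forall j : 'I_r, (1 < j)%N -> ~ is_integer (y - alpha`_j).
  apply: filter_forall => j; case: (ltnP 1 j) => j1; last by apply: nearW => y.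
  have : ~ is_integer (c - alpha`_j).
    rewrite /c -al1; apply: al_nonint; first by rewrite j1/=.
    by case=> e; rewrite e in j1.
  by move/near_nonint; apply: filterS => y yj _.
have h3 : \forall y \near c^', forall j : 'I_r, ~ is_integer (y - beta`_j).
  apply: filter_forall => j; apply: near_nonint.
  have := @nonint_int _ _ (-1) (B_nonint (ltn_ord j)).
  by have -> : 1 + alpha`_0 + p%:~R - beta`_j + (-1)%:~R = c - beta`_j by rewrite /c; ring.
near=> y; have y1 : ~ is_integer (y - c) by near: y.
have y2 : forall j : 'I_r, (1 < j)%N -> ~ is_integer (y - alpha`_j) by near: y.
have y3 : forall j : 'I_r, ~ is_integer (y - beta`_j) by near: y.
have y0 j : (j < r)%N -> j != 1%N -> ~ is_integer (y - alpha`_j).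
  move=> jr; case: j jr => [|[|j]] jr // _; last exact: (y2 (Ordinal jr)).
  have := @nonint_int _ _ p y1.
  by have -> : y - c + p%:~R = y - alpha`_0 by rewrite /c; ring.
split => // i j ir jr.
  rewrite !alyE => ij; case: (altP (i =P 1%N)) ij => [->|i1] ij.
    by rewrite eq_sym (negbTE ij); apply: y0; rewrite // eq_sym.
  case: (altP (j =P 1%N)) => [_|j1].
    by rewrite -opprB; apply: nonint_opp; exact: y0.
  apply: (nonint_pair_sym al_nonint) => //.
  by case: i j i1 j1 ij {ir jr} => [|[|i]] [|[|j]].
rewrite alyE; case: i ir => [|[|]] //= _.
  have := @nonint_opp_int _ _ (1 + p) (B_nonint jr).
  by have -> : (1 + p)%:~R - (1 + alpha`_0 + p%:~R - beta`_j) = beta`_j - alpha`_0 by rewrite intrD; ring.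
by rewrite -opprB; apply: nonint_opp; exact: (y3 (Ordinal jr)).
Unshelve. all: by end_near.
Qed.

Variable E : nat.
Hypothesis EE : e_of n m + 1 = E%:Z.

Lemma size_aly y : size (aly y) = r.
Proof. by rewrite size_set_nth sa; apply/maxn_idPr. Qed.

Let near_be y : \forall s \near (0 : C)^', forall i j : 'I_r,
  ~ is_integer (beta`_j + s - (aly y)`_i).
Proof.
apply: filter_forall => i; apply: filter_forall => j.
have [e e0 he] := @nonint_near R (beta`_j - (aly y)`_i).
apply/nbhsC_dP; exists e => // s s0; rewrite subr0 => se.
have -> : beta`_j + s - (aly y)`_i = s + (beta`_j - (aly y)`_i) by ring.
by apply: he; rewrite ?addrK// -subr_eq0 addrK.
Qed.

Let sum_be_near y : good y -> \forall s \near (0 : C)^', forall J,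
  Delta_raw (aly y) (shiftv beta s) n m J = \sum_(t < E.+1) 'C(E, t)%:R * (-1) ^+ t *
     \sum_(i < r) VT r (nth 0 (aly y)) (fun j => beta`_j + s) (nth 0 n) (nth 0 m) i (J - t%:Z).
Proof.
move=> [g1 g2 g3].
apply: filterS (near_be y) => s hs J.
have bE j : (j < r)%N -> (shiftv beta s)`_j = beta`_j + s by move=> jr; rewrite nth_shiftv ?sb.
rewrite (@Delta_raw_csum _ r _ _ n m _ _ _ _ J E)// ?size_aly ?size_shiftv//; last first.
  by move=> i j ir jr; rewrite bE//; exact: (hs (Ordinal ir) (Ordinal jr)).
apply: eq_bigr => t _; congr (_ * _); apply: eq_bigr => i _.
rewrite -(@VT_be_ext _ r (nth 0 (aly y)) (nth 0 (shiftv beta s))); last exact: bE.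
rewrite VT_Tsum//.
  by move=> j jr ji; apply: g2; rewrite // eq_sym.
by move=> j jr; rewrite bE//; exact: (hs i (Ordinal jr)).
Qed.

(** [csum_vanish] holds for generic parameters, where [Delta_raw] is identically 0 near the limit
    points; the zero then passes through both limits. *)
Lemma Delta_big J : e_of n m - vmin m < J -> Delta p alpha beta n m J = 0.
Proof.
move=> Jm; apply: limC; apply: (@cvgC_eq _ _ _ _ (fun=> 0)); last exact: cvgC_cst.
apply: filterS good_near => y [g1 g2 g3]; apply/esym.
apply: limC; apply: (@cvgC_eq _ _ _ _ (fun=> 0)); last exact: cvgC_cst.
apply: filterS (near_be y) => s hs.
have bE j : (j < r)%N -> (shiftv beta s)`_j = beta`_j + s by move=> jr; rewrite nth_shiftv ?sb.
have hb i j : (i < r)%N -> (j < r)%N -> ~ is_integer ((shiftv beta s)`_j - (aly y)`_i).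
  by move=> ir jr; rewrite bE//; exact: (hs (Ordinal ir) (Ordinal jr)).
rewrite (@Delta_raw_csum _ r _ _ n m _ _ _ _ J E)// ?size_aly ?size_shiftv//.
apply/esym; apply: csum_vanish => //; first exact: ltnW.
  (* The degree condition is strict since E = e + 1 and e >= M - N - r + 1; the other condition
     holds since J > e - m_min means J - E >= - m_min. *)
  have em : \sum_(a <- m) a = \sum_(j < r) m`_j by rewrite (big_nth 0) sm big_mkord.
  have en : \sum_(a <- n) a = \sum_(j < r) n`_j by rewrite (big_nth 0) sn big_mkord.
  by rewrite -em -en; move: EE; rewrite /e_of sn; lia.
move=> j jr; have : vmin m <= m`_j by apply: vmin_le; rewrite mem_nth ?sm.
by move: EE Jm; lia.
Qed.

Lemma Delta_small J : J < - vmax n -> Delta p alpha beta n m J = 0.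
Proof.
move=> Jm; apply: limC; apply: (@cvgC_eq _ _ _ _ (fun=> 0)); last exact: cvgC_cst.
apply: nearW => y; apply/esym.
apply: limC; apply: (@cvgC_eq _ _ _ _ (fun=> 0)); last exact: cvgC_cst.
apply: nearW => s; rewrite /Delta_raw /zrange.
by rewrite ge_max [_ <= J]leNgt Jm/= big_nil.
Qed.

Variables (K K' : nat).
Hypotheses (pK : `|p| <= K%:Z) (sK : `|p + n`_0 - n`_1| <= K'%:Z).

(** The limit of the l-th inner sum. The shift by n_2 appears because the exponents of X and Y
    satisfy kap + q = l + n_2. *)
Definition clim (l : int) : C :=
  conv2 K K' (Ulim r p A B (nth 0 n) (nth 0 m)) (l + n`_1)
  + \sum_(i < r | (1 < i)%N) VT r (nth 0 alpha) (nth 0 beta) (nth 0 n) (nth 0 m) i l.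

(** The limit in s is taken in the form [VT]: unlike the Gamma quotients of [Tform], it keeps its
    meaning when some beta_j - alpha_i with i >= 2 is an integer. *)
Let Delta_generic_good y J : good y ->
  Delta_generic (aly y) beta n m J = \sum_(t < E.+1) 'C(E, t)%:R * (-1) ^+ t *
     \sum_(i < r) VT r (nth 0 (aly y)) (nth 0 beta) (nth 0 n) (nth 0 m) i (J - t%:Z).
Proof.
move=> gy; apply: limC.
apply: (@cvgC_eq _ _ _ _ (fun s => \sum_(t < E.+1) 'C(E, t)%:R * (-1) ^+ t *
     \sum_(i < r) VT r (nth 0 (aly y)) (fun j => beta`_j + s) (nth 0 n) (nth 0 m) i (J - t%:Z))).
  by apply: filterS (sum_be_near gy) => s ->.
apply: cvg_sumC => t _; apply: cvgCM; first exact: cvgC_cst.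
apply: cvg_sumC => i _; apply: VT_shift_cvg => j jr.
have [g1 g2 g3] := gy; case: (ltnP 1 i) => i1.
  rewrite alyE; have -> : (i : nat) == 1%N = false by apply/negbTE; rewrite neq_ltn i1 orbT.
  have := fin (i := i) (j := j); rewrite i1/= => /(_ (ltn_ord i) jr).
  by have -> : 1 - beta`_j + alpha`_i = 1 + alpha`_i - beta`_j by ring.
apply: nonint_poch_finite.
have := @nonint_opp_int _ _ 1 (g3 i j i1 jr).
by have -> : 1%:~R - (beta`_j - (aly y)`_i) = 1 + (aly y)`_i - beta`_j by ring.
Qed.

Let aly0 y : (aly y)`_0 = alpha`_0. Proof. by rewrite alyE. Qed.

Let Vsum_cvg l :
  \sum_(i < r) VT r (nth 0 (aly y)) (nth 0 beta) (nth 0 n) (nth 0 m) i l @[y --> c^'] --> clim l.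
Proof.
have h : conv2 K K' (fun kap q => (-1) ^ p * (Cpi R / Csin (Cpi R * (y - c))
          * W r p A B (nth 0 n) (nth 0 m) kap q (y - c))) (l + n`_1)
     + \sum_(i < r | (1 < i)%N) VT r (nth 0 (aly y)) (nth 0 beta) (nth 0 n) (nth 0 m) i l
    @[y --> c^'] --> clim l.
  apply: cvgCD.
    apply: conv2_cvg => a b; apply: cvg_shift0.
    have A_nonint j : (1 < j < r)%N -> ~ is_integer (A j).
      move=> /andP[j1 jr].
      have : ~ is_integer (alpha`_1 - alpha`_j) by apply: (nonint_pair_sym al_nonint); rewrite ?j1// neq_ltn j1.
      move/(@nonint_int _ _ 1); rewrite al1.
      by have -> : alpha`_0 + p%:~R - alpha`_j + 1%:~R = A j by rewrite /A; ring.
    apply: cvgC_eq (@U_cvg _ r p A B (nth 0 n) (nth 0 m) A_nonint B_nonint a b).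
    by apply: nearW => d; rewrite addrK.
  apply: cvg_sumC => i i1; have ir := ltn_ord i.
  have cj j : (aly y)`_j @[y --> c^'] --> alpha`_j.
    case: (altP (j =P 1%N)) => [->|j1].
      have h : y @[y --> c^'] --> alpha`_1 by rewrite al1; exact: cvg_id_dnbhs.
      by apply: cvgC_eq h; apply: nearW => y; rewrite alyE.
    have h : alpha`_j @[y --> c^'] --> alpha`_j by exact: cvgC_cst.
    by apply: cvgC_eq h; apply: nearW => y; rewrite alyE (negbTE j1).
  apply: VT_al_cvg => //.
  - by move=> j jr ji; apply: (nonint_pair_sym al_nonint); rewrite ?i1// eq_sym.
  - by move=> y; rewrite alyE; case: (nat_of_ord i) i1 => [|[|]].
  move=> j jr ji k; have nij : ~ is_integer (alpha`_i - alpha`_j).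
    by apply: (nonint_pair_sym al_nonint); rewrite ?i1// eq_sym.
  case: (altP (j =P 1%N)) => [je|j1].
    have h : poch (alpha`_i - y) k @[y --> c^'] --> poch (alpha`_i - alpha`_j) k.
      apply: (@cvg_refl_cst _ (fun x => poch x k)).
      by rewrite je al1; apply: poch_cont; apply: nonint_poch_finite; rewrite /c -al1 -je.
    by apply: cvgC_eq h; apply: nearW => y; rewrite je alyE.
  have h : poch (alpha`_i - alpha`_j) k @[y --> c^'] --> poch (alpha`_i - alpha`_j) k by exact: cvgC_cst.
  by apply: cvgC_eq h; apply: nearW => y; rewrite alyE (negbTE j1).
apply: cvgC_eq h; apply: filterS good_near => y [g1 g2 g3].
(* For generic y the terms 0 and 1 go back to [Tsum] and are merged by [Tsum01] with d = y - c; the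
   others converge separately. *)
rewrite [RHS](@sum_split01 _ r (fun i => VT r (nth 0 (aly y)) (nth 0 beta) (nth 0 n) (nth 0 m) i l))//; congr (_ + _).
have r0 : (0 < r)%N by exact: ltnW.
rewrite !VT_Tsum//; [|by move=> j jr j1; apply: g2; rewrite // eq_sym|by move=> j jr; apply: g3
  |by move=> j jr j1; apply: g2; rewrite // eq_sym|by move=> j jr; apply: g3].
have e1 : (aly y)`_1 = (aly y)`_0 + p%:~R + (y - c) by rewrite !alyE/= /c; ring.
rewrite (Tsum01 (nth 0 beta) (nth 0 m) r1 e1 g1 l pK sK).
apply: conv2_ext => a b; congr (_ * (_ * _)); rewrite aly0; apply: W_ext => j j1.
by rewrite alyE; case: j j1 => [|[|]].
Qed.

Lemma Delta_clim J : Delta p alpha beta n m J =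
  \sum_(t < E.+1) 'C(E, t)%:R * (-1) ^+ t * clim (J - t%:Z).
Proof.
apply: limC.
apply: (@cvgC_eq _ _ _ _ (fun y => \sum_(t < E.+1) 'C(E, t)%:R * (-1) ^+ t *
     \sum_(i < r) VT r (nth 0 (aly y)) (nth 0 beta) (nth 0 n) (nth 0 m) i (J - t%:Z))).
  by apply: filterS good_near => y gy; rewrite -(Delta_generic_good J gy).
by apply: cvg_sumC => t _; apply: cvgCM; [exact: cvgC_cst|exact: Vsum_cvg].
Qed.

End DeltaLimit.

(** * Summation *)

Section HypSums.
Variable R : realType.
Local Notation C := (CC R).

Lemma prod_split01 (r : nat) (F : nat -> C) : (1 < r)%N ->
  \prod_(i < r) F i = F 0 * F 1 * \prod_(i < r | (1 < i)%N) F i.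
Proof.
move=> r1; have r0 : (0 < r)%N by exact: ltnW.
rewrite (bigD1 (Ordinal r0))//= (bigD1 (Ordinal r1))//= mulrA; congr (_ * _).
by apply: eq_bigl => j; rewrite -!val_eqE/=; case: (nat_of_ord j) => [|[|]].
Qed.

Lemma prod_divM (r : nat) (P : pred nat) (c : C) (f g : nat -> C) :
  \prod_(j < r | P j) (c / (f j * g j)) =
  \prod_(j < r | P j) c / (\prod_(j < r | P j) f j * \prod_(j < r | P j) g j).
Proof. by rewrite prodf_div big_split. Qed.

Definition hratio (r : nat) (x y : nat -> C) (k : nat) : C :=
  \prod_(j < r) Gamma (x j + k%:R) / \prod_(j < r | (1 < j)%N) Gamma (y j + k%:R).

Lemma subexp_big_prod (r : nat) (P : pred nat) (f : nat -> nat -> C) :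
  (forall j, (j < r)%N -> P j -> subexp (f j)) ->
  subexp (fun k => \prod_(j < r | P j) f j k).
Proof.
move=> h; elim: r h => [|r IH] h.
  by apply: subexp_ext (subexp_cst 1) => k; rewrite big_ord0.
have IH' := IH (fun j jr => h j (ltnW jr)).
case Pr : (P r).
  apply: subexp_ext (subexpM IH' (h r (ltnSn r) Pr)) => k.
  by rewrite [RHS]big_mkcond big_ord_recr/= Pr -big_mkcond.
apply: subexp_ext IH' => k; by rewrite [RHS]big_mkcond big_ord_recr/= Pr -big_mkcond mulr1.
Qed.

Lemma subexp_big_sum (r : nat) (P : pred nat) (f : nat -> nat -> C) :
  (forall j, (j < r)%N -> P j -> subexp (f j)) ->
  subexp (fun k => \sum_(j < r | P j) f j k).
Proof.
move=> h; elim: r h => [|r IH] h.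
  by apply: subexp_ext (subexp_cst 0) => k; rewrite big_ord0.
have IH' := IH (fun j jr => h j (ltnW jr)).
case Pr : (P r).
  apply: subexp_ext (subexpD IH' (h r (ltnSn r) Pr)) => k.
  by rewrite [RHS]big_mkcond big_ord_recr/= Pr -big_mkcond.
apply: subexp_ext IH' => k; by rewrite [RHS]big_mkcond big_ord_recr/= Pr -big_mkcond addr0.
Qed.

(** The powers of k! balance: r quotients Gamma/k!, r - 2 quotients k!/Gamma and [t k * k!] leave
    exactly 1/k!. *)
Lemma subexp_hratio (r : nat) (x y : nat -> C) (t : nat -> C) : (1 < r)%N ->
  (forall j, (j < r)%N -> nonpole (x j)) -> subexp (fun k => t k * k`!%:R) ->
  subexp (fun k => hratio r x y k * t k / k`!%:R).
Proof.
move=> r1 xi ts.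
have h1 := @subexp_big_prod r xpredT (fun j k => Gamma (x j + k%:R) / k`!%:R)
  (fun j jr _ => subexp_Gamma (xi j jr)).
have h2 := @subexp_big_prod r (fun j => 1 < j)%N (fun j k => k`!%:R / Gamma (y j + k%:R))
  (fun j jr _ => @subexp_invGamma _ (y j)).
apply: subexp_ext (subexpM (subexpM h1 h2) ts) => k.
rewrite /hratio !prodf_div (@prod_split01 r (fun _ => k`!%:R))//.
have f0 := fact_neq0 R k.
have f1 : \prod_(i < r | (1 < i)%N) k`!%:R != 0 :> C by apply/prodf_neq0.
move: (\prod_(i < r | (1 < i)%N) Gamma _) => w; rewrite !invfM; move: (w^-1) => w'.
set a := \prod_(i < r) _; set b := \prod_(i < r | _) _ in f1 *.
by move: a b f1 (k`!%:R : C) f0 (t k) => a b b0 f f0' tk; field; rewrite b0 f0'.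
Qed.

Lemma subexp_rise (x : C) : subexp (fun k => rise x k / k`!%:R).
Proof.
have [xi|[N xN]] := nonpole_cases x.
  apply: subexp_ext (subexpM (subexp_cst (Gamma x)^-1) (subexp_Gamma xi)) => k.
  by rewrite rise_Gamma// mulrC mulrAC.
apply: (@subexp_addn _ _ N.+1); apply: subexp_ext (subexp_cst 0) => k.
by rewrite xN rise_neg0 ?mul0r// addnS ltnS leq_addl.
Qed.

Lemma subexp_inv_rise (x : C) : nonpole x -> subexp (fun k => k`!%:R / rise x k).
Proof.
move=> xi; apply: subexp_ext (subexpM (subexp_cst (Gamma x)) (@subexp_invGamma _ x)) => k.
by rewrite rise_Gamma// invfM invrK; ring.
Qed.

Lemma lsum_from (z : C) (a : int) (K : nat) (f : int -> C) S : z != 0 ->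
  (forall i, i < a -> f i = 0) -> - a <= K%:Z ->
  gsum (fun k : nat => f (a + k%:Z) * z ^+ k) S -> has_lsum z K f (z ^ a * S).
Proof.
move=> z0 fa aK /lsum_ps h.
have aK' : 0%N%:Z - a <= K%:Z by rewrite sub0r.
apply: lsum_ext (lsum_shift z0 h aK') => i /=.
case e : (i - a) => [k|k]/=; last by rewrite fa//; lia.
by rewrite -e addrC subrK.
Qed.

End HypSums.

(** Obtained by differentiating the shift formula of the sine. *)
Lemma Ccos_pi_shift (R : realType) (x : CC R) (k : int) :
  Ccos (Cpi R * (x + k%:~R)) = (-1) ^ k * Ccos (Cpi R * x).
Proof.
have h1 : has_deriv (fun t : CC R => Csin (Cpi R * (t + k%:~R))) x (Cpi R * Ccos (Cpi R * (x + k%:~R))).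
  by apply: (@has_deriv_shift _ (fun t => Csin (Cpi R * t))); exact: Csin_pi_deriv.
have h2 := has_derivM (has_deriv_cst ((-1) ^ k : CC R) x) (@Csin_pi_deriv R x).
have h3 : has_deriv (fun t : CC R => Csin (Cpi R * (t + k%:~R))) x
    (0 * Csin (Cpi R * x) + (-1) ^ k * (Cpi R * Ccos (Cpi R * x))).
  by apply: has_deriv_ext h2 => t; rewrite Csin_pi_shift.
apply: (mulfI (Cpi_neq0 R)); rewrite (has_deriv_unique h1 h3) mul0r add0r.
by move: (Ccos _) => w; ring.
Qed.

(** * Coefficients of the Wronskian-like combination *)

Section Coefficients.
Variable R : realType.
Local Notation C := (CC R).
Variables (r : nat) (p : int) (A B : nat -> C) (n m : nat -> int).
Hypothesis r1 : (1 < r)%N.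
Hypothesis A_nonint : forall j : nat, (1 < j < r)%N -> ~ is_integer (A j).
Hypothesis B_nonint : forall j : nat, (j < r)%N -> ~ is_integer (B j).
Let s : int := p + n 0%N - n 1%N.

(* X = sum Xf k z^k and Y = sum Yf q z^q are z^p phi_1B and phi_B; Xd1 + Xd2 and
   Yd1 + Yd2 are the derivatives of Xf and Yf in a continuous index. *)
Definition Pc (k : int) : C :=
  \prod_(j < r) Gamma (1 - B j + k%:~R) / \prod_(j < r | (1 < j)%N) Gamma (2 - A j + k%:~R).
Definition Pd (k : int) : C :=
  \sum_(j < r) psi (1 - B j + k%:~R) - \sum_(j < r | (1 < j)%N) psi (2 - A j + k%:~R).
Definition Qc (q : int) : C :=
  \prod_(j < r) Gamma (B j + (m j - n 1%N)%:~R + q%:~R)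
  / \prod_(j < r | (1 < j)%N) Gamma (A j + (n j - n 1%N)%:~R + q%:~R).
Definition Qd (q : int) : C :=
  \sum_(j < r) psi (B j + (m j - n 1%N)%:~R + q%:~R)
  - \sum_(j < r | (1 < j)%N) psi (A j + (n j - n 1%N)%:~R + q%:~R).

Definition Xf k : C := Pc k * (rho k%:~R * rho (k - p)%:~R).
Definition Xd1 k : C := Pc k * (rhod k%:~R * rho (k - p)%:~R).
Definition Xd2 k : C := Pc k * (rho k%:~R * (rhod (k - p)%:~R + rho (k - p)%:~R * Pd k)).
Definition Yf q : C := Qc q * (rho q%:~R * rho (q + s)%:~R).
Definition Yd1 q : C := Qc q * (rho q%:~R * (rhod (q + s)%:~R + rho (q + s)%:~R * Qd q)).
Definition Yd2 q : C := Qc q * (rhod q%:~R * rho (q + s)%:~R).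

Definition Ksin : C := \prod_(j < r | (1 < j)%N) Csin (Cpi R * A j)
  / \prod_(j < r) Csin (Cpi R * B j).
Definition Cotd : C := \sum_(j < r | (1 < j)%N) Ccot (Cpi R * A j)
  - \sum_(j < r) Ccot (Cpi R * B j).

(** The reflection formula carries the Gammas of [Pc] to the other side of the fraction in [gW]. The
    factors u = pi (-1)^kap nearly cancel: u^2 = pi^2 survives, and the r - 2 minus signs from 2 - A
    give (-1)^r. *)
Lemma PQ_gW (kap q : int) : Pc kap * Qc q = (-1) ^+ r * Cpi R ^+ 2 * Ksin * gW r A B n m kap q 0.
Proof.
pose u : C := Cpi R * (-1) ^ kap.
have hB j : (j < r)%N -> Gamma (1 - B j + kap%:~R) =
    u / (Csin (Cpi R * B j) * Gamma (B j + (- kap)%:~R + 0)).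
  move=> jr; have xi := @nonint_int _ _ (- kap) (B_nonint jr).
  have h := Gamma_reflection xi; rewrite Csin_pi_shift signzN in h.
  have g0 : Gamma (B j + (- kap)%:~R) != 0 by apply: Gamma_neq0; exact: nonint_nonpole.
  have s0 := Csin_pi_neq0 (B_nonint jr).
  have -> : 1 - B j + kap%:~R = 1 - (B j + (- kap)%:~R) by rewrite rmorphN/=; ring.
  rewrite addr0 /u -[X in X * _ / _]h.
  have t1 := @signzM R kap.
  move: (Gamma _) (Gamma _) g0 (Csin _) s0 ((-1) ^ kap) t1 => G G' G0 S S0 t t1.
  have -> : G' * G * (t * S) * t / (S * G') = G * (t * t) by field; rewrite S0 G0.
  by rewrite t1 mulr1.
have hA j : (1 < j < r)%N -> Gamma (2 - A j + kap%:~R) =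
    - u / (Csin (Cpi R * A j) * Gamma (A j + (- 1 - kap)%:~R + 0)).
  move=> jr; have xi := @nonint_int _ _ (- 1 - kap) (A_nonint jr).
  have h := Gamma_reflection xi; rewrite Csin_pi_shift signzD signzN in h.
  have g0 : Gamma (A j + (- 1 - kap)%:~R) != 0 by apply: Gamma_neq0; exact: nonint_nonpole.
  have s0 := Csin_pi_neq0 (A_nonint jr).
  have -> : 2 - A j + kap%:~R = 1 - (A j + (- 1 - kap)%:~R) by rewrite intrB; ring.
  rewrite addr0 /u -[X in - (X * _) / _]h.
  have t1 := @signzM R kap.
  have -> : ((-1) ^ (-1)%R : C) = -1 by rewrite signzN.
  rewrite signzN in h *.
  move: (Gamma _) (Gamma _) g0 (Csin _) s0 ((-1) ^ kap) t1 => G G' G0 S S0 t t1.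
  have -> : - (G' * G * (-1 * t * S) * t) / (S * G') = G * (t * t) by field; rewrite S0 G0.
  by rewrite t1 mulr1.
have uu : u * u = Cpi R ^+ 2.
  rewrite /u; have := @signzM R kap; move: ((-1) ^ kap : C) => t t1.
  by rewrite mulrACA t1 mulr1 -expr2.
clearbody u.
have -> : Pc kap = (\prod_(j < r) u / \prod_(j < r | (1 < j)%N) - u)
   * (\prod_(j < r | (1 < j)%N) Csin (Cpi R * A j) / \prod_(j < r) Csin (Cpi R * B j))
   * (\prod_(j < r | (1 < j)%N) Gamma (A j + (- 1 - kap)%:~R + 0)
      / \prod_(j < r) Gamma (B j + (- kap)%:~R + 0)).
  rewrite /Pc (eq_bigr _ (fun (j : 'I_r) _ => hB j (ltn_ord j))).
  have -> : \prod_(j < r | (1 < j)%N) Gamma (2 - A j + kap%:~R) = \prod_(j < r | (1 < j)%N)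
     (- u / (Csin (Cpi R * A j) * Gamma (A j + (- 1 - kap)%:~R + 0))).
    by apply: eq_bigr => j j1; apply: hA; rewrite j1/=.
  have e1 := @prod_divM R r xpredT u (fun j => Csin (Cpi R * B j)) (fun j => Gamma (B j + (- kap)%:~R + 0)).
  have e2 := @prod_divM R r (fun j => 1 < j)%N (- u) (fun j => Csin (Cpi R * A j)) (fun j => Gamma (A j + (-1 - kap)%:~R + 0)).
  cbv beta in e1, e2; rewrite e1 e2; move: (\prod_(j < r) u) (\prod_(j < r | _) - u) => a a'.
  move: (\prod_(j < r) Csin (Cpi R * B j)) (\prod_(j < r | (1 < j)%N) Csin (Cpi R * A j)) => b b'.
  move: (\prod_(j < r) Gamma (B j + (- kap)%:~R + 0))
    (\prod_(j < r | (1 < j)%N) Gamma (A j + (-1 - kap)%:~R + 0)) => g g'.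
  by rewrite !invfM !invrK; move: (a'^-1) (b^-1) (g^-1) => x1 x2 x3; ring.
have u0 : u != 0.
  apply/eqP => u0; have := uu; rewrite u0 mulr0 => /esym/eqP.
  by rewrite sqrf_eq0; apply/negP; exact: Cpi_neq0.
have -> : \prod_(j < r) u / \prod_(j < r | (1 < j)%N) - u = (-1) ^+ r * Cpi R ^+ 2.
  have e1 : \prod_(j < r | (1 < j)%N) - u = \prod_(j < r | (1 < j)%N) -1 * \prod_(j < r | (1 < j)%N) u.
    by rewrite -big_split/=; apply: eq_bigr => j _; rewrite mulN1r.
  have e2 : (-1) ^+ r = \prod_(j < r | (1 < j)%N) -1 :> C.
    have := @prod_split01 R r (fun=> -1) r1; rewrite prodr_const card_ord => ->.
    by rewrite mulrNN mulr1 mul1r.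
  rewrite (@prod_split01 _ r (fun=> u))// e1 -e2 uu.
  have pu : \prod_(j < r | (1 < j)%N) u != 0 by apply/prodf_neq0.
  have ss : ((-1) ^+ r : C)^-1 = (-1) ^+ r by rewrite -exprVn invrN1.
  rewrite invfM ss; move: (\prod_(j < r | _) u) pu => w w0.
  by field.
rewrite /Ksin /gW /Qc !prodf_div.
have -> : \prod_(j < r) Gamma (B j + (m j - n 1%N)%:~R + q%:~R) = \prod_(j < r) Gamma (B j + (m j + q - n 1%N)%:~R + 0).
  by apply: eq_bigr => j _; rewrite !(intrB, intrD); congr Gamma; ring.
have -> : \prod_(j < r | (1 < j)%N) Gamma (A j + (n j - n 1%N)%:~R + q%:~R) = \prod_(j < r | (1 < j)%N) Gamma (A j + (n j + q - n 1%N)%:~R + 0).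
  by apply: eq_bigr => j _; rewrite !(intrB, intrD); congr Gamma; ring.
by ring.
Qed.

(** Reflecting the digammas of [Pd] gives those of [gWd]; the cotangents left over have period 1 in
    A and B, so the discrepancy depends neither on kap nor on q. *)
Lemma gWd_cot (kap q : int) : Qd q - Pd kap = gWd r A B n m kap q + Cpi R * Cotd.
Proof.
rewrite /Qd /Pd /gWd /Cotd !sumrB.
have -> : \sum_(j < r) psi (B j + (m j - n 1%N)%:~R + q%:~R) = \sum_(j < r) psi (B j + (m j + q - n 1%N)%:~R).
  by apply: eq_bigr => j _; rewrite !(intrB, intrD); congr psi; ring.
have -> : \sum_(j < r | (1 < j)%N) psi (A j + (n j - n 1%N)%:~R + q%:~R) = \sum_(j < r | (1 < j)%N) psi (A j + (n j + q - n 1%N)%:~R).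
  by apply: eq_bigr => j _; rewrite !(intrB, intrD); congr psi; ring.
have ccot x (k : int) : Ccot (Cpi R * (x + k%:~R)) = Ccot (Cpi R * x) :> C.
  have hk : ((-1) ^ k : C) != 0 by rewrite -unitfE unitrE signzV signzM.
  by rewrite /Ccot Ccos_pi_shift Csin_pi_shift invfM mulrACA divff// mul1r.
have hB : \sum_(j < r) psi (1 - B j + kap%:~R) = \sum_(j < r) psi (B j + (- kap)%:~R)
    + Cpi R * \sum_(j < r) Ccot (Cpi R * B j).
  rewrite mulr_sumr -big_split/=; apply: eq_bigr => j _.
  have xi := @nonint_int _ _ (- kap) (B_nonint (ltn_ord j)).
  have := psi_reflection xi; rewrite ccot => <-.
  by rewrite addrC subrK; congr psi; rewrite rmorphN/=; ring.
have hA : \sum_(j < r | (1 < j)%N) psi (2 - A j + kap%:~R) = \sum_(j < r | (1 < j)%N) psi (A j + (- 1 - kap)%:~R)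
    + Cpi R * \sum_(j < r | (1 < j)%N) Ccot (Cpi R * A j).
  rewrite mulr_sumr -big_split/=; apply: eq_bigr => j j1.
  have jr : (1 < j < r)%N by rewrite j1/=.
  have xi := @nonint_int _ _ (- 1 - kap) (A_nonint jr).
  have := psi_reflection xi; rewrite ccot => <-.
  by rewrite addrC subrK; congr psi; rewrite intrB; ring.
by rewrite hA hB; ring.
Qed.

(** The coefficient form of the theorem. X Y' - X' Y is the difference of index derivatives
    described by [Ulim], except that [Qd - Pd] replaces [gWd]; the difference yields the cotangent
    term. *)
Lemma XY_Ulim (kap q : int) :
  Xf kap * (Yd1 q + Yd2 q) - (Xd1 kap + Xd2 kap) * Yf q =
  (-1) ^ (r%:Z + p) * Cpi R ^+ 2 * Ksin * Ulim r p A B n m kap q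
  + Cpi R * Cotd * (Xf kap * Yf q).
Proof.
have PQ := PQ_gW kap q; have gc := gWd_cot kap q.
have -> : (-1) ^ (r%:Z + p) * Cpi R ^+ 2 * Ksin * Ulim r p A B n m kap q
  = ((-1) ^ p * (-1) ^ p) * ((-1) ^+ r * Cpi R ^+ 2 * Ksin * gW r A B n m kap q 0) *
  (rho kap%:~R * rho (kap - p)%:~R
     * (rhod q%:~R * rho (q + s)%:~R + rho q%:~R * rhod (q + s)%:~R)
   - (rhod kap%:~R * rho (kap - p)%:~R + rho kap%:~R * rhod (kap - p)%:~R)
     * (rho q%:~R * rho (q + s)%:~R)
   + rho kap%:~R * rho (kap - p)%:~R * rho q%:~R * rho (q + s)%:~R * gWd r A B n m kap q).
  rewrite /Ulim signzD -exprnP -/s; set w := _ + _ * gWd _ _ _ _ _ _ _; move: w => w.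
  by ring.
rewrite signzM mul1r -PQ.
have -> : gWd r A B n m kap q = Qd q - Pd kap - Cpi R * Cotd by rewrite gc; ring.
rewrite /Xf /Yf /Xd1 /Xd2 /Yd1 /Yd2.
move: (Pc kap) (Qc q) (Pd kap) (Qd q) (Cpi R * Cotd) (rho kap%:~R) (rho q%:~R)
  (rho (kap - p)%:~R) (rho (q + s)%:~R) (rhod kap%:~R) (rhod q%:~R) (rhod (kap - p)%:~R) (rhod (q + s)%:~R).
by move=> *; ring.
Qed.

End Coefficients.

(** * The series of the Frobenius solutions *)

Section ConfluentSums.
Variable R : realType.
Local Notation C := (CC R).
Variables (r : nat) (p : int) (A B : nat -> C) (n m : nat -> int).
Hypothesis r1 : (1 < r)%N.
Hypothesis A_nonint : forall j : nat, (1 < j < r)%N -> ~ is_integer (A j).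
Hypothesis B_nonint : forall j : nat, (j < r)%N -> ~ is_integer (B j).
Variable z : C.
Hypotheses (z0 : z != 0) (z1 : nrm z < 1).
Variables (K K' : nat).
Let s : int := p + n 0%N - n 1%N.
Hypotheses (pK : `|p| <= K%:Z) (sK : `|s| <= K'%:Z).

Definition psum (a : nat -> C) : C := limn (series (fun k => a k * z ^+ k)).

Lemma psum_gsum a : subexp a -> gsum (fun k => a k * z ^+ k) (psum a).
Proof. by move=> /(subexp_gsum z0 z1)[S hS]; rewrite /psum (gsum_lim hS). Qed.

Let x1_nonpole j k : (j < r)%N -> nonpole (1 - B j + k%:~R).
Proof.
move=> jr; apply: nonint_nonpole; have := @nonint_opp_int _ _ (1 + k) (B_nonint jr).
by have -> : (1 + k)%:~R - B j = 1 - B j + k%:~R by rewrite intrD; ring.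
Qed.

Let y1_nonpole j k : (1 < j < r)%N -> nonpole (2 - A j + k%:~R).
Proof.
move=> jr; apply: nonint_nonpole; have := @nonint_opp_int _ _ (2 + k) (A_nonint jr).
by have -> : (2 + k)%:~R - A j = 2 - A j + k%:~R by rewrite intrD; ring.
Qed.

Let x2_nonpole j k : (j < r)%N -> nonpole (B j + k%:~R).
Proof. by move=> jr; apply: nonint_nonpole; apply: nonint_int; exact: B_nonint. Qed.

Let y2_nonpole j k : (1 < j < r)%N -> nonpole (A j + k%:~R).
Proof. by move=> jr; apply: nonint_nonpole; apply: nonint_int; exact: A_nonint. Qed.

Lemma PcE (a : int) (k : nat) : Pc r A B (a + k%:Z) =
  hratio r (fun j => 1 - B j + a%:~R) (fun j => 2 - A j + a%:~R) k.
Proof.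
by rewrite /Pc /hratio; congr (_ / _); apply: eq_bigr => j _; rewrite intrD addrA -pmulrn.
Qed.

Lemma QcE (a : int) (k : nat) : Qc r A B n m (a + k%:Z) =
  hratio r (fun j => B j + (m j - n 1%N)%:~R + a%:~R) (fun j => A j + (n j - n 1%N)%:~R + a%:~R) k.
Proof.
by rewrite /Qc /hratio; congr (_ / _); apply: eq_bigr => j _; rewrite (intrD _ a) addrA -pmulrn.
Qed.

Lemma rhoE (a : int) (k : nat) : rho (a + k%:Z)%:~R = (Gamma (1 + a%:~R + k%:R : C))^-1.
Proof. by rewrite /rho intrD addrA -pmulrn. Qed.

Lemma rhodE (a : int) (k : nat) : rhod (a + k%:Z)%:~R = - psi_div_Gamma (1 + a%:~R + k%:R : C).
Proof. by rewrite /rhod intrD addrA -pmulrn. Qed.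

Lemma rho_natz (k : nat) : rho (k%:Z)%:~R = (k`!%:R : C)^-1.
Proof. by rewrite -pmulrn rho_nat. Qed.

Lemma subexp_rho (a : int) : subexp (fun k => rho (a + k%:Z)%:~R * k`!%:R : C).
Proof. by apply: subexp_ext (@subexp_invGamma _ (1 + a%:~R)) => k; rewrite rhoE mulrC. Qed.

Lemma subexp_rhod (a : int) : subexp (fun k => rhod (a + k%:Z)%:~R * k`!%:R : C).
Proof.
apply: subexp_ext (subexpM (subexp_cst (-1)) (@subexp_psi_div_Gamma _ (1 + a%:~R))) => k.
by rewrite rhodE; ring.
Qed.

Lemma subexpB (a b : nat -> C) : subexp a -> subexp b -> subexp (fun k => a k - b k).
Proof.
move=> ha hb; apply: subexp_ext (subexpD ha (subexpM (subexp_cst (-1)) hb)) => k.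
by rewrite mulN1r.
Qed.

Lemma subexp_Pd : subexp (fun k => Pd r A B k%:Z).
Proof.
apply: subexpB.
  have := @subexp_big_sum _ r xpredT (fun j k => psi (1 - B j + k%:R)); apply => j jr _.
  by have := x1_nonpole 0 jr; rewrite addr0 => /subexp_psi.
have := @subexp_big_sum _ r (fun j => 1 < j)%N (fun j k => psi (2 - A j + k%:R)); apply => j jr j1.
have jr1 : (1 < j < r)%N by rewrite j1.
by have := y1_nonpole 0 jr1; rewrite addr0 => /subexp_psi.
Qed.

Lemma subexp_Qd : subexp (fun k => Qd r A B n m k%:Z).
Proof.
apply: subexpB.
  have := @subexp_big_sum _ r xpredT (fun j k => psi (B j + (m j - n 1%N)%:~R + k%:R)); apply => j jr _.
  by have := x2_nonpole (m j - n 1%N) jr => /subexp_psi.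
have := @subexp_big_sum _ r (fun j => 1 < j)%N (fun j k => psi (A j + (n j - n 1%N)%:~R + k%:R)); apply => j jr j1.
have jr1 : (1 < j < r)%N by rewrite j1.
by have := y2_nonpole (n j - n 1%N) jr1 => /subexp_psi.
Qed.

Lemma subexp_Pt (a : int) (t : nat -> C) : subexp (fun k => t k * k`!%:R) ->
  subexp (fun k => Pc r A B (a + k%:Z) * t k / k`!%:R).
Proof.
move=> ts; apply: subexp_ext (@subexp_hratio _ r (fun j => 1 - B j + a%:~R) (fun j => 2 - A j + a%:~R) t r1 _ ts); last first.
  by move=> j jr; exact: (x1_nonpole a jr).
by move=> k; rewrite PcE.
Qed.

Lemma subexp_Qt (a : int) (t : nat -> C) : subexp (fun k => t k * k`!%:R) ->
  subexp (fun k => Qc r A B n m (a + k%:Z) * t k / k`!%:R).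
Proof.
move=> ts; apply: subexp_ext (@subexp_hratio _ r (fun j => B j + (m j - n 1%N)%:~R + a%:~R)
  (fun j => A j + (n j - n 1%N)%:~R + a%:~R) t r1 _ ts); last first.
  by move=> j jr; rewrite -addrA -intrD; exact: x2_nonpole.
by move=> k; rewrite QcE.
Qed.

Lemma subexp_Xf : subexp (fun k => Xf r p A B (p + k%:Z)).
Proof.
apply: subexp_ext (subexp_Pt p (subexp_rho p)) => k.
by rewrite /Xf [p + _ - p]addrAC subrr add0r rho_natz mulrA.
Qed.

Lemma subexp_Xd1 : subexp (fun k => Xd1 r p A B (p + k%:Z)).
Proof.
apply: subexp_ext (subexp_Pt p (subexp_rhod p)) => k.
by rewrite /Xd1 [p + _ - p]addrAC subrr add0r rho_natz mulrA.
Qed.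

Lemma subexp_Xd2 : subexp (fun k => Xd2 r p A B k%:Z).
Proof.
have h : subexp (fun k => (rhod (- p + k%:Z)%:~R + rho (- p + k%:Z)%:~R * Pd r A B k%:Z) * k`!%:R : C).
  apply: subexp_ext (subexpD (subexp_rhod (- p)) (subexpM (subexp_rho (- p)) subexp_Pd)) => k.
  by rewrite mulrDl; congr (_ + _); rewrite mulrAC.
apply: subexp_ext (subexp_Pt 0 h) => k.
by rewrite /Xd2 add0r rho_natz [k%:Z - p]addrC; ring.
Qed.

Lemma subexp_Yf : subexp (fun k => Yf r p A B n m k%:Z).
Proof.
apply: subexp_ext (subexp_Qt 0 (subexp_rho s)) => k.
by rewrite /Yf -/s add0r rho_natz [k%:Z + s]addrC; ring.
Qed.

Lemma subexp_Yd1 : subexp (fun k => Yd1 r p A B n m k%:Z).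
Proof.
have h : subexp (fun k => (rhod (s + k%:Z)%:~R + rho (s + k%:Z)%:~R * Qd r A B n m k%:Z) * k`!%:R : C).
  apply: subexp_ext (subexpD (subexp_rhod s) (subexpM (subexp_rho s) subexp_Qd)) => k.
  by rewrite mulrDl; congr (_ + _); rewrite mulrAC.
apply: subexp_ext (subexp_Qt 0 h) => k.
by rewrite /Yd1 -/s add0r rho_natz [k%:Z + s]addrC; ring.
Qed.

Lemma subexp_Yd2 : subexp (fun k => Yd2 r p A B n m (- s + k%:Z)).
Proof.
apply: subexp_ext (subexp_Qt (- s) (subexp_rhod (- s))) => k.
by rewrite /Yd2 -/s [- s + _ + s]addrAC addNr add0r rho_natz mulrA.
Qed.

Definition SXf := psum (fun k => Xf r p A B (p + k%:Z)).
Definition SXd1 := psum (fun k => Xd1 r p A B (p + k%:Z)).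
Definition SXd2 := psum (fun k => Xd2 r p A B k%:Z).
Definition SYf := psum (fun k => Yf r p A B n m k%:Z).
Definition SYd1 := psum (fun k => Yd1 r p A B n m k%:Z).
Definition SYd2 := psum (fun k => Yd2 r p A B n m (- s + k%:Z)).

Let subexp0 (f : int -> C) : subexp (fun k => f k%:Z) -> subexp (fun k => f (0 + k%:Z)).
Proof. by apply: subexp_ext => k; rewrite add0r. Qed.

Lemma lsum_psum (a : int) (L : nat) (f : int -> C) : (forall i, i < a -> f i = 0) ->
  - a <= L%:Z -> subexp (fun k => f (a + k%:Z)) ->
  has_lsum z L f (z ^ a * psum (fun k => f (a + k%:Z))).
Proof. by move=> fa aL /psum_gsum h; exact: lsum_from. Qed.

Lemma lsum_psum0 (L : nat) (f : int -> C) : (forall i, i < 0 -> f i = 0) ->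
  subexp (fun k => f k%:Z) -> has_lsum z L f (psum (fun k => f k%:Z)).
Proof.
move=> fa fs; have := @lsum_psum 0 L f fa _ (subexp0 fs).
have -> : (fun k => f (0 + k%:Z)) = (fun k => f k%:Z) by apply/funext => k; rewrite add0r.
by rewrite expr0z mul1r; apply; rewrite oppr0.
Qed.

Let pmK : - p <= K%:Z. Proof. by lia. Qed.
Let smK : - - s <= K'%:Z. Proof. by lia. Qed.

Lemma lsum_Xf : has_lsum z K (Xf r p A B) (z ^ p * SXf).
Proof.
apply: lsum_psum => // [i ip|]; last exact: subexp_Xf.
by rewrite /Xf (@rho_neg _ (i - p)) ?mulr0// subr_lt0.
Qed.

(** The derivative is kept in two parts because they start at different exponents, p and 0; these
    are the z^p part and the other part of the first Psi series. *)
Lemma lsum_Xd : has_lsum z K (fun k => Xd1 r p A B k + Xd2 r p A B k) (z ^ p * SXd1 + SXd2).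
Proof.
apply: lsumD.
  apply: lsum_psum => // [i ip|]; last exact: subexp_Xd1.
  by rewrite /Xd1 (@rho_neg _ (i - p)) ?mulr0// subr_lt0.
apply: lsum_psum0 => [i i0|]; last exact: subexp_Xd2.
by rewrite /Xd2 (@rho_neg _ i) ?mul0r ?mulr0.
Qed.

Lemma lsum_Yf : has_lsum z K' (Yf r p A B n m) SYf.
Proof.
apply: lsum_psum0 => [i i0|]; last exact: subexp_Yf.
by rewrite /Yf (@rho_neg _ i) ?mul0r ?mulr0.
Qed.

Lemma lsum_Yd : has_lsum z K' (fun k => Yd1 r p A B n m k + Yd2 r p A B n m k)
  (SYd1 + z ^ (- s) * SYd2).
Proof.
apply: lsumD.
  apply: lsum_psum0 => [i i0|]; last exact: subexp_Yd1.
  by rewrite /Yd1 (@rho_neg _ i) ?mul0r ?mulr0.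
apply: lsum_psum => // [i ip|]; last exact: subexp_Yd2.
by rewrite /Yd2 (@rho_neg _ (i + _)) ?mulr0//; move: ip; rewrite /s; lia.
Qed.

Definition Ksgn : C := (-1) ^ (r%:Z + p) * Cpi R ^+ 2 * Ksin r A B.

Lemma Ksgn_neq0 : Ksgn != 0.
Proof.
rewrite /Ksgn /Ksin !mulf_neq0 ?invr_eq0 ?expf_neq0 ?Cpi_neq0//.
- by rewrite -unitfE unitrE signzV signzM.
- by apply/prodf_neq0 => j j1; apply: Csin_pi_neq0; apply: A_nonint; rewrite j1/=.
- by apply/prodf_neq0 => j _; apply: Csin_pi_neq0; exact: B_nonint.
Qed.

(** [SU] is found by solving the identity for it, as [Ksgn] is nonzero. [XY_Ulim] then shows that
    its coefficients are the convolutions of [Ulim], so its convergence comes from that of the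
    products of X, Y and their derivatives. *)
Lemma confluent_sum : exists SU : C,
  has_lsum z (K + K')%N (conv2 K K' (Ulim r p A B n m)) SU /\
  z ^ p * SXf * (SYd1 + z ^ (- s) * SYd2) - (z ^ p * SXd1 + SXd2) * SYf =
  Ksgn * SU + Cpi R * Cotd r A B * (z ^ p * SXf * SYf).
Proof.
have h1 := lsumM z0 lsum_Xf lsum_Yd; have h2 := lsumM z0 lsum_Xd lsum_Yf.
have h3 := lsumM z0 lsum_Xf lsum_Yf.
set T1 := z ^ p * SXf * _ in h1 *; set T2 := (_ + SXd2) * _ in h2 *; set T3 := z ^ p * SXf * _ in h3 *.
exists (Ksgn^-1 * (T1 - T2 - Cpi R * Cotd r A B * T3)); split; last first.
  by rewrite mulVKf ?Ksgn_neq0// subrK.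
apply: lsum_ext (lsumZ Ksgn^-1 (lsumB (lsumB h1 h2) (lsumZ (Cpi R * Cotd r A B) h3))) => l.
apply: (mulfI Ksgn_neq0); rewrite mulVKf ?Ksgn_neq0//.
rewrite !conv_conv2; set c1 := conv2 _ _ _ _; set c2 := conv2 _ _ _ _.
have -> : c1 = c2 + conv2 K K' (fun a b => Ksgn * Ulim r p A B n m a b) l
    + conv2 K K' (fun a b => Cpi R * Cotd r A B * (Xf r p A B a * Yf r p A B n m b)) l.
  rewrite -!conv2D; apply: conv2_ext => a b.
  have := @XY_Ulim R r p A B n m r1 A_nonint B_nonint a b; rewrite -/Ksgn => h.
  by rewrite -addrA -h addrC subrK.
by rewrite !conv2Z; ring.
Qed.

End ConfluentSums.

Section LaurentExtra.
Variable R : realType.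
Local Notation C := (CC R).
Variable z : C.
Hypothesis z0 : z != 0.

Lemma lsum0 (L : nat) : has_lsum z L (fun=> 0) 0.
Proof.
split=> //; have := @gsum_fin R (fun=> 0) 0 (fun _ _ => erefl); rewrite big_ord0.
by apply: gsum_ext => k; rewrite mul0r.
Qed.

Lemma lsum_big (L r : nat) (P : pred nat) (f : nat -> int -> C) (S : nat -> C) :
  (forall j, (j < r)%N -> P j -> has_lsum z L (f j) (S j)) ->
  has_lsum z L (fun l => \sum_(j < r | P j) f j l) (\sum_(j < r | P j) S j).
Proof.
move=> h; elim: r h => [|r IH] h.
  rewrite big_ord0; apply: lsum_ext (lsum0 L) => l; by rewrite big_ord0.
have IH' := IH (fun j jr => h j (ltnW jr)).
rewrite big_mkcond big_ord_recr/= -big_mkcond/=.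
case Pr : (P r).
  apply: lsum_ext (lsumD IH' (h r (ltnSn r) Pr)) => l.
  by rewrite [RHS]big_mkcond big_ord_recr/= Pr -big_mkcond.
rewrite addr0; apply: lsum_ext IH' => l.
by rewrite [RHS]big_mkcond big_ord_recr/= Pr -big_mkcond addr0.
Qed.

Lemma lsum_zrange (L : nat) (f : int -> C) (a b : int) : - a <= L%:Z ->
  (forall i, i < a -> f i = 0) -> (forall i, b < i -> f i = 0) ->
  has_lsum z L f (\sum_(j <- zrange a b) f j * z ^ j).
Proof.
move=> aL fa fb; pose N := if a <= b then (absz (b - a)).+1 else 0%N.
have hN k : (N <= k)%N -> f (a + k%:Z) * z ^+ k = 0.
  by rewrite /N => Nk; rewrite fb ?mul0r//; move: Nk; case: ifP => ab; lia.
have := lsum_from z0 fa aL (gsum_fin hN).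
congr has_lsum; rewrite mulr_sumr /zrange /N; case: ifP => ab; last by rewrite big_ord0 big_nil.
rewrite big_map -[iota 0 _]/(index_iota 0 (absz (b - a)).+1) big_mkord; apply: eq_bigr => k _.
by rewrite expfzDr// -exprnP mulrCA.
Qed.

Lemma sum_ord_ext (N M : nat) (f : nat -> C) : (forall k, (minn N M <= k)%N -> f k = 0) ->
  \sum_(k < N) f k = \sum_(k < M) f k.
Proof.
wlog NM : N M / (N <= M)%N => [h h0|].
  by case: (leqP N M) => NM; [exact: h|apply/esym; apply: h; [exact: ltnW|rewrite minnC]].
move=> h; rewrite -!(big_mkord xpredT f) [RHS](big_cat_nat (n := N))//=.
rewrite [X in _ = _ + X]big1_seq ?addr0// => k /andP[_]; rewrite mem_index_iota => /andP[Nk _].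
by apply: h; rewrite (minn_idPl NM).
Qed.

(** Multiplication by the polynomial (1 - z)^E, seen as a Laurent product; reducing to supports
    makes the convolution range agree with that of the binomials. *)
Lemma lsum_binomial (L E : nat) (f : int -> C) S : has_lsum z L f S ->
  has_lsum z L (fun J => \sum_(t < E.+1) 'C(E, t)%:R * (-1) ^+ t * f (J - t%:Z)) ((1 - z) ^+ E * S).
Proof.
move=> fS; pose b t : C := 'C(E, t)%:R * (-1) ^+ t.
have hb : has_lsum z 0 (of_ps b) ((1 - z) ^+ E).
  apply: lsum_ps; rewrite exprBn.
  have := @gsum_fin R (fun k => b k * z ^+ k) E.+1.
  rewrite (eq_bigr (fun i : 'I_E.+1 => (-1) ^+ i * 1 ^+ (E - i) * z ^+ i *+ 'C(E, i))).
    apply=> t Et; by rewrite /b bin_small// !mul0r.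
  by move=> i _; rewrite /b expr1n mulr1 -[RHS]mulr_natl mulrA.
have [f0 _] := fS.
apply: lsum_ext (lsumM z0 hb fS) => J; rewrite conv_conv2.
rewrite (@conv2_supp _ 0 L 0 (- L%:Z)) ?oppr0//; last first.
  move=> a c [a0|c0]; last by rewrite f0 ?mulr0.
  by case: a a0 => //= a _; rewrite mul0r.
have -> : J - 0 - - L%:Z = J + L%:Z by ring.
case e : (J + L%:Z) => [N|N].
  rewrite (eq_bigr (fun k : 'I_N.+1 => b k * f (J - k%:Z))); last by move=> k _; rewrite add0r.
  apply: (@sum_ord_ext _ _ (fun k => b k * f (J - k%:Z))) => k.
  rewrite geq_min => /orP[Nk|Ek]; first by rewrite f0 ?mulr0//; lia.
  by rewrite /b bin_small// !mul0r.
by rewrite big1// => t _; rewrite f0 ?mulr0//; lia.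
Qed.

End LaurentExtra.

(** * The Laurent series of the regular terms *)

Section V3Sum.
Variable R : realType.
Local Notation C := (CC R).
Variables (r : nat) (al be : nat -> C) (n m : nat -> int) (i : nat).
Variable z : C.
Hypotheses (z0 : z != 0) (z1 : nrm z < 1).
Hypothesis ir : (i < r)%N.
Hypothesis al_nonint : forall j : nat, (j < r)%N -> j != i -> ~ is_integer (al i - al j).

Lemma subexp_rise_ratio (x y : nat -> C) :
  (forall j, (j < r)%N -> j != i -> nonpole (y j)) ->
  subexp (fun k => \prod_(j < r) rise (x j) k / \prod_(j < r | (j : nat) != i) rise (y j) k / k`!%:R).
Proof.
move=> yi.
have h1 := @subexp_big_prod _ r xpredT (fun j k => rise (x j) k / k`!%:R)
  (fun j jr _ => subexp_rise (x j)).
have h2 := @subexp_big_prod _ r (fun j => j != i) (fun j k => k`!%:R / rise (y j) k)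
  (fun j jr ji => subexp_inv_rise (yi j jr ji)).
apply: subexp_ext (subexpM h1 h2) => k.
rewrite !prodf_div; cbv beta.
have -> : \prod_(j < r) k`!%:R = k`!%:R * \prod_(j < r | (j : nat) != i) k`!%:R :> C.
  by rewrite (bigD1 (Ordinal ir))//=; congr (_ * _); apply: eq_bigl => j; rewrite -val_eqE.
have f0 := fact_neq0 R k.
have f1 : \prod_(j < r | (j : nat) != i) k`!%:R != 0 :> C by apply/prodf_neq0.
move: (\prod_(j < r) rise (x j) k) (\prod_(j < r | (j : nat) != i) rise (y j) k) => a b.
move: (k`!%:R : C) f0 (\prod_(j < r | (j : nat) != i) k`!%:R) f1 => d d0 c c0.
by move: (b^-1) => b'; field; rewrite c0 d0.
Qed.

Lemma subexp_VF : subexp (VF r al be i).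
Proof.
apply: (@subexp_rise_ratio (fun j => be j - al i) (fun j => al j + (1 - al i))) => j jr ji; apply: nonint_nonpole.
have := @nonint_opp_int _ _ 1 (al_nonint jr ji).
by have -> : 1%:~R - (al i - al j) = al j + (1 - al i) by ring.
Qed.

Lemma subexp_VG : subexp (VG r al be n m i).
Proof.
apply: (@subexp_rise_ratio (fun j => 1 + al i - be j + (m j - n i)%:~R)
  (fun j => 1 + al i - al j + (n j - n i)%:~R)) => j jr ji; apply: nonint_nonpole.
have := @nonint_int _ _ (1 + (n j - n i)) (al_nonint jr ji).
by have -> : al i - al j + (1 + (n j - n i))%:~R = 1 + al i - al j + (n j - n i)%:~R by rewrite (intrD _ 1); ring.
Qed.

Lemma VT_lsum (L : nat) : n i <= L%:Z ->
  has_lsum z L (VT r al be n m i)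
   (z ^ (- n i) * (VC r al be n m i * (psum z (VF r al be i) * psum z (VG r al be n m i)))).
Proof.
move=> niL.
have h := gsumM (psum_gsum z0 z1 subexp_VF) (psum_gsum z0 z1 subexp_VG).
have h' : gsum (fun k => (VC r al be n m i * \sum_(u < k.+1) VF r al be i u * VG r al be n m i (k - u)) * z ^+ k)
    (VC r al be n m i * (psum z (VF r al be i) * psum z (VG r al be n m i))).
  apply: gsum_ext (gsumZ (VC r al be n m i) h) => k.
  rewrite -mulrA; congr (_ * _); rewrite /cauchy mulr_suml; apply: eq_bigr => u _.
  by rewrite mulrACA -exprD subnKC// -ltnS.
apply: lsum_ext (lsum_shift (j := - n i) (K' := L) z0 (lsum_ps h') _) => [l|]; last by rewrite opprK add0r.
by rewrite /VT opprK addrC; case: (n i + l).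
Qed.

End V3Sum.

Section V3E.
Variable R : realType.
Local Notation C := (CC R).
Variables (r : nat) (alpha beta : seq C) (n m : seq int).
Hypotheses (sa : size alpha = r) (sb : size beta = r) (sn : size n = r) (sm : size m = r).
Variable z : C.
Let al := nth 0 alpha.
Let be := nth 0 beta.
Let nn := nth 0 n.
Let mm := nth 0 m.

Lemma V3_sum : V3 alpha beta n m z = \sum_(i < r | (1 < i)%N)
  z ^ (- nn i) * (VC r al be nn mm i * (psum z (VF r al be i) * psum z (VG r al be nn mm i))).
Proof.
rewrite /V3 sa big_geq_mkord; apply: eq_bigr => i _; have ir := ltn_ord i.
rewrite -/(al i) -/(nn i).
rewrite (pochv_nth (r := r)) ?size_rsubv ?size_map//.
rewrite rem_at_rsubv -rem_at_map (pochv_rem (r := r)) ?size_rsubv ?size_map//.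
have -> : hyperF (shiftv beta (- al i)) (shiftv (rem_at i alpha) (1 - al i)) z = psum z (VF r al be i).
  congr (limn (series _)); apply/funext => k; rewrite mulrAC; congr (_ / _ / _ * _).
    rewrite (prod_seq_nth 0 _ (r := r)) ?size_shiftv//; apply: eq_bigr => j _.
    by rewrite nth_shiftv ?sb// poch_nat.
  rewrite rem_at_shiftv (prod_rem_at 0 _ (r := r)) ?size_shiftv//; apply: eq_bigr => j _.
  by rewrite nth_shiftv ?sa// poch_nat.
have -> : hyperF (addzv (rsubv (1 + al i) beta) [seq mj - nn i | mj <- m])
   (addzv (rsubv (1 + al i) (rem_at i alpha)) [seq nj - nn i | nj <- rem_at i n]) z
   = psum z (VG r al be nn mm i).
  congr (limn (series _)); apply/funext => k; rewrite mulrAC; congr (_ / _ / _ * _).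
    have sz : size (rsubv (1 + al i) beta) = size [seq mj - nn i | mj <- m] by rewrite size_rsubv size_map sb sm.
    have szr := size_addzv sz; rewrite size_rsubv sb in szr.
    rewrite (prod_seq_nth 0 _ szr); apply: eq_bigr => j _.
    by rewrite (nth_addzv sz) ?size_rsubv ?sb// nth_rsubv ?sb// (nth_map 0) ?sm// poch_nat.
  have sz : size (rsubv (1 + al i) alpha) = size [seq mj - nn i | mj <- n] by rewrite size_rsubv size_map sa sn.
  rewrite rem_at_rsubv -rem_at_map rem_at_addzv//.
  have szr := size_addzv sz; rewrite size_rsubv sa in szr.
  rewrite (prod_rem_at 0 _ szr ir); apply: eq_bigr => j _.
  by rewrite (nth_addzv sz) ?size_rsubv ?sa// nth_rsubv ?sa// (nth_map 0) ?sn// poch_nat.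
have -> : \prod_(j < r) poch (rsubv (1 + al i) beta)`_j [seq mj - nn i | mj <- m]`_j
   = \prod_(j < r) poch (1 + al i - be j) (mm j - nn i).
  by apply: eq_bigr => j _; rewrite nth_rsubv ?sb// (nth_map 0) ?sm.
have -> : \prod_(j < r | (j : nat) != i) poch (rsubv (al i) alpha)`_j [seq nj - nn i + 1 | nj <- n]`_j
   = \prod_(j < r | (j : nat) != i) poch (al i - al j) (nn j - nn i + 1).
  by apply: eq_bigr => j _; rewrite nth_rsubv ?sa// (nth_map 0) ?sn.
by rewrite /VC; ring.
Qed.

End V3E.

(** * The Psi and phi series in terms of indexed coefficients *)

Section ListTerms.
Variable R : realType.
Local Notation C := (CC R).
Variables (r : nat) (p : int) (alpha beta : seq C) (n m : seq int).
Hypotheses (sa : size alpha = r) (sb : size beta = r) (sn : size n = r) (sm : size m = r).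
Let Af j := 1 + alpha`_0 + p%:~R - alpha`_j.
Let Bf j := 1 + alpha`_0 + p%:~R - beta`_j.
Let A := rsubv (1 + alpha`_0 + p%:~R) (drop 2 alpha).
Let B := rsubv (1 + alpha`_0 + p%:~R) beta.

Lemma drop_map_nth (T : Type) (x0 : T) (s : seq T) (a : nat) :
  drop a s = [seq nth x0 s j | j <- index_iota a (size s)].
Proof.
rewrite /index_iota; have [as_|sa_] := leqP a (size s).
  by rewrite map_nth_iota ?subnKC// take_oversize// size_drop.
by rewrite drop_oversize 1?ltnW// (eqP (ltnW sa_)).
Qed.

Lemma rsubv_map (c : C) (f : nat -> C) s : rsubv c (map f s) = [seq c - f j | j <- s].
Proof. by rewrite /rsubv -map_comp. Qed.

Lemma shiftv_map (c : C) (f : nat -> C) s : shiftv (map f s) c = [seq f j + c | j <- s].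
Proof. by rewrite /shiftv -map_comp. Qed.

Lemma addzv_map (f : nat -> C) (k : nat -> int) s :
  addzv (map f s) (map k s) = [seq f j + (k j)%:~R | j <- s].
Proof. by rewrite /addzv zip_map -map_comp. Qed.

Lemma AE : A = map Af (index_iota 2 r).
Proof. by rewrite /A (drop_map_nth 0) sa rsubv_map. Qed.

Lemma BE : B = map Bf (index_iota 0 r).
Proof. by rewrite /B -[beta in LHS]drop0 (drop_map_nth 0) sb rsubv_map. Qed.

Lemma AnE : addzv A (drop 2 n) = [seq Af j + (n`_j)%:~R | j <- index_iota 2 r].
Proof. by rewrite AE (drop_map_nth 0) sn addzv_map. Qed.

Lemma BmE : addzv B m = [seq Bf j + (m`_j)%:~R | j <- index_iota 0 r].
Proof. by rewrite BE -[m in LHS]drop0 (drop_map_nth 0) sm addzv_map. Qed.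

Lemma sinv_A : sinv [seq Cpi R * a | a <- A] = \prod_(j < r | (1 < j)%N) Csin (Cpi R * Af j).
Proof. by rewrite AE -map_comp /sinv big_map big_geq_mkord. Qed.

Lemma sinv_B : sinv [seq Cpi R * a | a <- B] = \prod_(j < r) Csin (Cpi R * Bf j).
Proof. by rewrite BE -map_comp /sinv big_map big_mkord. Qed.

Lemma cot_A : \sum_(a <- A) Ccot (Cpi R * a) = \sum_(j < r | (1 < j)%N) Ccot (Cpi R * Af j).
Proof. by rewrite AE big_map big_geq_mkord. Qed.

Lemma cot_B : \sum_(a <- B) Ccot (Cpi R * a) = \sum_(j < r) Ccot (Cpi R * Bf j).
Proof. by rewrite BE big_map big_mkord. Qed.

Let s : int := p + n`_0 - n`_1.

Let numX (k : nat) (c : C) (a : int) : c = 1 + (a + k%:Z)%:~R ->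
  Gammav (rsubv c B) = \prod_(j < r) Gamma (1 - Bf j + (a + k%:Z)%:~R).
Proof.
move=> ->; rewrite BE rsubv_map /Gammav big_map big_mkord; apply: eq_bigr => j _.
by congr Gamma; ring.
Qed.

Let denX (k : nat) (c : C) (a : int) : c = 2 + (a + k%:Z)%:~R ->
  Gammav (rsubv c A) = \prod_(j < r | (1 < j)%N) Gamma (2 - Af j + (a + k%:Z)%:~R).
Proof.
move=> ->; rewrite AE rsubv_map /Gammav big_map big_geq_mkord; apply: eq_bigr => j _.
by congr Gamma; ring.
Qed.

Let numY (c : C) (q : int) : c = (q - n`_1)%:~R ->
  Gammav (shiftv (addzv B m) c) = \prod_(j < r) Gamma (Bf j + (m`_j - n`_1)%:~R + q%:~R).
Proof.
move=> ->; rewrite BmE shiftv_map /Gammav big_map big_mkord; apply: eq_bigr => j _.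
by congr Gamma; rewrite !intrB; ring.
Qed.

Let denY (c : C) (q : int) : c = (q - n`_1)%:~R ->
  Gammav (shiftv (addzv A (drop 2 n)) c) =
  \prod_(j < r | (1 < j)%N) Gamma (Af j + (n`_j - n`_1)%:~R + q%:~R).
Proof.
move=> ->; rewrite AnE shiftv_map /Gammav big_map big_geq_mkord; apply: eq_bigr => j _.
by congr Gamma; rewrite !intrB; ring.
Qed.

(** The sign, here and in the next lemmas, is that of [rhod], which is minus psi/Gamma; the braces
    of [Psi3] carry the opposite sign already. *)
Lemma Psi1E k : Psi1 p A B k = - Xd1 r p Af Bf (p + k%:Z).
Proof.
rewrite /Psi1 (@numX k _ p); last by rewrite intrD -pmulrn addrA.
rewrite (@denX k _ p); last by rewrite intrD -pmulrn addrA.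
rewrite /Xd1 rhodE [p + _ - p]addrAC subrr add0r rho_natz /Pc invfM.
set a := \prod_(j < r) _; set b := \prod_(j < r | _) _.
by move: a (b^-1) (k`!%:R^-1) (psi_div_Gamma _) => *; ring.
Qed.

Lemma Psi2E k : Psi2 p A B k = - Xd2 r p Af Bf k%:Z.
Proof.
rewrite /Psi2 (@numX k _ 0); last by rewrite add0r -pmulrn.
rewrite (@denX k _ 0); last by rewrite add0r -pmulrn.
have -> : psiv (rsubv (1 + k%:R) B) = \sum_(j < r) psi (1 - Bf j + k%:R).
  rewrite BE rsubv_map /psiv big_map big_mkord; apply: eq_bigr => j _.
  by congr psi; ring.
have -> : psiv (rsubv (2 + k%:R) A) = \sum_(j < r | (1 < j)%N) psi (2 - Af j + k%:R).
  rewrite AE rsubv_map /psiv big_map big_geq_mkord; apply: eq_bigr => j _.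
  by congr psi; ring.
rewrite /Xd2 [k%:Z - p]addrC rhodE rhoE rho_natz rmorphN /Pc add0r invfM /Pd.
rewrite -!pmulrn.
set a := \prod_(j < r) _; set b := \prod_(j < r | _) _.
set c := \sum_(j < r) _; set d := \sum_(j < r | _) _.
by move: a (b^-1) c d (k`!%:R^-1) (psi_div_Gamma _) ((Gamma _)^-1) => *; ring.
Qed.

Lemma Psi3E k : Psi3 p A B n m k = Yd1 r p Af Bf (nth 0 n) (nth 0 m) k%:Z.
Proof.
have kE : k%:R - (n`_1)%:~R = (k%:Z - n`_1)%:~R :> C by rewrite intrB -pmulrn.
rewrite /Psi3 (numY kE) (denY kE) kE.
have -> : psiv (shiftv (addzv B m) (k%:Z - n`_1)%:~R) = \sum_(j < r) psi (Bf j + (m`_j - n`_1)%:~R + (k%:Z)%:~R).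
  rewrite BmE shiftv_map /psiv big_map big_mkord; apply: eq_bigr => j _.
  by congr psi; rewrite !intrB; ring.
have -> : psiv (shiftv (addzv A (drop 2 n)) (k%:Z - n`_1)%:~R) =
    \sum_(j < r | (1 < j)%N) psi (Af j + (n`_j - n`_1)%:~R + (k%:Z)%:~R).
  rewrite AnE shiftv_map /psiv big_map big_geq_mkord; apply: eq_bigr => j _.
  by congr psi; rewrite !intrB; ring.
rewrite /Yd1 -/s [k%:Z + s]addrC rhodE rhoE rho_natz /Qc /Qd invfM.
have -> : (1 + p + n`_0 - n`_1)%:~R + k%:R = 1 + s%:~R + k%:R :> C.
  by rewrite /s !(intrB, intrD); ring.
set a := \prod_(j < r) _; set b := \prod_(j < r | _) _.
set c := \sum_(j < r) _; set d := \sum_(j < r | _) _.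
by move: a (b^-1) c d (k`!%:R^-1) (psi_div_Gamma _) ((Gamma _)^-1) => *; ring.
Qed.

(** The index starts at q = - s, where [rho (q + s)] becomes nonzero. *)
Lemma Psi4E k : Psi4 p A B n m k = - Yd2 r p Af Bf (nth 0 n) (nth 0 m) (- s + k%:Z).
Proof.
have kE : k%:R - (p + n`_0)%:~R = (- s + k%:Z - n`_1)%:~R :> C.
  by rewrite /s !(intrB, intrD, rmorphN)/= -!pmulrn; ring.
rewrite /Psi4 (numY kE) (denY kE).
have -> : (1 - p + n`_1 - n`_0)%:~R + k%:R = 1 + (- s)%:~R + k%:R :> C.
  by rewrite /s !(intrB, intrD, rmorphN)/=; ring.
rewrite /Yd2 -/s [- s + _ + s]addrAC addNr add0r rhodE rho_natz /Qc invfM.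
set a := \prod_(j < r) _; set b := \prod_(j < r | _) _.
by move: a (b^-1) (k`!%:R^-1) (psi_div_Gamma _) => *; ring.
Qed.

Lemma phi_BE z : phi (shiftv (addzv B m) (- (n`_1)%:~R))
   ((1 + p + n`_0 - n`_1)%:~R :: shiftv (addzv A (drop 2 n)) (- (n`_1)%:~R)) z =
  SYf r p Af Bf (nth 0 n) (nth 0 m) z.
Proof.
congr (limn (series _)); apply/funext => k; rewrite mulrAC; congr (_ * _).
have kE : - (n`_1)%:~R + k%:R = (k%:Z - n`_1)%:~R :> C by rewrite intrB -pmulrn addrC.
have e (v : seq C) : shiftv (shiftv v (- (n`_1)%:~R)) k%:R = shiftv v (- (n`_1)%:~R + k%:R).
  by rewrite /shiftv -map_comp; apply: eq_map => x /=; rewrite addrA.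
rewrite e (numY kE) /=; rewrite /Gammav big_cons -/(Gammav _).
rewrite e (denY kE) /Yf -/s [k%:Z + s]addrC rhoE rho_natz /Qc invfM.
have -> : (1 + p + n`_0 - n`_1)%:~R + k%:R = 1 + s%:~R + k%:R :> C.
  by rewrite /s !(intrB, intrD); ring.
set a := \prod_(j < r) _; set b := \prod_(j < r | _) _.
by move: a (b^-1) (k`!%:R^-1) ((Gamma _)^-1) => *; ring.
Qed.

Lemma phi_1BE z : phi (rsubv (1 + p%:~R) B) ((1 + p)%:~R :: rsubv (2 + p%:~R) A) z =
  SXf r p Af Bf z.
Proof.
congr (limn (series _)); apply/funext => k; rewrite mulrAC; congr (_ * _).
have e (c : C) (v : seq C) : shiftv (rsubv c v) k%:R = rsubv (c + k%:R) v.
  by rewrite /shiftv /rsubv -map_comp; apply: eq_map => x /=; rewrite addrAC.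
rewrite e (@numX k _ p); last by rewrite intrD -pmulrn addrA.
rewrite /= /Gammav big_cons -/(Gammav _).
rewrite e (@denX k _ p); last by rewrite intrD -pmulrn addrA.
rewrite /Xf [p + _ - p]addrAC subrr add0r rhoE rho_natz /Pc invfM.
have -> : (1 + p)%:~R + k%:R = 1 + p%:~R + k%:R :> C by rewrite intrD.
set a := \prod_(j < r) _; set b := \prod_(j < r | _) _.
by move: a (b^-1) (k`!%:R^-1) ((Gamma _)^-1) => *; ring.
Qed.

End ListTerms.

Theorem theorem2p1 (R : realType) (r : nat) (p : int)
    (alpha beta : r.-tuple (CC R)) (n m : r.-tuple int) (z : CC R) :
  (2 <= r)%N ->
  alpha`_1 = alpha`_0 + p%:~R ->
  (forall i j : nat, (i < j < r)%N -> (i, j) <> (0%N, 1%N) ->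
     ~ is_integer (alpha`_i - alpha`_j)) ->
  let A := rsubv (1 + alpha`_0 + p%:~R) (drop 2 alpha) in
  let B := rsubv (1 + alpha`_0 + p%:~R) beta in
  (forall a, a \in A -> ~ is_integer a) ->
  (forall b, b \in B -> ~ is_integer b) ->
  V3_finite alpha beta n m ->
  0 < `|z| < 1 ->
  let n1 := n`_0 in
  let n2 := n`_1 in
  let e := e_of n m in
  let phi_B :=
    phi (shiftv (addzv B m) (- n2%:~R))
        ((1 + p + n1 - n2)%:~R :: shiftv (addzv A (drop 2 n)) (- n2%:~R)) z in
  let phi_1B :=
    phi (rsubv (1 + p%:~R) B) ((1 + p)%:~R :: rsubv (2 + p%:~R) A) z in
  phi_B * limn (series (fun k : nat =>
              (Psi1 p A B k * z ^ p + Psi2 p A B k) * z ^ (k%:Z - n2)))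
  + phi_1B * limn (series (fun k : nat =>
              (Psi3 p A B n m k * z ^ (p + n1 - n2) - Psi4 p A B n m k)
                * z ^ (k%:Z - n1)))
  = (-1) ^ (r%:Z + p) * Cpi R ^+ 2
      * (sinv [seq Cpi R * a | a <- A] / sinv [seq Cpi R * b | b <- B])
      * (((1 - z) ^ (e + 1))^-1
           * (\sum_(j <- zrange (- vmax n) (e - vmin m))
                 Delta p alpha beta n m j * z ^ j)
         - V3 alpha beta n m z)
    + Cpi R * z ^ (p - n2)
      * ((\sum_(eta <- A) Ccot (Cpi R * eta))
         - (\sum_(delta <- B) Ccot (Cpi R * delta)))
      * phi_1B * phi_B.

Proof.
move=> r1 al1 al_nonint A B A_nonint B_nonint fin zz n1 n2 e phi_B phi_1B.
have sa := size_tuple alpha; have sb := size_tuple beta.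
have sn := size_tuple n; have sm := size_tuple m.
have z0 : z != 0 by case/andP: zz => + _; rewrite normr_gt0.
have z1 : nrm z < 1 by case/andP: zz => _; rewrite nrmE -[1]/((1 : R)%:C) ltcR.
pose Af (j : nat) : CC R := 1 + alpha`_0 + p%:~R - alpha`_j.
pose Bf (j : nat) : CC R := 1 + alpha`_0 + p%:~R - beta`_j.
have hA j : (1 < j < r)%N -> ~ is_integer (Af j).
  by move=> jr; apply: A_nonint; rewrite /A (AE p sa) map_f// mem_index_iota.
have hB j : (j < r)%N -> ~ is_integer (Bf j).
  by move=> jr; apply: B_nonint; rewrite /B (BE p alpha sb) map_f// mem_index_iota.
have hfin i j : (1 < i < r)%N -> (j < r)%N -> poch_finite (1 - beta`_j + alpha`_i) (m`_j - n`_i).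
  by move=> ir jr; apply: fin; rewrite ?sa ?sb.
pose K := absz p; pose s : int := p + n`_0 - n`_1; pose K' := absz s.
have pK : `|p| <= K%:Z by [].
have sK : `|p + n`_0 - n`_1| <= K'%:Z by [].
have [SU [hU main]] := @confluent_sum R r p Af Bf (nth 0 n) (nth 0 m) r1 hA hB z z0 z1 K K' pK sK.
(* A common bound: all Laurent series below have exponents at least - L, both the convolution
   shifted by n_2 and the terms of [V3], which start at - n_i. *)
pose L := (K + K' + absz n2 + absz (vmax n))%N.
pose V i := z ^ (- n`_i) * (VC r (nth 0 alpha) (nth 0 beta) (nth 0 n) (nth 0 m) i *
  (psum z (VF r (nth 0 alpha) (nth 0 beta) i) * psum z (VG r (nth 0 alpha) (nth 0 beta) (nth 0 n) (nth 0 m) i))).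
have nL i : (i < r)%N -> n`_i <= L%:Z.
  move=> ir; have : n`_i <= vmax n by apply: vmax_ge; rewrite mem_nth// sn.
  by rewrite /L; lia.
have hclim : has_lsum z L (clim r p alpha beta n m K K') (z ^ (- n2) * SU + V3 alpha beta n m z).
  rewrite (V3_sum sa sb sn sm); apply: lsumD.
    have h : (K + K')%N%:Z - (- n2) <= L%:Z by rewrite /L; lia.
    by apply: lsum_ext (lsum_shift z0 hU h) => l; rewrite opprK.
  apply: (@lsum_big R z L r (fun i => 1 < i)%N _ V) => i ir i1.
  apply: VT_lsum => //; last exact: nL.
  by move=> j jr ji; apply: (nonint_pair_sym al_nonint); rewrite ?i1// eq_sym.
pose E := absz (e + 1).
(* The exponent e + 1 is natural because e >= -1 by definition. *)
have eE : e + 1 = E%:Z by rewrite /E /e /e_of; lia.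
have hD : has_lsum z L (Delta p alpha beta n m) ((1 - z) ^+ E * (z ^ (- n2) * SU + V3 alpha beta n m z)).
  apply: lsum_ext (lsum_binomial z0 E hclim) => J.
  by rewrite (Delta_clim sa sb sn sm r1 al1 al_nonint hB hfin eE pK sK).
(* The series of Delta_j is summed a second time, now as a finite sum; uniqueness of the sum gives
   the rational form, which is then divided by (1 - z)^E. *)
have hD' : has_lsum z L (Delta p alpha beta n m)
    (\sum_(j <- zrange (- vmax n) (e - vmin m)) Delta p alpha beta n m j * z ^ j).
  apply: lsum_zrange => //; first by rewrite /L; lia.
    by move=> i; exact: Delta_small.
  by move=> i; exact: (Delta_big sa sb sn sm r1 al1 al_nonint hB eE).
have z1' : 1 - z != 0.
  by rewrite subr_eq0; apply/eqP => zE; move: z1; rewrite -zE nrm1 ltxx.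
have e1 : ((1 - z) ^ (e + 1))^-1
           * (\sum_(j <- zrange (- vmax n) (e - vmin m)) Delta p alpha beta n m j * z ^ j)
         - V3 alpha beta n m z = z ^ (- n2) * SU.
  rewrite (lsum_unique hD' hD) eE -exprnP mulKf ?expf_neq0//.
  by rewrite addrK.
rewrite e1.
have eY : phi_B = SYf r p Af Bf (nth 0 n) (nth 0 m) z by exact: (@phi_BE R r p alpha beta n m sa sb sn sm z).
have eX : phi_1B = SXf r p Af Bf z by exact: (@phi_1BE R r p alpha beta sa sb z).
pose X1 := SXd1 r p Af Bf z; pose X2 := SXd2 r p Af Bf z.
pose Y1 := SYd1 r p Af Bf (nth 0 n) (nth 0 m) z; pose Y2 := SYd2 r p Af Bf (nth 0 n) (nth 0 m) z.
have S1 : limn (series (fun k : nat =>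
              (Psi1 p A B k * z ^ p + Psi2 p A B k) * z ^ (k%:Z - n2))) = - z ^ (- n2) * (z ^ p * X1 + X2).
  apply: gsum_lim.
  have g1 := psum_gsum z0 z1 (subexp_Xd1 p Af r1 hB); have g2 := psum_gsum z0 z1 (subexp_Xd2 p r1 hA hB).
  apply: gsum_ext (gsumZ (- z ^ (- n2)) (gsumD (gsumZ (z ^ p) g1) g2)) => k.
  rewrite (Psi1E p sa sb) (Psi2E p sa sb) expfzDr// -exprnP; ring.
have S2 : limn (series (fun k : nat =>
              (Psi3 p A B n m k * z ^ (p + n1 - n2) - Psi4 p A B n m k)
                * z ^ (k%:Z - n1))) = z ^ (- n1) * (z ^ s * Y1 + Y2).
  apply: gsum_lim.
  have g1 := psum_gsum z0 z1 (subexp_Yd1 p (nth 0 n) (nth 0 m) r1 hA hB).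
  have g2 := psum_gsum z0 z1 (subexp_Yd2 p Af (nth 0 n) (nth 0 m) r1 hB).
  apply: gsum_ext (gsumZ (z ^ (- n1)) (gsumD (gsumZ (z ^ s) g1) g2)) => k.
  rewrite (Psi3E p sa sb sn sm) (Psi4E p sa sb sn sm) -/s.
  by rewrite (expfzDr k%:Z)// -exprnP; ring.
rewrite S1 S2 eX eY (sinv_A p sa) (sinv_B p alpha sb) (cot_A p sa) (cot_B p alpha sb).
rewrite -/(Ksin r Af Bf) -/(Cotd r Af Bf).
set Y := SYf _ _ _ _ _ _ _ in main *; set X := SXf _ _ _ _ _ in main *.
(* As s = p + n_1 - n_2, the prefactors of the second Psi series match those of the first: - n_1 + s
   = - n_2 + p. *)
have zs : z ^ (- n1) * z ^ s = z ^ (- n2) * z ^ p by rewrite -!expfzDr//; congr (_ ^ _); rewrite /s; ring.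
have zs' : z ^ (- n1) = z ^ (- n2) * z ^ p * z ^ (- s) by rewrite -!expfzDr//; congr (_ ^ _); rewrite /s; ring.
have -> : Y * (- z ^ (- n2) * (z ^ p * X1 + X2)) + X * (z ^ (- n1) * (z ^ s * Y1 + Y2))
  = z ^ (- n2) * (z ^ p * X * (Y1 + z ^ (- s) * Y2) - (z ^ p * X1 + X2) * Y).
  by rewrite [z ^ (- n1) * (_ + _)]mulrDr [z ^ (- n1) * (_ * Y1)]mulrA zs zs'; ring.
rewrite main /Ksgn (expfzDr p (- n2))//.
move: (z ^ (- n2)) (z ^ p) (Ksin _ _ _) (Cotd _ _ _) ((-1) ^ (r%:Z + p)) => x1 x2 x3 x4 x5.
by ring.
Qed.
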